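(* Let $n\ge 2$, $G=\mathrm{Spin}(2n,1)$, let $a_1>a_2>\cdots>a_{n-1}>|a_n|>0$ be real numbers, $\vec a=(a_1,\dots,a_n)$, $f=\iota(t_{\vec a})\in\mathfrak g^*$, and $\mathcal O_f=G\cdot f$. The image $q(\mathcal O_f)$ of the moment map $q:\mathcal O_f\to\mathfrak p^*$ consists of all depth one coadjoint orbits of $P$ with the sign of the Pfaffian equal to the sign of $a_n$, and with singular values $(x_1,\dots,x_{n-1})$ such that $$a_1\ge x_1\ge a_2\ge x_2\ge\cdots\ge a_{n-1}\ge x_{n-1}\ge|a_n|.$$ Moreover, $q$ maps different $P$-orbits in $\mathcal O_f$ to different $P$-orbits in $\mathfrak p^*$.
   Context: Put $m=2n-1$. $G=\mathrm{Spin}(m+1,1)$ is the two-fold covering of $\mathrm{SO}_e(m+1,1)$, the identity component of $\{X\in M_{m+2}(\mathbb{R}):XI_{m+1,1}X^t=I_{m+1,1}\}$, $I_{m+1,1}=\mathrm{diag}(1,\dots,1,-1)$; $\mathfrak g=\mathfrak{so}(m+1,1)$. $H_0$ has only nonzero entries $1$ at positions $(m+1,m+2),(m+2,m+1)$; $\mathfrak a=\mathbb{R}H_0$; $\mathfrak m=\mathfrak{so}(m)$ (upper-left block); for a row vector $\alpha\in\mathbb{R}^m$, $X_\alpha=\begin{pmatrix}0_{m\times m}&-\alpha^t&\alpha^t\\ \alpha&0&0\\ \alpha&0&0\end{pmatrix}$ and $\mathfrak n=\{X_\alpha\}$. $P=MAN$ is the minimal parabolic subgroup with Lie algebra $\mathfrak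 p=\mathfrak l+\mathfrak n$, $\mathfrak l=\mathfrak m+\mathfrak a$, $M\cong\mathrm{Spin}(m)$. Put $H'=\begin{pmatrix}0&1\\-1&0\end{pmatrix}$ and $t_{\vec a}=\mathrm{diag}\{a_1H',\dots,a_nH',0\}\in\mathfrak g$. $(X,Y)=\frac12\mathrm{tr}(XY)$; $\iota:\mathfrak g\to\mathfrak g^*$, $\iota(X)(Y)=(X,Y)$; $\mathrm{pr}:\mathfrak g\to\mathfrak p^*$, $\mathrm{pr}(X)=\iota(X)|_{\mathfrak p}$. The moment map $q:\mathcal O_f\to\mathfrak p^*$ is restriction of linear forms to $\mathfrak p$. A coadjoint $P$-orbit in $\mathfrak p^*$ has depth zero if it is contained in $\mathfrak l^*=\{f:f|_{\mathfrak n}=0\}$, and depth one otherwise. For $Y\in\mathfrak{so}(m)$ and $\beta\in\mathbb{R}^m$, put $$X_{Y,\beta,0}=\begin{pmatrix}Y&\beta^t&\beta^t\\-\beta&0&0\\ \beta&0&0\end{pmatrix},\qquad Z_{Y,\beta}=\begin{pmatrix}Y&\beta^t/|\beta|\\-\beta/|\beta|&0\end{pmatrix}\ (\beta\ne0).$$ Each depth one $P$-orbit contains some $\mathrm{pr}(X_{Y,\beta,0})$ with $\beta\ne0$, $Y\beta^t=0$, and is determined by the singular values $x_1,x_1,\dots,x_{n-1},x_{n-1},0$ of $Y$, with $x_1\ge\cdots\ge x_{n-1}\ge0$ (the orbit is said to have singular values $(x_1,\dots,x_{n-1})$), together with the sign ($1$, $-1$ or $0$) of the Pfaffian of $Z_{Y,\beta}$,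 normalized by $\mathrm{Pf}(\mathrm{diag}(c_1H',\dots,c_nH'))=c_1\cdots c_n$. *)

(* Defs.v *)
From HB Require Import structures.
From mathcomp Require Import all_boot all_order all_fingroup all_algebra.
From mathcomp Require Import all_classical all_reals all_analysis.

Set Implicit Arguments.
Unset Strict Implicit.
Unset Printing Implicit Defensive.

Import Order.TTheory GRing.Theory Num.Theory.
Import numFieldNormedType.Exports.

Local Open Scope classical_set_scope.
Local Open Scope ring_scope.

HB.mixin Record isTopologicalGroup G & monoid.Group G & Topological G := {
  mulg_continuous : continuous (fun z : G * G => (z.1 * z.2)%g);
  invg_continuous : continuous (fun g : G => (g^-1)%g)
}.

#[short(type="topologicalGroupType")]
HB.structure Definition TopologicalGroup :=
  {G of monoid.Group G & Topological G & isTopologicalGroup G}.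

Section Matrices.
Variables (R : realType) (m : nat).

(* Matrices of size m + 2, in blocks of sizes m, 1, 1. *)
Definition mx3 (A : 'M[R]_m) (b c : 'cV[R]_m) (d : 'rV[R]_m) (e f : R)
    (g : 'rV[R]_m) (h k : R) : 'M[R]_(m + 1 + 1) :=
  block_mx (block_mx A b d e%:M) (col_mx c f%:M) (row_mx g h%:M) k%:M.

Definition I_m1 : 'M[R]_(m + 1 + 1) := mx3 1%:M 0 0 0 1 0 0 0 (-1).

Definition O_m1 : set 'M[R]_(m + 1 + 1) :=
  [set X | X *m I_m1 *m X^T = I_m1].

Definition SOe : set 'M[R]_(m + 1 + 1) := connected_component O_m1 1%:M.

Definition H0 : 'M[R]_(m + 1 + 1) := mx3 0 0 0 0 0 1 0 1 0.

Definition X_ (alpha : 'rV[R]_m) : 'M[R]_(m + 1 + 1) :=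
  mx3 0 (- alpha^T) alpha^T alpha 0 0 alpha 0 0.

Definition so : {vspace 'M[R]_m} := lker (linfun (fun Y : 'M[R]_m => Y + Y^T)).

Definition g_ : {vspace 'M[R]_(m + 1 + 1)} :=
  lker (linfun (fun X : 'M[R]_(m + 1 + 1) => X *m I_m1 + I_m1 *m X^T)).
Definition m_ : {vspace 'M[R]_(m + 1 + 1)} :=
  (linfun (fun Y : 'M[R]_m => mx3 Y 0 0 0 0 0 0 0 0) @: so)%VS.
Definition a_ : {vspace 'M[R]_(m + 1 + 1)} := <[H0]>%VS.
Definition n_ : {vspace 'M[R]_(m + 1 + 1)} := limg (linfun X_).
Definition l_ : {vspace 'M[R]_(m + 1 + 1)} := (m_ + a_)%VS.
Definition p_ : {vspace 'M[R]_(m + 1 + 1)} := (l_ + n_)%VS.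

Definition SO : set 'M[R]_m := [set k | k *m k^T = 1%:M /\ \det k = 1].

(* exp (t H0) *)
Definition expA (t : R) : 'M[R]_(m + 1 + 1) :=
  let ch := (expR t + expR (- t)) / 2 in
  let sh := (expR t - expR (- t)) / 2 in
  mx3 1%:M 0 0 0 ch sh 0 sh ch.

(* exp (X_alpha), since X_alpha ^ 3 = 0 *)
Definition expN (alpha : 'rV[R]_m) : 'M[R]_(m + 1 + 1) :=
  1%:M + X_ alpha + 2^-1 *: (X_ alpha *m X_ alpha).

(* The image of P = MAN in SO_e(m+1,1). *)
Definition MAN : set 'M[R]_(m + 1 + 1) :=
  [set X | exists k t alpha,
     SO k /\ X = mx3 k 0 0 0 1 0 0 0 1 *m expA t *m expN alpha].

Definition dual (V : {vspace 'M[R]_(m + 1 + 1)}) := 'Hom(subvs_of V, R^o).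

(* vsproj V sends a vector of V to itself, seen in the type subvs_of V; all
   uses below are on vectors of V. *)
Definition coad (V : {vspace 'M[R]_(m + 1 + 1)}) (A : 'M[R]_(m + 1 + 1))
    (xi : dual V) : dual V :=
  linfun (fun v : subvs_of V => xi (vsproj V (invmx A *m vsval v *m A))).

Definition iota_ (X : 'M[R]_(m + 1 + 1)) : dual g_ :=
  linfun (fun v : subvs_of g_ => (2^-1 * \tr (X *m vsval v) : R^o)).

Definition restr (xi : dual g_) : dual p_ :=
  linfun (fun v : subvs_of p_ => xi (vsproj g_ (vsval v))).

Definition pr (X : 'M[R]_(m + 1 + 1)) : dual p_ := restr (iota_ X).

Definition l_dual : set (dual p_) :=
  [set xi | forall v : subvs_of p_, vsval v \in n_ -> xi v = 0].

Definition depth_one (O : set (dual p_)) : Prop := ~ (O `<=` l_dual).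

Definition X_Yb0 (Y : 'M[R]_m) (beta : 'rV[R]_m) : 'M[R]_(m + 1 + 1) :=
  mx3 Y beta^T beta^T (- beta) 0 0 beta 0 0.

(* Euclidean norm; the norm `|beta| of the library is the sup norm. *)
Definition norm2 (beta : 'rV[R]_m) : R := Num.sqrt ((beta *m beta^T) 0 0).

Definition Z_Yb (Y : 'M[R]_m) (beta : 'rV[R]_m) : 'M[R]_(m + 1) :=
  block_mx Y ((norm2 beta)^-1 *: beta^T) (- ((norm2 beta)^-1 *: beta)) 0.

End Matrices.

Arguments O_m1 R m _ : clear implicits.
Arguments SOe R m _ : clear implicits.
Arguments SO R m _ : clear implicits.
Arguments MAN R m _ : clear implicits.
Arguments l_dual R m _ : clear implicits.

(* 1 / (2^k k!) * \sum_s sgn(s) \prod_(i < k) A (s (2i)) (s (2i + 1)), N = 2k *)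
Definition Pf (R : realType) (N : nat) (A : 'M[R]_N) : R :=
  (2 ^+ N./2 * (N./2)`!%:R)^-1 *
  \sum_(s : 'S_N) (-1) ^+ s *
    \prod_(i < N) \prod_(j < N | ~~ odd i && (j == i.+1 :> nat)) A (s i) (s j).

(* The N x N matrix diag{c_1 H', ..., c_n H', 0, ..., 0}. Finite sequences of
   reals are given by functions on nat, with indices starting from 1; the
   values at other indices play no role. *)
Definition skew_diag (R : realType) (N n : nat) (c : nat -> R) : 'M[R]_N :=
  \matrix_(i < N, j < N) \sum_(1 <= k < n.+1)
    c k * (((i == k.-1.*2 :> nat) && (j == k.-1.*2.+1 :> nat))%:R
           - ((j == k.-1.*2 :> nat) && (i == k.-1.*2.+1 :> nat))%:R).

(* s lists the singular values of Y: the square roots of the eigenvalues of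
   Y^T Y, with multiplicity. *)
Definition singular_values (R : realType) (N : nat) (Y : 'M[R]_N) (s : seq R) :
    Prop :=
  all (fun x => 0 <= x) s /\
  char_poly (Y^T *m Y) = \prod_(x <- s) ('X - (x ^+ 2)%:P).

(* Singular values (x_1, ..., x_(n-1)) and sign e of the Pfaffian. *)
Definition orbit_type (R : realType) (n m : nat) (O : set (dual (p_ R m)))
    (x : nat -> R) (e : R) : Prop :=
  exists (Y : 'M[R]_m) (beta : 'rV[R]_m),
    [/\ [/\ Y \in so R m, beta != 0 & Y *m beta^T = 0],
        O (pr (X_Yb0 Y beta)),
        forall i, (1 <= i)%N -> (i.+1 < n)%N -> x i.+1 <= x i,
        singular_values Y
          (flatten [seq [:: x i; x i] | i <- iota 1 n.-1] ++ [:: 0]) &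
        Num.sg (Pf (Z_Yb Y beta)) = e].

(* pi : G -> S is a connected two-fold covering group of the matrix group S:
   near each point of S there are two continuous sections of pi, indexed by
   bool, whose images are open, disjoint and cover the preimage. *)
Record two_fold_covering (R : realType) (N : nat) (G : topologicalGroupType)
    (pi : G -> 'M[R]_N) (S : set 'M[R]_N) : Prop := TwoFoldCovering {
  cover_connected : connected [set: G];
  cover_continuous : continuous pi;
  cover_mul : forall g h : G, pi (g * h)%g = pi g *m pi h;
  cover_range : forall g, S (pi g);
  cover_even : forall X, S X ->
    exists (U : set 'M[R]_N) (s : bool -> 'M[R]_N -> G),
      [/\ open U /\ U X,
          forall b, {within U `&` S, continuous (s b)},
          forall b, open (s b @` (U `&` S)),
          forall b Y, (U `&` S) Y -> pi (s b Y) = Y &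
          forall g, U (pi g) -> exists! b, s b (pi g) = g]
}.

Section Orbits.
Variables (R : realType) (m : nat) (G : topologicalGroupType).
Variable pi : G -> 'M[R]_(m + 1 + 1).

(* P contains the kernel of the covering, so it is the full preimage. *)
Definition P_ : set G := pi @^-1` MAN R m.

(* The adjoint action of G on g is X |-> pi(g) X pi(g)^-1. *)
Definition orbit_of (V : {vspace 'M[R]_(m + 1 + 1)}) (S : set G)
    (xi : dual V) : set (dual V) :=
  [set coad (pi g) xi | g in S].

Definition is_P_orbit (V : {vspace 'M[R]_(m + 1 + 1)}) (O : set (dual V)) :
    Prop :=
  exists xi, O = orbit_of P_ xi.

End Orbits.

(* Main.v *)
Require Import Defs.
From HB Require Import structures.
From mathcomp Require Import all_boot all_order all_fingroup all_algebra.
From mathcomp Require Import all_classical all_reals all_analysis.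
From mathcomp Require Import zify ring lra.

Set Implicit Arguments.
Unset Strict Implicit.
Unset Printing Implicit Defensive.

Import Order.TTheory GRing.Theory Num.Theory.
Import numFieldNormedType.Exports.

Local Open Scope classical_set_scope.
Local Open Scope ring_scope.


(** Identify [g_] with its dual by the invariant form, so that O_f is the
conjugacy class of the matrix [t = skew_diag a], and [P] with the stabilizer of
the ray of the isotropic vector [v0] (lemma [MANP]).  Two elements of [g_] have
the same image in the dual of [p_] exactly when they differ by an element
[X_ alpha] of [n_].

The [P]-orbits in O_f are then the orbits of the centralizer of [t], a torus, on
the future isotropic rays: to [X = g t g^-1] one attaches the vector
[z = g^-1 v0], and only the weights [r_i], the squared lengths of the components
of [z] in the planes where [t] rotates by [a_i], matter ([torus_transitive]).
On the other side, each point of the image can be moved by the unipotent part of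
[P] to the normal form [X_Yb0 Y beta] with [Y beta^T = 0] ([normal_form]).
The bridge between the two descriptions is the function
[<v0, (x - X)^-1 v0>].  Computed in the frame of the torus it is a sum of simple
fractions with coefficients [r_i]; computed by Cramer's rule it is a quotient of
determinants whose numerator involves [Y] and [beta] only ([resolvent_v0]).
Equating the two expressions gives ([secular_identity])

  4 |beta|^2 det (x - Y) = x * sum_i r_i a_i^2 prod_(k != i) (x^2 + a_k^2).

Everything about singular values follows from this identity.  The polynomial
sum_i s_i prod_(k != i) (z - a_k^2) with all [s_i >= 0] changes sign between
consecutive [a_k^2], so its roots [x_j^2] interlace them ([secular_roots]);
conversely Lagrange interpolation writes any polynomial with interlacing roots in
this form ([secular_of_roots]).  Its coefficients are determined by its values at
the [a_i^2], so the image of [X] determines the weights, hence the [P]-orbit of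
[X] ([separate]).

The sign of the Pfaffian is found by restricting the skew form
[(u, v) |-> <u, X v>] to the orthogonal of [v0].  For the normal form this is
[Z_Yb Y beta] up to scaling the last vector; for [g t g^-1] it is congruent to the
torus block by a matrix of positive determinant, because [t] kills the time axis
and [g] preserves the future ([sg_Pf_Z]).

Finally a pair [(Y, beta)] is determined up to conjugation by [SO] by its singular
values, the length of [beta] and the sign of the Pfaffian ([skew_conj], from the
normal form of real skew-symmetric matrices).  So an orbit of the prescribed type
is reached by choosing a vector [z] with the interpolated weights and moving it to
[v0] by two spacelike reflections ([realize]).

Three general facts are needed on the way: the behaviour of the Pfaffian under
congruence ([Pf_congr]), the description of the identity component of O(m+1,1)
by the determinant and the time direction ([SOeP]), which rests on the fact that
the product of two spacelike reflections is joined to the identity by a path of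
such products, and the orthogonal normal form of skew-symmetric matrices
([skew_normal_form]). *)

(** * The Pfaffian under congruence *)

Section Mate.
Variable N : nat.
Implicit Types i j : 'I_N.

(** The partner of an index in the pairs {0, 1}, {2, 3}, and so on.  When [N] is
odd the last index has no partner and is its own mate. *)
Definition mate i : 'I_N := insubd i (if odd i then i.-1 else i.+1).

Lemma val_mate i :
  mate i = (if odd i then i.-1 else if (i.+1 < N)%N then i.+1 else i) :> nat.
Proof.
rewrite /mate val_insubd; case: (odd i) => //; rewrite ifT //.
by apply: leq_ltn_trans (ltn_ord i); exact: leq_pred.
Qed.

Lemma mateK : involutive mate.
Proof.
move=> i; apply: val_inj; rewrite /= val_mate !val_mate.
have := ltn_ord i; have := odd_double_half i.
repeat case: ifP => /=; lia.
Qed.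

Lemma half_mate i : (mate i)./2 = i./2.
Proof.
rewrite val_mate; have := odd_double_half i; repeat case: ifP => /=; lia.
Qed.

Lemma odd_mate i : ~~ odd N -> odd (mate i) = ~~ odd i.
Proof.
rewrite val_mate; have := odd_double_half i; have := odd_double_half N.
have := ltn_ord i; repeat case: ifP => /=; lia.
Qed.

Lemma half_eq_mate i j : (i./2 == j./2) = (i == j) || (i == mate j).
Proof.
rewrite -!(inj_eq val_inj) /= val_mate.
have := odd_double_half i; have := odd_double_half j.
have := ltn_ord i; have := ltn_ord j.
by repeat case: ifP => /=; lia.
Qed.

Lemma mate_neq i : (i < N./2.*2)%N -> mate i != i.
Proof.
rewrite -(inj_eq val_inj) /= val_mate.
have := odd_double_half i; have := odd_double_half N.
by repeat case: ifP => /=; lia.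
Qed.

End Mate.

Section Pfaffian.
Variables (R : realType) (N : nat).
Hypothesis evenN : ~~ odd N.
Implicit Types A B : 'M[R]_N.

Let Pf_cst : R := (2 ^+ N./2 * (N./2)`!%:R)^-1.

Lemma Pf_mate A :
  Pf A = Pf_cst * \sum_(s : 'S_N) (-1) ^+ s *
    \prod_(i < N | ~~ odd i) A (s i) (s (mate i)).
Proof.
rewrite /Pf; congr (_ * _); apply: eq_bigr => s _; congr (_ * _).
rewrite (bigID (fun i : 'I_N => ~~ odd i)) /= [X in _ * X]big1 ?mulr1; last first.
  by move=> i /negPn oi; rewrite big_pred0 // => j; rewrite oi.
apply: eq_bigr => i ei; rewrite (big_pred1 (mate i)) // => j /=.
rewrite ei /= -(inj_eq val_inj) /= val_mate (negbTE ei).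
have := odd_double_half i; have := odd_double_half N.
have := ltn_ord i; have := ltn_ord j.
by case: ifP => /=; lia.
Qed.

(** A choice of two indices for each mated pair amounts to a function on all
indices, which is the form in which determinants appear in [Pf_congr]. *)
Lemma prod_even_sum_sum (F : 'I_N -> 'I_N -> 'I_N -> R) :
  \prod_(i < N | ~~ odd i) \sum_(u < N) \sum_(v < N) F i u v =
  \sum_(phi : {ffun 'I_N -> 'I_N})
    \prod_(i < N | ~~ odd i) F i (phi i) (phi (mate i)).
Proof.
have [N0|N0] := posnP N.
  have z (i : 'I_N) : False by case: i => i; rewrite N0.
  rewrite big_pred0; last by move=> i; case: (z i).
  rewrite (big_pred1 [ffun i => i]) => [|phi]; first by rewrite big_pred0 // => i; case: (z i).
  by apply/esym/eqP/ffunP => i; case: (z i).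
pose i0 : 'I_N := Ordinal N0.
under eq_bigr do rewrite pair_bigA /=.
rewrite (big_distr_big (i0, i0)) /=.
(* Functions into pairs are normalized to (i0, i0) at odd indices. *)
pose h (phi : {ffun 'I_N -> 'I_N}) : {ffun 'I_N -> 'I_N * 'I_N} :=
  [ffun i : 'I_N => if odd i then (i0, i0) else (phi i, phi (mate i))].
pose h' (f : {ffun 'I_N -> 'I_N * 'I_N}) : {ffun 'I_N -> 'I_N} :=
  [ffun i : 'I_N => if odd i then (f (mate i)).2 else (f i).1].
rewrite (reindex_onto h h') /=; last first.
  move=> f /pffun_onP[/supportP fs _]; apply/ffunP => i; rewrite !ffunE.
  case: ifP => oi; first by rewrite fs // unfold_in oi.
  by rewrite odd_mate // oi /= mateK; case: (f i).
apply: eq_big => [phi|phi _]; last first.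
  by apply: eq_bigr => i /negbTE ei; rewrite ffunE ei.
apply/andP; split.
  apply/pffun_onP; split; last by [].
  by apply/supportP => i; rewrite unfold_in negbK ffunE => ->.
apply/eqP/ffunP => i; rewrite !ffunE; case: ifP => oi; last by rewrite oi.
by rewrite odd_mate // oi /= mateK.
Qed.

Lemma sum_perm_prod_det B (phi : {ffun 'I_N -> 'I_N}) :
  \sum_(s : 'S_N) (-1) ^+ s * \prod_(i < N) B (s i) (phi i) =
  \det (\matrix_(i, j) B j (phi i)).
Proof.
by apply: eq_bigr => s _; congr (_ * _); apply: eq_bigr => i _; rewrite mxE.
Qed.

Lemma prod_mate (F : 'I_N -> R) :
  \prod_(i < N) F i = \prod_(i < N | ~~ odd i) (F i * F (mate i)).
Proof.
rewrite big_split /= (bigID (fun i : 'I_N => ~~ odd i)) /=; congr (_ * _).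
rewrite (reindex_inj (can_inj (@mateK N))) /=.
by apply: eq_bigl => i; rewrite odd_mate // negbK.
Qed.

(** Expanding every entry of [B A B^T] and summing over the permutation first
leaves determinants of matrices with columns of [B], which vanish unless the
columns are a permutation of those of [B]. *)
Lemma Pf_congr A B : Pf (B *m A *m B^T) = \det B * Pf A.
Proof.
rewrite !Pf_mate mulrCA; congr (_ * _).
pose T (s : 'S_N) (phi : {ffun 'I_N -> 'I_N}) :=
  (-1) ^+ s * (\prod_(i < N | ~~ odd i) A (phi i) (phi (mate i)) *
     \prod_(i < N) B (s i) (phi i)).
transitivity (\sum_s \sum_phi T s phi).
  apply: eq_bigr => s _; rewrite -mulr_sumr; congr (_ * _).
  under eq_bigr => i _.
    rewrite mxE; under eq_bigr do rewrite mxE mulr_suml.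
    rewrite exchange_big /=.
    over.
  rewrite (prod_even_sum_sum (fun i u v => B (s i) u * A u v * B^T v (s (mate i)))).
  apply: eq_bigr => phi _; rewrite prod_mate -big_split /=.
  by apply: eq_bigr => i _; rewrite mxE; ring.
rewrite exchange_big /=.
transitivity (\sum_(phi : {ffun 'I_N -> 'I_N})
  \prod_(i < N | ~~ odd i) A (phi i) (phi (mate i)) *
  \det (\matrix_(i, j) B j (phi i))).
  apply: eq_bigr => phi _; rewrite -sum_perm_prod_det mulr_sumr.
  by apply: eq_bigr => s _; rewrite /T mulrCA.
rewrite (bigID (fun phi : {ffun 'I_N -> 'I_N} => injectiveb phi)) /= addrC big1 ?add0r.
  rewrite (reindex (@pval _)) /=; last first.
    exists (fun phi => if insub phi is Some s then s else 1%g : 'S_N).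
      by move=> s _; rewrite valK.
    by move=> phi; rewrite inE => phiI; rewrite insubT.
  rewrite mulr_sumr; apply: eq_big => [s|s _]; first exact: (valP s).
  have -> : \matrix_(i, j) B j (pval s i) = perm_mx s *m B^T.
    by apply/matrixP => i j; rewrite -row_permE !mxE pvalE.
  rewrite det_mulmx det_perm det_tr [LHS]mulrC -mulrA mulrCA.
  by congr (_ * (_ * _)); apply: eq_bigr => i _; rewrite pvalE.
move=> phi /injectivePn[i [j ij eij]].
rewrite (determinant_alternate ij) ?mulr0 // => k.
by rewrite !mxE eij.
Qed.

End Pfaffian.

(** * The Pfaffian of the standard skew-symmetric matrix *)

Section StandardPfaffian.
Variables (R : realType) (N : nat).
Hypothesis evenN : ~~ odd N.
Implicit Types (i j : 'I_N) (s t : 'S_N).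

Definition mate_perm : 'S_N := perm (can_inj (@mateK N)).

Lemma mate_permJ i j : (tperm i j ^ mate_perm)%g = tperm (mate i) (mate j).
Proof. by rewrite tpermJ !permE. Qed.

Lemma commute_mate_perm s i : commute s mate_perm -> s (mate i) = mate (s i).
Proof. by move/permP/(_ i); rewrite !permM !permE. Qed.

(** Such a permutation permutes the even indices and the odd ones in the same
way; moving one even point to its place costs two transpositions. *)
Lemma even_parity_preserving s : commute s mate_perm ->
  (forall i, odd (s i) = odd i) -> odd_perm s = false.
Proof.
have [k] := ubnP #|[pred i | s i != i]|; elim: k s => // k IH s leks sC sp.
have [i si|fix_s] := pickP (fun i => s i != i); last first.
  suff -> : s = 1%g by rewrite odd_perm1.
  by apply/permP => i; rewrite perm1; apply/eqP/negbFE/fix_s.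
have smi := commute_mate_perm i sC.
have odd_neq a b : odd a != odd b -> a != b by apply: contraNneq => ->.
have imi : i != mate i by rewrite odd_neq // odd_mate //; case: (odd i).
have imsi : i != mate (s i) by rewrite odd_neq // odd_mate // sp; case: (odd i).
have simi : s i != mate i by rewrite odd_neq // odd_mate // sp; case: (odd i).
have simsi : s i != mate (s i) by rewrite odd_neq // odd_mate // sp; case: (odd i).
set t1 := tperm i (s i); set t2 := tperm (mate i) (mate (s i)).
have t12 : (t1 * t2 = t2 * t1)%g.
  by rewrite conjgC /t1 tpermJ !tpermD // eq_sym.
pose s' := (s * (t1 * t2))%g.
have s'C : commute s' mate_perm.
  apply/commute_sym/commuteM/commute_sym; first exact/commute_sym.
  by apply/commgP/conjg_fixP; rewrite conjMg !mate_permJ !mateK -t12.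
have s'p j : odd (s' j) = odd j.
  have tp (a b c : 'I_N) : odd a = odd b -> odd (tperm a b c : 'I_N) = odd c.
    by move=> ab; case: tpermP => // ->.
  by rewrite /s' !permM /t1 /t2 !tp ?odd_mate ?sp.
have s'E : odd_perm s' = odd_perm s.
  rewrite !odd_permM !odd_tperm eq_sym si (inj_eq (can_inj (@mateK N))).
  by rewrite eq_sym si addbb addbF.
rewrite -s'E; apply: IH => //.
rewrite -ltnS; apply: leq_trans leks; rewrite ltnS; apply: proper_card.
apply/fintype.properP; split; last first.
  exists i; rewrite inE ?si // /s' !permM /t1 tpermR /t2 negbK tpermD //.
    by rewrite eq_sym.
  by rewrite eq_sym.
apply/fintype.subsetP => j; rewrite !inE; apply: contraNneq => sj.
have ji : i != j by apply: contraNneq si => ->; rewrite sj.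
have jsi : s i != j.
  by apply: contraNneq ji => /esym jE; apply/eqP/(@perm_inj _ s); rewrite sj.
have jmi : mate i != j.
  by apply: contraNneq jsi => /esym jE; move: sj;
    rewrite jE smi => /(can_inj (@mateK N)) e; rewrite e eqxx in si.
have jmsi : mate (s i) != j.
  apply: contraNneq jmi => jE; apply/eqP/(@perm_inj _ s).
  by rewrite smi sj.
by rewrite /s' !permM /t1 /t2 sj tpermD // tpermD.
Qed.

(** Exchanging the two values of a permutation on a mated pair changes its
signature and the parity of one of its values on even indices; this reduces to
the parity-preserving case. *)
Lemma sign_commute_mate s : commute s mate_perm ->
  (-1) ^+ s * \prod_(i < N | ~~ odd i) (-1) ^+ odd (s i) = 1 :> R.
Proof.
have [k] := ubnP #|[pred i : 'I_N | ~~ odd i & odd (s i)]|.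
elim: k s => // k IH s leks sC.
have [i /andP[ei osi]|nflip] := pickP (fun i : 'I_N => ~~ odd i && odd (s i)); last first.
  have es i : ~~ odd i -> odd (s i) = false by move=> ei; have := nflip i; rewrite ei.
  rewrite even_parity_preserving // ?mul1r; last first.
    move=> i; case oi: (odd i); last by rewrite es ?oi.
    rewrite -[i]mateK commute_mate_perm // odd_mate // es // odd_mate // oi //.
  by rewrite big1 // => i ei; rewrite es.
have smi := commute_mate_perm i sC.
pose t := tperm (s i) (mate (s i)); pose s' := (s * t)%g.
have simsi : s i != mate (s i).
  by apply/eqP => e; have := odd_mate (s i) evenN; rewrite -e osi.
have s'i : s' i = mate (s i) by rewrite /s' permM /t tpermL.
have s'ej j : ~~ odd j -> j != i -> s' j = s j.
  move=> ej ji; rewrite /s' permM /t tpermD //.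
    by rewrite (inj_eq perm_inj) eq_sym.
  rewrite -smi (inj_eq perm_inj); apply: contraNneq ej => <-.
  by rewrite odd_mate.
have s'C : commute s' mate_perm.
  apply/commute_sym/commuteM/commute_sym; first exact/commute_sym.
  by apply/commgP/conjg_fixP; rewrite /t mate_permJ mateK tpermC.
rewrite -[RHS](IH s') //.
  rewrite (bigD1 i) //= [in RHS](bigD1 i) //= s'i odd_mate // osi.
  rewrite /s' odd_permM odd_tperm simsi addbT.
  have -> : (-1) ^+ (~~ odd_perm s) = - (-1) ^+ (odd_perm s) :> R.
    by case: (odd_perm s) => /=; rewrite ?expr1 ?expr0 ?opprK.
  rewrite /= expr0 expr1 mul1r mulN1r mulrN mulNr; congr (- (_ * _)).
  by apply: eq_bigr => j /andP[ej ji]; have := s'ej j ej ji; rewrite /s' => ->.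
rewrite -ltnS; apply: leq_trans leks; rewrite ltnS; apply: proper_card.
apply/fintype.properP; split; last first.
  by exists i; rewrite inE ?ei ?osi // s'i odd_mate // osi.
apply/fintype.subsetP => j; rewrite !inE => /andP[ej].
have [->|ji] := eqVneq j i; first by rewrite s'i odd_mate // osi.
by rewrite s'ej // ej.
Qed.

End StandardPfaffian.

Section SkewDiag.
Variables (R : realType) (N n : nat).
Hypothesis leN : (n.*2 <= N)%N.
Implicit Types (c : nat -> R) (i j : 'I_N).

Lemma skew_diagE c i j : skew_diag N n c i j =
  if (i./2 < n)%N && (j == mate i) then (-1) ^+ odd i * c i./2.+1 else 0.
Proof.
rewrite mxE big_add1 /= big_mkord.
have iE := odd_double_half i; have jE := odd_double_half j.
have := ltn_ord i; have := ltn_ord j => ltj lti.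
case: ifPn => [/andP[ltin /eqP jm]|].
  have jv := congr1 (@nat_of_ord N) jm; rewrite /= val_mate in jv.
  rewrite (bigD1 (Ordinal ltin)) //= big1 ?addr0.
    rewrite mulrC; congr (_ * _).
    move: jv iE jE; case: (odd i) => /= jv iE jE.
      have -> : (nat_of_ord i == i./2.*2) = false by apply/eqP; lia.
      have -> : (nat_of_ord j == i./2.*2) by apply/eqP; lia.
      have -> : (nat_of_ord i == i./2.*2.+1) by apply/eqP; lia.
      by rewrite /= sub0r expr1.
    move: jv; case: ifP => hi jv; last by lia.
    have -> : (nat_of_ord i == i./2.*2) by apply/eqP; lia.
    have -> : (nat_of_ord j == i./2.*2.+1) by apply/eqP; lia.
    have -> : (nat_of_ord j == i./2.*2) = false by apply/eqP; lia.
    by rewrite /= subr0 expr0.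
  move=> k; rewrite -(inj_eq val_inj) /= => ki.
  have -> : (nat_of_ord i == k.*2) = false by apply/eqP; lia.
  have -> : (nat_of_ord i == k.*2.+1) = false by apply/eqP; lia.
  by rewrite /= andbF subrr mulr0.
rewrite -(inj_eq val_inj) /= val_mate => nij; apply: big1 => k _.
have := ltn_ord k => ltk.
have -> : (nat_of_ord i == k.*2) && (nat_of_ord j == k.*2.+1) = false.
  apply/negP => /andP[/eqP ik /eqP jk]; case/negP: nij.
  move: iE; case: (odd i) => /= iE; first lia.
  by rewrite ifT; lia.
have -> : (nat_of_ord j == k.*2) && (nat_of_ord i == k.*2.+1) = false.
  apply/negP => /andP[/eqP ik /eqP jk]; case/negP: nij.
  by move: iE; case: (odd i) => /= iE; lia.
by rewrite subrr mulr0.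
Qed.

End SkewDiag.

Section PfSkewDiag.
Variables (R : realType) (n : nat).

(** A permutation has a nonzero contribution only if it commutes with [mate], and
its contribution is then 1, so that nothing cancels. *)
Lemma Pf_skew_diag1_gt0 : 0 < Pf (skew_diag n.*2 n (fun=> 1 : R)).
Proof.
have eN : ~~ odd n.*2 by rewrite odd_double.
have lth (i : 'I_n.*2) : (i./2 < n)%N.
  by have := ltn_ord i; have := odd_double_half i; lia.
rewrite Pf_mate //; apply: mulr_gt0.
  by rewrite invr_gt0 mulr_gt0 ?exprn_gt0 // ltr0n fact_gt0.
have term_ge0 (s : 'S_n.*2) : 0 <= (-1) ^+ s * \prod_(i < n.*2 | ~~ odd i)
    skew_diag n.*2 n (fun=> 1 : R) (s i) (s (mate i)).
  have [/existsP[i /andP[ei si]]|] :=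
      boolP [exists i : 'I_n.*2, ~~ odd i && (s (mate i) != mate (s i))].
    by rewrite (bigD1 i) //= skew_diagE // (negbTE si) andbF mul0r mulr0.
  rewrite negb_exists => /forallP sC.
  have sC1 (i : 'I_n.*2) : ~~ odd i -> s (mate i) = mate (s i).
    by move=> ei; apply/eqP; have := sC i; rewrite ei negbK.
  rewrite -[X in _ <= X](_ : 1 = _) //.
  rewrite -[LHS](@sign_commute_mate R _ eN s).
    congr (_ * _); apply: eq_bigr => i ei.
    by rewrite skew_diagE // lth sC1 // eqxx mulr1.
  apply/permP => i; rewrite !permM !permE.
  have [oi|ei] := boolP (odd i); last by rewrite sC1.
  have := sC1 (mate i); rewrite odd_mate // oi mateK => /(_ isT) ->.
  by rewrite mateK.
rewrite (bigD1 1%g) //= ltr_pwDl ?sumr_ge0 //.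
rewrite odd_perm1 mul1r big1 // => i ei.
by rewrite !perm1 skew_diagE // lth eqxx (negbTE ei) mulr1.
Qed.

(** A diagonal congruence scales the standard matrix to any [skew_diag]. *)
Lemma Pf_skew_diag (c : nat -> R) :
  Pf (skew_diag n.*2 n c) =
  (\prod_(1 <= i < n.+1) c i) * Pf (skew_diag n.*2 n (fun=> 1 : R)).
Proof.
have eN : ~~ odd n.*2 by rewrite odd_double.
have lth (i : 'I_n.*2) : (i./2 < n)%N.
  by have := ltn_ord i; have := odd_double_half i; lia.
pose D : 'M[R]_n.*2 := diag_mx (\row_i if odd i then 1 else c i./2.+1).
have -> : skew_diag n.*2 n c = D *m skew_diag n.*2 n (fun=> 1) *m D^T.
  apply/matrixP => i j; rewrite tr_diag_mx mul_mx_diag [RHS]mxE mul_diag_mx [X in X * _]mxE.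
  rewrite !skew_diagE // lth /= !mxE.
  case: eqVneq => [->|_]; last by rewrite mulr0 mul0r.
  by rewrite half_mate odd_mate //; case: (odd i) => /=; ring.
rewrite Pf_congr //; congr (_ * _); rewrite det_diag.
under eq_bigr do rewrite mxE.
rewrite -(big_mkord xpredT (fun i => if odd i then 1 else c i./2.+1)) big_add1 /=.
elim: (n) => [|k IH]; first by rewrite !big_geq.
by rewrite doubleS !big_nat_recr //= IH odd_double /= doubleK mulr1.

Qed.

End PfSkewDiag.

(** * Polynomials with interlacing roots *)

Section PolynomialFacts.
Variable R : realType.
Implicit Types (p q : {poly R}).

(** Identities obtained at the values [- x ^ 2] or away from an eigenvalue are
promoted to identities of polynomials in this way. *)
Lemma poly_eq_on_neg p q : (forall x, x < 0 -> p.[x] = q.[x]) -> p = q.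
Proof.
move=> pq; apply/eqP; rewrite -subr_eq0; apply: contraT => nz.
have := @max_poly_roots _ (p - q) [seq - (k.+1)%:R | k <- iota 0 (size (p - q))] nz.
rewrite size_map size_iota ltnn; apply; last first.
  rewrite map_inj_uniq ?iota_uniq // => i j /oppr_inj /eqP.
  by rewrite eqr_nat => /eqP[].
apply/allP => _ /mapP[k _ ->]; by rewrite rootE !hornerE pq ?subrr.
Qed.

Lemma poly_eq_on_pts p q (n : nat) (b : nat -> R) :
  (forall i j, (i < j < n)%N -> b j < b i) ->
  (size p <= n)%N -> (size q <= n)%N ->
  (forall i, (i < n)%N -> p.[b i] = q.[b i]) -> p = q.
Proof.
move=> bdec sp sq pq; apply/eqP; rewrite -subr_eq0; apply: contraT => nz.
have rs : all (root (p - q)) [seq b k | k <- iota 0 n].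
  apply/allP => x /mapP[k]; rewrite mem_iota => /andP[_ kn] ->.
  by rewrite rootE !hornerE pq ?subrr.
have us : uniq [seq b k | k <- iota 0 n].
  rewrite map_inj_in_uniq ?iota_uniq // => i j.
  rewrite !mem_iota /= add0n => ltin ltjn bij.
  have [ij|ji|//] := ltngtP i j.
    by have := bdec i j; rewrite ij ltjn bij ltxx => /(_ isT).
  by have := bdec j i; rewrite ji ltin bij ltxx => /(_ isT).
have := max_poly_roots nz rs us; rewrite size_map size_iota ltnNge.
suff -> : (size (p - q)%R <= n)%N by [].
by rewrite (leq_trans (size_polyD _ _)) // size_polyN geq_max sp sq.
Qed.

(** Alternation of the signs of [Q] at the points [b i] forces one root in each
gap.  Splitting off a root [y] of the first gap keeps the alternation at
[b 1, b 2, ...]; only if [y = b 1] can the sign at [b 1] become wrong, and then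
the quotient has itself a root in the first gap, beyond [b 1]. *)
Lemma interlacing_roots (n : nat) (b : nat -> R) (Q : {poly R}) :
  (forall i j, (i < j <= n)%N -> b j < b i) ->
  (size Q <= n.+1)%N ->
  (forall i, (i <= n)%N -> 0 <= (-1) ^+ i * Q.[b i]) ->
  exists c (y : nat -> R), (forall j, (j < n)%N -> b j.+1 <= y j <= b j) /\
    Q = c *: \prod_(0 <= j < n) ('X - (y j)%:P).
Proof.
elim: n b Q => [|n IH] b Q bdec sQ Qs.
  exists Q`_0, (fun=> 0); split => //.
  by rewrite big_geq // -mul_polyC mulr1; apply: size1_polyC.
have b10 : b 1%N < b 0%N by apply: bdec.
suff [y [Q1 [yI QE Q1s]]] : exists y (Q1 : {poly R}),
    [/\ b 1%N <= y <= b 0%N, Q = Q1 * ('X - y%:P) & 0 <= Q1.[b 1%N]].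
  have sQ1 : (size Q1 <= n.+1)%N.
    have [->|Q10] := eqVneq Q1 0; first by rewrite size_poly0.
    by move: sQ; rewrite QE size_Mmonic ?monicXsubC // size_XsubC addn2.
  have [] := IH (fun i => b i.+1) Q1 _ sQ1.
  - by move=> i j ij; apply: bdec; rewrite !ltnS.
  - move=> [|i] ltin; first by rewrite expr0 mul1r.
    have := Qs i.+2 ltin; rewrite QE hornerM hornerXsubC.
    have lty : b i.+2 - y < 0.
      rewrite subr_lt0; apply: lt_le_trans (_ : b 1%N <= _); last by case/andP: yI.
      by apply: bdec.
    rewrite mulrA -[(-1) ^+ i.+2]/(-1 * (-1) ^+ i.+1) mulN1r !mulNr oppr_ge0.
    by rewrite nmulr_lle0.
  move=> c [z [zI Q1E]]; exists c, (fun j => if j is j'.+1 then z j' else y).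
  split; first by case=> [|j] ltj //; apply: zI.
  by rewrite QE Q1E big_nat_recl //= -scalerAl mulrC.
have Q0 := Qs 0%N isT; rewrite expr0 mul1r in Q0.
have Q1 := Qs 1%N isT; rewrite expr1 mulN1r oppr_ge0 in Q1.
have [y yI ry] : exists2 y, b 1%N <= y <= b 0%N & root Q y.
  by apply: poly_ivt; [exact: ltW|rewrite Q1].
have [Q' QE] := factor_theorem _ _ ry.
have [Q'1|Q'1] := leP 0 Q'.[b 1%N]; first by exists y, Q'.
have yb : y = b 1%N.
  apply/eqP; rewrite eq_le; case/andP: (yI) => -> _; rewrite andbT.
  rewrite leNgt; apply/negP => yb; move: Q1; rewrite QE hornerM hornerXsubC leNgt.
  by rewrite nmulr_rgt0 // subr_lt0 yb.
have Q'0 : 0 <= Q'.[b 0%N].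
  by move: Q0; rewrite QE hornerM hornerXsubC yb pmulr_lge0 // subr_gt0.
have [z zI rz] : exists2 z, b 1%N <= z <= b 0%N & root Q' z.
  by apply: poly_ivt; [exact: ltW|rewrite Q'0 ltW].
have [Q2 Q'E] := factor_theorem _ _ rz.
have Q20 : 0 <= Q2.[b 1%N].
  rewrite leNgt; apply/negP => Q2n; move: Q'1; rewrite Q'E hornerM hornerXsubC ltNge.
  by rewrite nmulr_rge0 // subr_le0; case/andP: zI => ->.
exists z, (Q2 * ('X - y%:P)); split => //.
  by rewrite QE Q'E mulrAC.
by rewrite hornerM hornerXsubC yb subrr mulr0.
Qed.

Lemma alternating_prod (n i : nat) (F : nat -> R) : (i <= n)%N ->
  (forall j, (j < i)%N -> F j <= 0) ->
  (forall j, (i <= j < n)%N -> 0 <= F j) ->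
  0 <= (-1) ^+ i * \prod_(0 <= j < n) F j.
Proof.
move=> lein Fle Fge.
rewrite (big_cat_nat (leq0n i) lein) /=.
rewrite mulrA; apply: mulr_ge0; last first.
  rewrite big_nat_cond prodr_ge0 // => j; rewrite andbT; exact: Fge.
elim: i {lein Fge} Fle => [|i IH] Fle; first by rewrite big_geq // mulr1.
rewrite big_nat_recr //= exprS.
set P := \prod_(_ <= _ < _) _; rewrite [leRHS](_ : _ = (-1) ^+ i * P * - F i); last by ring.
apply: mulr_ge0.
  by apply: IH => j ltj; apply: Fle; apply: ltnW.
by rewrite oppr_ge0 Fle.
Qed.

End PolynomialFacts.

(** * Block calculus for matrices of size m + 2 *)

Section Blocks.
Variables (R : realType) (m : nat).
Implicit Types (A : 'M[R]_m) (b c : 'cV[R]_m) (d g : 'rV[R]_m) (e f h k : R).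

Local Notation mx3 := (@mx3 R m).

Definition col3 b e f : 'cV[R]_(m + 1 + 1) := col_mx (col_mx b e%:M) f%:M.

Definition dot d b : R := (d *m b) 0 0.

Lemma dotE d b : d *m b = (dot d b)%:M.
Proof. exact: mx11_scalar. Qed.

Lemma mx3_inj A b c d e f g h k A' b' c' d' e' f' g' h' k' :
  mx3 A b c d e f g h k = mx3 A' b' c' d' e' f' g' h' k' ->
  [/\ [/\ A = A', b = b' & c = c'], [/\ d = d', e = e' & f = f'] &
      [/\ g = g', h = h' & k = k']].
Proof.
have sc (x y : R) : (x%:M = y%:M :> 'M[R]_1) -> (x = y).
  by move/matrixP/(_ 0 0); rewrite !mxE eqxx !mulr1n.
rewrite /mx3 => /eq_block_mx[/eq_block_mx[-> -> -> /sc ->]].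
by move=> /eq_col_mx[-> /sc ->] /eq_row_mx[-> /sc ->] /sc ->.
Qed.

Lemma col3_inj b e f b' e' f' : col3 b e f = col3 b' e' f' ->
  [/\ b = b', e = e' & f = f'].
Proof.
have sc (x y : R) : (x%:M = y%:M :> 'M[R]_1) -> (x = y).
  by move/matrixP/(_ 0 0); rewrite !mxE eqxx !mulr1n.
by move=> /eq_col_mx[/eq_col_mx[-> /sc ->] /sc ->].
Qed.

Lemma mx3P (X : 'M[R]_(m + 1 + 1)) : exists A b c d e f g h k,
  X = mx3 A b c d e f g h k.
Proof.
exists (ulsubmx (ulsubmx X)), (ursubmx (ulsubmx X)), (usubmx (ursubmx X)).
exists (dlsubmx (ulsubmx X)), (drsubmx (ulsubmx X) 0 0), (dsubmx (ursubmx X) 0 0).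
exists (lsubmx (dlsubmx X)), (rsubmx (dlsubmx X) 0 0), (drsubmx X 0 0).
by rewrite /mx3 -!mx11_scalar submxK vsubmxK hsubmxK submxK.
Qed.

Lemma col3P (v : 'cV[R]_(m + 1 + 1)) : exists b e f, v = col3 b e f.
Proof.
exists (usubmx (usubmx v)), (dsubmx (usubmx v) 0 0), (dsubmx v 0 0).
by rewrite /col3 -!mx11_scalar !vsubmxK.
Qed.

Lemma add_mx3 A b c d e f g h k A' b' c' d' e' f' g' h' k' :
  mx3 A b c d e f g h k + mx3 A' b' c' d' e' f' g' h' k' =
  mx3 (A + A') (b + b') (c + c') (d + d') (e + e') (f + f') (g + g') (h + h')
    (k + k').
Proof.
by rewrite /mx3 !(add_block_mx, add_col_mx, add_row_mx) !raddfD.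
Qed.

Lemma scale_mx3 x A b c d e f g h k :
  x *: mx3 A b c d e f g h k =
  mx3 (x *: A) (x *: b) (x *: c) (x *: d) (x * e) (x * f) (x *: g) (x * h)
    (x * k).
Proof.
by rewrite /mx3 !(scale_block_mx, scale_col_mx, scale_row_mx) !scale_scalar_mx.
Qed.

Lemma opp_mx3 A b c d e f g h k :
  - mx3 A b c d e f g h k =
  mx3 (- A) (- b) (- c) (- d) (- e) (- f) (- g) (- h) (- k).
Proof. by rewrite -scaleN1r scale_mx3 !scaleN1r !mulN1r. Qed.

Lemma mx3_0 : 0 = mx3 0 0 0 0 0 0 0 0 0.
Proof. by rewrite /mx3 !raddf0 !(block_mx0, col_mx0, row_mx0). Qed.

Lemma mx3_scalar x : x%:M = mx3 x%:M 0 0 0 x 0 0 0 x.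
Proof. by rewrite /mx3 !raddf0 col_mx0 row_mx0 -!scalar_mx_block. Qed.

Lemma tr_mx3 A b c d e f g h k : (mx3 A b c d e f g h k)^T =
  mx3 A^T d^T g^T b^T e h c^T f k.
Proof.
by rewrite /mx3 !(tr_block_mx, tr_col_mx, tr_row_mx, tr_scalar_mx).
Qed.

Lemma mul_mx3 A b c d e f g h k A' b' c' d' e' f' g' h' k' :
  mx3 A b c d e f g h k *m mx3 A' b' c' d' e' f' g' h' k' =
  mx3 (A *m A' + b *m d' + c *m g') (A *m b' + e' *: b + h' *: c)
      (A *m c' + f' *: b + k' *: c)
      (d *m A' + e *: d' + f *: g') (dot d b' + e * e' + f * h')
      (dot d c' + e * f' + f * k')
      (g *m A' + h *: d' + k *: g') (dot g b' + h * e' + k * h')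
      (dot g c' + h * f' + k * k').
Proof.
rewrite /mx3 !mulmx_block !mul_col_row !mul_block_col !mul_row_block !mul_row_col.
rewrite !mul_mx_scalar !mul_scalar_mx !dotE.
rewrite !(scale_row_mx, scale_col_mx, add_block_mx, add_col_mx, add_row_mx).
rewrite !scale_scalar_mx -!raddfD /=.
by congr (block_mx (block_mx _ _ _ _) (col_mx _ _) (row_mx _ _) _);
  congr (_%:M); ring.
Qed.

Lemma mul_mx3_col3 A b c d e f g h k b' e' f' :
  mx3 A b c d e f g h k *m col3 b' e' f' =
  col3 (A *m b' + e' *: b + f' *: c) (dot d b' + e * e' + f * f')
    (dot g b' + h * e' + k * f').
Proof.
rewrite /mx3 /col3 !mul_block_col !mul_col_mx !mul_row_col.
rewrite !mul_mx_scalar !dotE !scale_scalar_mx.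
rewrite !(add_col_mx, scale_col_mx, scale_scalar_mx) -!raddfD /=.
by congr (col_mx (col_mx _ _) _); congr (_%:M); ring.
Qed.

End Blocks.

(** * The Lorentz group, its Lie algebra and the parabolic subalgebra *)

Lemma linfunE (R : realType) (aT rT : vectType R) (f : aT -> rT) :
  linear f -> linfun f =1 f.
Proof.
move=> lf.
pose L := GRing.isLinear.Build R aT rT *:%R f lf.
pose F : {linear aT -> rT} := HB.pack f L.
exact: (lfunE F).
Qed.

Lemma trmxN (R : realType) m n (A : 'M[R]_(m, n)) : (- A)^T = - A^T.
Proof. by rewrite linearN. Qed.

Lemma trmxD (R : realType) m n (A B : 'M[R]_(m, n)) : (A + B)^T = A^T + B^T.
Proof. by rewrite linearD. Qed.

Lemma trmxZ (R : realType) m n x (A : 'M[R]_(m, n)) : (x *: A)^T = x *: A^T.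
Proof. by rewrite linearZ. Qed.

Section Dot.
Variables (R : realType) (m : nat).
Implicit Types (d : 'rV[R]_m) (b : 'cV[R]_m).

Lemma dotDl d d' b : dot (d + d') b = dot d b + dot d' b.
Proof. by rewrite /dot mulmxDl mxE. Qed.

Lemma dotDr d b b' : dot d (b + b') = dot d b + dot d b'.
Proof. by rewrite /dot mulmxDr mxE. Qed.

Lemma dotNl d b : dot (- d) b = - dot d b.
Proof. by rewrite /dot mulNmx mxE. Qed.

Lemma dotNr d b : dot d (- b) = - dot d b.
Proof. by rewrite /dot mulmxN mxE. Qed.

Lemma dotZl x d b : dot (x *: d) b = x * dot d b.
Proof. by rewrite /dot -scalemxAl mxE. Qed.

Lemma dotZr x d b : dot d (x *: b) = x * dot d b.
Proof. by rewrite /dot -scalemxAr mxE. Qed.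

Lemma dot0l b : dot 0 b = 0.
Proof. by rewrite /dot mul0mx mxE. Qed.

Lemma dot0r d : dot d 0 = 0.
Proof. by rewrite /dot mulmx0 mxE. Qed.

Lemma dotC d b : dot b^T d^T = dot d b.
Proof. by rewrite /dot -trmx_mul mxE. Qed.

Lemma dotxx d : dot d d^T = \sum_j d 0 j ^+ 2.
Proof. by rewrite /dot mxE; apply: eq_bigr => j _; rewrite mxE. Qed.

Lemma dotxx_ge0 d : 0 <= dot d d^T.
Proof. by rewrite dotxx sumr_ge0 // => j _; rewrite sqr_ge0. Qed.

Lemma dotxx_eq0 d : (dot d d^T == 0) = (d == 0).
Proof.
apply/eqP/eqP => [|->]; last by rewrite dot0l.
rewrite dotxx => /psumr_eq0P d0; apply/rowP => j; rewrite mxE.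
by apply/eqP; rewrite -sqrf_eq0 d0 // => i _; rewrite sqr_ge0.
Qed.

Lemma mxtrace_sqr_ge0 (A : 'M[R]_m) : 0 <= \tr (A *m A^T).
Proof.
apply: sumr_ge0 => i _; rewrite mxE sumr_ge0 // => j _.
by rewrite mxE -expr2 sqr_ge0.
Qed.

Lemma mxtrace_sqr_eq0 (A : 'M[R]_m) : \tr (A *m A^T) = 0 -> A = 0.
Proof.
move=> /psumr_eq0P A0; apply/matrixP => i j; rewrite mxE.
have ge0 k : 0 <= (A *m A^T) k k.
  by rewrite mxE sumr_ge0 // => l _; rewrite mxE -expr2 sqr_ge0.
have := A0 (fun k _ => ge0 k) i isT; rewrite mxE => /psumr_eq0P Ai.
apply/eqP; rewrite -sqrf_eq0 expr2.
by have := Ai _ j isT; rewrite mxE => -> // k _; rewrite mxE -expr2 sqr_ge0.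
Qed.

End Dot.

Section Lorentz.
Variables (R : realType) (m : nat).
Local Notation M := (m + 1 + 1)%N.
Local Notation I := (I_m1 R m).
Local Notation mx3 := (@mx3 R m).
Implicit Types (A Y K : 'M[R]_m) (b c : 'cV[R]_m) (d alpha beta : 'rV[R]_m).
Implicit Types (X p : 'M[R]_M).

(** The isotropic vector whose ray has stabilizer [MAN]. *)
Definition v0 : 'cV[R]_M := col3 0 1 1.

Lemma tr_I : I^T = I.
Proof. by rewrite /I_m1 tr_mx3 !trmx0 trmx1. Qed.

Lemma mul_II : I *m I = 1%:M.
Proof.
rewrite /I_m1 mul_mx3 mx3_scalar !(mul0mx, mulmx0, scaler0, addr0, add0r, dot0r, mulmx1).
by congr (mx3 _ _ _ _ _ _ _ _ _); ring.
Qed.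

Lemma O_unit X : O_m1 R m X -> X \in unitmx.
Proof.
move=> OX; suff : X *m (I *m X^T *m I) = 1%:M by case/mulmx1_unit.
by rewrite !mulmxA OX mul_II.
Qed.

Lemma O_inv X : O_m1 R m X -> invmx X = I *m X^T *m I.
Proof.
move=> OX; have uX := O_unit OX.
have e : X *m (I *m X^T *m I) = 1%:M by rewrite !mulmxA OX mul_II.
by rewrite -[RHS](mulKmx uX) e mulmx1.
Qed.

Lemma O_invI X : O_m1 R m X -> I *m invmx X = X^T *m I.
Proof. by move=> OX; rewrite O_inv // !mulmxA mul_II mul1mx. Qed.

Lemma O_trmx X : O_m1 R m X -> X^T *m I *m X = I.
Proof.
by move=> OX; rewrite -O_invI // -mulmxA mulVmx ?mulmx1 // O_unit.
Qed.

Lemma O_mul X p : O_m1 R m X -> O_m1 R m p -> O_m1 R m (X *m p).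
Proof.
move=> OX Op; rewrite /O_m1 /= trmx_mul.
have -> : X *m p *m I *m (p^T *m X^T) = X *m (p *m I *m p^T) *m X^T.
  by rewrite !mulmxA.
by rewrite Op.
Qed.

Lemma O_invmx X : O_m1 R m X -> O_m1 R m (invmx X).
Proof.
move=> OX; rewrite /O_m1 /= O_inv // !trmx_mul trmxK tr_I.
transitivity (I *m (X^T *m (I *m I) *m I *m X) *m I); first by rewrite !mulmxA.
by rewrite mul_II mulmx1 O_trmx // mul_II mul1mx.
Qed.

Lemma O_1 : O_m1 R m 1%:M.
Proof. by rewrite /O_m1 /= trmx1 mul1mx mulmx1. Qed.

Lemma O_I : O_m1 R m I.
Proof. by rewrite /O_m1 /= tr_I mul_II mul1mx. Qed.

Lemma det_I_neq0 : \det I != 0.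
Proof. by have := O_unit O_I; rewrite unitmxE unitfE. Qed.

Lemma O_det X : O_m1 R m X -> \det X = 1 \/ \det X = -1.
Proof.
move=> OX; have := congr1 determinant OX; rewrite !det_mulmx det_tr => e.
have : \det X ^+ 2 == 1.
  by rewrite -(inj_eq (mulIf det_I_neq0)) mul1r -[X in _ == X]e expr2; apply/eqP; ring.
by rewrite sqrf_eq1 => /orP[]/eqP; [left|right].
Qed.

Lemma gP X : reflect (X *m I + I *m X^T = 0) (X \in g_ R m).
Proof.
rewrite memv_ker linfunE => [|x u v]; first exact: eqP.
by rewrite linearP /= mulmxDl mulmxDr -scalemxAl -scalemxAr scalerDr addrACA.
Qed.

Lemma soP Y : reflect (Y^T = - Y) (Y \in so R m).
Proof.
rewrite memv_ker linfunE => [|x u v].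
  apply: (iffP eqP) => [e|->]; last by rewrite subrr.
  by apply/eqP; rewrite -addr_eq0 addrC e.
by rewrite linearP /= scalerDr addrACA.
Qed.

(** The general element of [g_], for [A] skew-symmetric. *)
Definition mk_g A b c e : 'M[R]_M := mx3 A b c (- b^T) 0 e c^T e 0.

Lemma gP3 X : reflect (exists A b c e, A^T = - A /\ X = mk_g A b c e)
  (X \in g_ R m).
Proof.
apply: (iffP (gP _)) => [|[A' [b' [c' [e' [A'E ->]]]]]]; last first.
  rewrite /mk_g /I_m1 tr_mx3 !mul_mx3 add_mx3 mx3_0 !trmxN !trmxK A'E.
  rewrite !(mul0mx, mulmx0, mulmx1, mul1mx, scaler0, addr0, add0r, dot0r, dot0l, dotNl).
  rewrite !(scale0r, scaleN1r, scale1r, add0r, addr0, mulr0, mul0r).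
  congr (mx3 _ _ _ _ _ _ _ _ _); rewrite ?addrN ?addNr //; ring.
have [A [b [c [d [e [f [g [h [k ->]]]]]]]]] := mx3P X.
rewrite /I_m1 tr_mx3 !mul_mx3 add_mx3 mx3_0.
rewrite !(mul0mx, mulmx0, mulmx1, mul1mx, scaler0, addr0, add0r, dot0r, dot0l,
  scale1r, scaleN1r, scale0r, mulr0, mulr1, mul0r, mul1r).
move=> /mx3_inj[[A0 b0 c0] [d0 e0 f0] [g0 h0 k0]].
exists A, b, c, f; split.
  by apply/eqP; rewrite -addr_eq0 addrC A0.
rewrite /mk_g; congr (mx3 _ _ _ _ _ _ _ _ _).
- by apply/eqP; rewrite -addr_eq0 d0.
- by move: e0; lra.
- by apply/eqP; rewrite -subr_eq0 g0.
- by move: h0; lra.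
- by move: k0; lra.
Qed.

Lemma X_E alpha : X_ alpha = mx3 0 (- alpha^T) alpha^T alpha 0 0 alpha 0 0.
Proof. by []. Qed.

Definition mk_p A e alpha : 'M[R]_M :=
  mx3 A (- alpha^T) alpha^T alpha 0 e alpha e 0.

Lemma X_linear : linear (@X_ R m).
Proof.
move=> x u v; rewrite /X_ scale_mx3 add_mx3 !scaler0 !mulr0 !addr0.
by rewrite [in LHS]linearD /= [in LHS]linearZ /= opprD -scalerN.
Qed.

Lemma nP X : reflect (exists alpha, X = X_ alpha) (X \in n_ R m).
Proof.
apply: (iffP memv_imgP) => [[u _ ->]|[u ->]]; exists u.
- by rewrite linfunE //; exact: X_linear.
- exact: memvf.
- by rewrite linfunE //; exact: X_linear.
Qed.

Lemma pP X : reflect (exists A e alpha, A^T = - A /\ X = mk_p A e alpha)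
  (X \in p_ R m).
Proof.
have mlin : linear (fun Y : 'M[R]_m => mx3 Y 0 0 0 0 0 0 0 0).
  move=> x u v; rewrite scale_mx3 add_mx3 !scaler0 !mulr0 !addr0 //.
apply: (iffP idP).
  move=> /memv_addP[_ /memv_addP[_ /memv_imgP[A As ->] [_ /vlineP[e ->] ->]] [u /nP[al ->] ->]].
  exists A, e, al; split; first exact/soP.
  rewrite linfunE // /H0 scale_mx3 X_E !add_mx3 !scaler0 !mulr0 !mulr1 !(add0r, addr0) //.
move=> [A [e [al [As ->]]]].
have -> : mk_p A e al = mx3 A 0 0 0 0 0 0 0 0 + e *: H0 R m + X_ al.
  by rewrite /H0 scale_mx3 X_E !add_mx3 !scaler0 !mulr0 !mulr1 !(add0r, addr0).
apply: memv_add; last by apply/nP; exists al.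
apply: memv_add; last by apply/vlineP; exists e.
apply/memv_imgP; exists A; first exact/soP.
by rewrite linfunE.
Qed.

Lemma mk_g_v0 A b c e : mk_g A b c e *m v0 = col3 (b + c) e e.
Proof.
by rewrite mul_mx3_col3 mulmx0 !scale1r !dot0r !mulr1 !add0r addr0.
Qed.

Lemma scale_v0 x : x *: v0 = col3 0 x x.
Proof.
by rewrite /v0 /col3 !scale_col_mx scaler0 !scale_scalar_mx mulr1.
Qed.

(** In this form the invariance of [p_] under the parabolic subgroup is
immediate. *)
Lemma p_stab X : reflect (X \in g_ R m /\ exists e, X *m v0 = e *: v0)
  (X \in p_ R m).
Proof.
apply: (iffP (pP _)).
  move=> [A [e [al [As ->]]]].
  have -> : mk_p A e al = mk_g A (- al^T) al^T e.
    by rewrite /mk_p /mk_g trmxN !trmxK opprK.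
  split; first by apply/gP3; exists A, (- al^T), al^T, e.
  by exists e; rewrite mk_g_v0 addNr scale_v0.
move=> [/gP3[A [b [c [e [As ->]]]]] [x]]; rewrite mk_g_v0 scale_v0.
move=> /col3_inj[bc _ _]; exists A, e, c^T; split => //.
have -> : b = - c by apply/eqP; rewrite -addr_eq0 bc.
by rewrite /mk_p /mk_g trmxN trmxK opprK.
Qed.

Lemma p_sub_g X : X \in p_ R m -> X \in g_ R m.
Proof. by case/p_stab. Qed.

Lemma g_conj p X : O_m1 R m p -> X \in g_ R m -> p *m X *m invmx p \in g_ R m.
Proof.
move=> Op /gP Xg; apply/gP; rewrite O_inv // !trmx_mul !trmxK tr_I.
have -> : p *m X *m (I *m p^T *m I) *m I = p *m (X *m I) *m p^T.
  by rewrite -!mulmxA mul_II mulmx1 !mulmxA.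
have -> : I *m (I *m (p *m I) *m (X^T *m p^T)) = p *m (I *m X^T) *m p^T.
  by rewrite !mulmxA mul_II mul1mx.
by rewrite -mulmxDl -mulmxDr Xg mulmx0 mul0mx.
Qed.

Lemma p_conj p (x : R) X : O_m1 R m p -> x != 0 -> p *m v0 = x *: v0 ->
  X \in p_ R m -> p *m X *m invmx p \in p_ R m.
Proof.
move=> Op x0 pv /p_stab[Xg [e Xv]]; apply/p_stab; split; first exact: g_conj.
have ipv : invmx p *m v0 = x^-1 *: v0.
  rewrite -[v0 in LHS]scale1r -(mulVf x0) -scalerA -pv -scalemxAr mulKmx //.
  exact: O_unit.
exists e; rewrite -!mulmxA ipv -!scalemxAr Xv -scalemxAr pv !scalerA.
by rewrite mulrAC mulVf ?mul1r.
Qed.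

End Lorentz.

(** * The parabolic subgroup as the stabilizer of an isotropic ray *)

Section Parabolic.
Variables (R : realType) (m : nat).
Local Notation M := (m + 1 + 1)%N.
Local Notation I := (I_m1 R m).
Local Notation mx3 := (@mx3 R m).
Local Notation v0 := (v0 R m).
Implicit Types (A Y k : 'M[R]_m) (b c : 'cV[R]_m) (d alpha beta : 'rV[R]_m).
Implicit Types (X p : 'M[R]_M) (t x : R).

Definition mx3E := (mul0mx, mulmx0, mulmx1, mul1mx, scaler0, addr0, add0r,
  dot0r, dot0l, scale0r, scale1r, scaleN1r, mulr0, mul0r, mulr1, mul1r).

Definition mk_k k : 'M[R]_M := mx3 k 0 0 0 1 0 0 0 1.

Lemma mk_k_mul k A b c d e f g h l :
  mk_k k *m mx3 A b c d e f g h l = mx3 (k *m A) (k *m b) (k *m c) d e f g h l.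
Proof. by rewrite mul_mx3 !mx3E. Qed.

Lemma mk_k_v0 k : mk_k k *m v0 = v0.
Proof. by rewrite mul_mx3_col3 !mx3E. Qed.

Lemma det_mk_k k : \det (mk_k k) = \det k.
Proof.
rewrite /mk_k /Defs.mx3 raddf0 col_mx0 det_lblock det_lblock !det_scalar1.
by rewrite !mulr1.
Qed.

Lemma O_mk_k k : k *m k^T = 1%:M -> O_m1 R m (mk_k k).
Proof.
move=> kk; rewrite /O_m1 /= /mk_k /I_m1 tr_mx3 !mul_mx3 !trmx0 !mx3E kk.
by [].
Qed.

Lemma expNE alpha : expN alpha =
  let q := dot alpha alpha^T / 2 in
  mx3 1%:M (- alpha^T) alpha^T alpha (1 - q) q alpha (- q) (1 + q).
Proof.
rewrite /expN /X_ mul_mx3 scale_mx3 mx3_scalar !add_mx3 !mx3E.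
rewrite mulNmx addNr !scaler0 !addr0 !dotNr.
by congr (mx3 _ _ _ _ _ _ _ _ _); rewrite mulrC // mulNr.
Qed.

Lemma expN_v0 alpha : expN alpha *m v0 = v0.
Proof.
rewrite expNE /= mul_mx3_col3 !mx3E addNr.
by congr col3; ring.
Qed.

Lemma expN_mul alpha beta : expN alpha *m expN beta = expN (alpha + beta).
Proof.
rewrite !expNE /= mul_mx3 !mx3E.
have ba : dot beta alpha^T = dot alpha beta^T by rewrite -[beta in LHS]trmxK dotC.
rewrite [(alpha + beta)^T]linearD /= !(dotDl, dotDr, dotNr) ba.
have e : - alpha^T *m beta + alpha^T *m beta = 0 by rewrite mulNmx addNr.
rewrite -addrA e addr0.
congr (mx3 _ _ _ _ _ _ _ _ _).
all: try by field.
all: by apply/matrixP => i j; rewrite !mxE; field.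
Qed.

Lemma O_expN alpha : O_m1 R m (expN alpha).
Proof.
rewrite /O_m1 /= expNE /= tr_mx3 /I_m1 !mul_mx3 !trmxN !trmxK !trmx1 !mx3E.
congr (mx3 _ _ _ _ _ _ _ _ _); rewrite ?dotNl ?dotNr ?mulNmx ?mulmxN.
all: try first [by field | by rewrite opprK addrK].
all: by apply/matrixP => i j; rewrite !mxE; field.
Qed.

Lemma expA_mul t x : expA m t *m expA m x = expA m (t + x).
Proof.
rewrite /expA mul_mx3 !mx3E opprD !expRD.
by congr (mx3 _ _ _ _ _ _ _ _ _); field.
Qed.

Lemma expA_v0 t : expA m t *m v0 = expR t *: v0.
Proof. by rewrite mul_mx3_col3 scale_v0 !mx3E; congr col3; field. Qed.

Lemma O_expA t : O_m1 R m (expA m t).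
Proof.
rewrite /O_m1 /= /expA tr_mx3 /I_m1 !mul_mx3 !trmx0 !trmx1 !mx3E.
have e : expR t * expR (- t) = 1 by rewrite -expRD subrr expR0.
congr (mx3 _ _ _ _ _ _ _ _ _).
- by transitivity (expR t * expR (- t)); [field|].
- by field.
- by field.
- by transitivity (- (expR t * expR (- t))); [field|rewrite e].
Qed.

Lemma expAC_k t k : expA m t *m mk_k k = mk_k k *m expA m t.
Proof. by rewrite /expA /mk_k !mul_mx3 !mx3E. Qed.

(** The element is a square in the isometry group, whose determinants are 1 and
-1. *)
Lemma det_expA t : \det (expA m t) = 1.
Proof.
have -> : expA m t = expA m (t / 2) *m expA m (t / 2).
  by rewrite expA_mul; congr expA; field.
by rewrite det_mulmx; have [->|->] := O_det (O_expA (t / 2)); ring.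
Qed.

Lemma det_expN alpha : \det (expN alpha) = 1.
Proof.
have -> : expN alpha = expN (2^-1 *: alpha) *m expN (2^-1 *: alpha).
  by rewrite expN_mul -scalerDl; congr expN; rewrite -[LHS]scale1r; congr (_ *: _); field.
by rewrite det_mulmx; have [->|->] := O_det (O_expN (2^-1 *: alpha)); ring.
Qed.

(** An isometry fixing [v0] also preserves the pairing with [v0]; this makes its
last two rows and columns depend on a single row vector. *)
Lemma O_fix_v0 p : O_m1 R m p -> p *m v0 = v0 ->
  exists k alpha, k *m k^T = 1%:M /\ p = mk_k k *m expN alpha.
Proof.
move=> Op pv.
have colp : p^T *m (I *m v0) = I *m v0.
  by rewrite -[v0 in LHS]pv !mulmxA O_trmx.
have [K [b [c [d [e [f [g [h [l pE]]]]]]]]] := mx3P p.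
move: pv colp Op; rewrite /O_m1 /= pE /I_m1 tr_mx3 !mul_mx3 !mul_mx3_col3 !mx3E.
move=> /col3_inj[bc ef hl] /col3_inj[dg eh fl] /mx3_inj[[KK Kd _] [_ dd _] _].
have {}bc : c = - b by apply/eqP; rewrite -addr_eq0 addrC bc.
have {}dg : g = d.
  by apply: trmx_inj; apply/eqP; rewrite eq_sym -subr_eq0 dg.
have fE : f = 1 - e by lra.
have hE : h = e - 1 by lra.
have lE : l = 2 - e by lra.
have eE : e = 1 - dot d d^T / 2 by move: dd; rewrite fE; lra.
have bE : b = - (K *m d^T).
  have : K *m d^T + b = 0.
    by rewrite -[RHS]Kd bc fE opprK -addrA -scalerDl [e + _]addrC subrK scale1r.
  by move=> /eqP; rewrite addrC addr_eq0 => /eqP.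
exists K, d; split.
  by rewrite -[RHS]KK bc opprK trmxN mulmxN addrK.
rewrite expNE /= mk_k_mul mulmx1 mulmxN bc dg bE opprK.
congr (mx3 _ _ _ _ _ _ _ _ _) => //; move: eE fE hE lE; lra.
Qed.

(** After a dilation by [expA] the vector [v0] itself is fixed, and [O_fix_v0]
applies.  This description shows at once that [MAN] is a group. *)
Lemma MANP p : MAN R m p <->
  [/\ O_m1 R m p, \det p = 1 & exists2 x, 0 < x & p *m v0 = x *: v0].
Proof.
split=> [[k [t [alpha [[kk dk] ->]]]]|[Op dp [x x0 pv]]].
  split; first by do 2?apply: O_mul; [exact: O_mk_k|exact: O_expA|exact: O_expN].
    by rewrite !det_mulmx det_mk_k dk det_expA det_expN !mulr1.
  exists (expR t); first exact: expR_gt0.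
  by rewrite -!mulmxA expN_v0 expA_v0 -scalemxAr mk_k_v0.
pose p1 := expA m (- ln x) *m p.
have Op1 : O_m1 R m p1 by apply: O_mul => //; exact: O_expA.
have p1v : p1 *m v0 = v0.
  rewrite -mulmxA pv -scalemxAr expA_v0 scalerA expRN lnK ?posrE //.
  by rewrite divff ?scale1r // gt_eqF.
have [k [alpha [kk p1E]]] := O_fix_v0 Op1 p1v.
exists k, (ln x), alpha; split.
  split=> //; have := congr1 determinant p1E.
  by rewrite !det_mulmx det_expA dp det_mk_k det_expN !mulr1.
rewrite -/(mk_k k) -expAC_k -mulmxA -p1E mulmxA expA_mul subrr.
suff -> : expA m 0 = 1%:M :> 'M[R]_M by rewrite mul1mx.
rewrite /expA /= oppr0 expR0 mx3_scalar.
by congr (mx3 _ _ _ _ _ _ _ _ _); field.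
Qed.

Lemma MAN_O p : MAN R m p -> O_m1 R m p. Proof. by case/MANP. Qed.

Lemma MAN_mul p q : MAN R m p -> MAN R m q -> MAN R m (p *m q).
Proof.
move=> /MANP[Op dp [x x0 px]] /MANP[Oq dq [y y0 qy]]; apply/MANP; split.
- exact: O_mul.
- by rewrite det_mulmx dp dq mulr1.
- exists (x * y); first exact: mulr_gt0.
  by rewrite -mulmxA qy -scalemxAr px scalerA mulrC.
Qed.

Lemma MAN_inv p : MAN R m p -> MAN R m (invmx p).
Proof.
move=> /MANP[Op dp [x x0 px]]; apply/MANP; split.
- exact: O_invmx.
- by rewrite det_inv dp invr1.
- exists x^-1; first by rewrite invr_gt0.
  rewrite -[v0 in LHS]scale1r -(@mulVf _ x) ?gt_eqF // -scalerA -px -scalemxAr.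
  by rewrite mulKmx // O_unit.
Qed.

Lemma MAN_1 : MAN R m 1%:M.
Proof.
apply/MANP; split; [exact: O_1|exact: det1|].
by exists 1; rewrite // mul1mx scale1r.
Qed.

End Parabolic.

(** * Reflections *)

Section Reflections.
Variables (R : realType) (N : nat) (J : 'M[R]_N).
Hypothesis symJ : J^T = J.
Implicit Types (u v c : 'cV[R]_N).

Definition bil u v : R := (u^T *m J *m v) 0 0.

Lemma bilE u v : u^T *m J *m v = (bil u v)%:M.
Proof. exact: mx11_scalar. Qed.

Lemma bilC u v : bil u v = bil v u.
Proof.
by rewrite /bil -[in LHS](trmxK (u^T *m J *m v)) mxE !trmx_mul trmxK symJ mulmxA.
Qed.

Lemma bilDl u u' v : bil (u + u') v = bil u v + bil u' v.
Proof. by rewrite /bil linearD !mulmxDl mxE. Qed.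

Lemma bilZl x u v : bil (x *: u) v = x * bil u v.
Proof. by rewrite /bil linearZ -!scalemxAl mxE. Qed.

Lemma bilNl u v : bil (- u) v = - bil u v.
Proof. by rewrite -scaleN1r bilZl mulN1r. Qed.

Lemma bilDr u v v' : bil u (v + v') = bil u v + bil u v'.
Proof. by rewrite bilC bilDl !(bilC u). Qed.

Lemma bilZr x u v : bil u (x *: v) = x * bil u v.
Proof. by rewrite bilC bilZl bilC. Qed.

Lemma bilNr u v : bil u (- v) = - bil u v.
Proof. by rewrite bilC bilNl bilC. Qed.

(** Reflection in the hyperplane orthogonal to [c]. *)
Definition refl c : 'M[R]_N := 1%:M - (2 / bil c c) *: (c *m c^T *m J).

Lemma refl_apply c u : refl c *m u = u - (2 * bil c u / bil c c) *: c.
Proof.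
rewrite mulmxBl mul1mx -scalemxAl -!mulmxA [c^T *m _]mulmxA bilE mul_mx_scalar.
by rewrite scalerA mulrAC.
Qed.

Lemma reflN c : refl (- c) = refl c.
Proof. by rewrite /refl bilNl bilNr opprK linearN /= mulNmx mulmxN opprK. Qed.

Lemma reflK c : bil c c != 0 -> refl c *m refl c = 1%:M.
Proof.
move=> c0; rewrite {1}/refl mulmxBl mul1mx -scalemxAl.
have -> : c *m c^T *m J *m refl c = - (c *m c^T *m J).
  rewrite mulmxBr mulmx1 -scalemxAr.
  have -> : c *m c^T *m J *m (c *m c^T *m J) = bil c c *: (c *m c^T *m J).
    transitivity (c *m (c^T *m J *m c) *m (c^T *m J)); first by rewrite !mulmxA.
    by rewrite bilE mul_mx_scalar -scalemxAl mulmxA.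
  rewrite scalerA mulfVK //.
  by rewrite scaler_nat mulr2n opprD addrA subrr sub0r.
by rewrite scalerN opprK subrK.
Qed.

Lemma refl_adj c : J *m refl c = (refl c)^T *m J.
Proof.
have -> : (refl c)^T = 1%:M - (2 / bil c c) *: (J *m (c *m c^T)).
  rewrite /refl [LHS]linearB [X in _ - X]linearZ /= trmx1 trmx_mul symJ.
  by rewrite trmx_mul trmxK.
by rewrite mulmxBr mulmxBl mulmx1 mul1mx -scalemxAr -scalemxAl !mulmxA.
Qed.

Lemma refl_isom c : bil c c != 0 -> (refl c)^T *m J *m refl c = J.
Proof. by move=> c0; rewrite -refl_adj -mulmxA reflK // mulmx1. Qed.

Lemma refl_isom_tr c : J *m J = 1%:M -> bil c c != 0 ->
  refl c *m J *m (refl c)^T = J.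
Proof.
move=> JJ c0; rewrite -[LHS]mulmx1 -JJ -!mulmxA (mulmxA _ J J) -refl_adj.
by rewrite !mulmxA -(mulmxA (refl c)) JJ mulmx1 reflK // mul1mx.
Qed.

Lemma bil_isom X u v : X^T *m J *m X = J -> bil (X *m u) (X *m v) = bil u v.
Proof.
by move=> XJ; rewrite /bil trmx_mul -!mulmxA (mulmxA X^T) (mulmxA (X^T *m J)) XJ.
Qed.

(** Vectors [u] and [v] of the same length have [u + v] orthogonal to
[u - v]. *)
Lemma refl_swap u v : bil u u = bil v v -> bil (u - v) (u - v) != 0 ->
  refl (u - v) *m u = v.
Proof.
move=> uv d0; rewrite refl_apply.
have -> : 2 * bil (u - v) u / bil (u - v) (u - v) = 1.
  rewrite -[RHS](divff d0); congr (_ / _).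
  by rewrite !(bilDl, bilDr, bilNl, bilNr) (bilC v u) -uv; ring.
by rewrite scale1r opprB addrC subrK.
Qed.

Lemma refl_fix c u : bil c u = 0 -> refl c *m u = u.
Proof. by move=> cu; rewrite refl_apply cu mulr0 mul0r scale0r subr0. Qed.

(** The two block factorizations of one bordered matrix compare the determinant
of a rank-one perturbation of the identity with a determinant of size 1. *)
Lemma det_refl c : bil c c != 0 -> \det (refl c) = -1.
Proof.
move=> c0; set x := 2 / bil c c.
have e1 : block_mx 1%:M (x *: c) (c^T *m J) 1%:M =
    block_mx (refl c) (x *: c) 0 1%:M *m block_mx 1%:M 0 (c^T *m J) 1%:M.
  rewrite mulmx_block !(mulmx1, mulmx0, mul0mx, mul1mx, add0r).
  by rewrite /refl -scalemxAl -/x mulmxA subrK.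
have e2 : block_mx 1%:M (x *: c) (c^T *m J) 1%:M =
    block_mx 1%:M 0 (c^T *m J) 1%:M *m
    block_mx 1%:M (x *: c) 0 (1%:M - x *: (bil c c)%:M).
  rewrite mulmx_block !(mulmx1, mulmx0, mul0mx, mul1mx, add0r, addr0).
  by rewrite -scalemxAr bilE addrC subrK.
have := congr1 determinant e1; rewrite e2 !det_mulmx !det_ublock !det_lblock.
rewrite !det1 !mul1r !mulr1 => <-.
by rewrite det_mx11 !mxE eqxx !mulr1n /x; field.
Qed.

End Reflections.

(** * Products of spacelike reflections lie in the identity component *)

Section ContinuousAlgebra.
Variables (R : realType) (T : topologicalType).
Implicit Types (f g : T -> R) (x : T).

Definition cts f x := f @ x --> f x.

Lemma cts_cst (a : R) x : cts (fun=> a) x. Proof. exact: cvg_cst. Qed.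

Lemma ctsD f g x : cts f x -> cts g x -> cts (fun y => f y + g y) x.
Proof. exact: cvgD. Qed.

Lemma ctsN f x : cts f x -> cts (fun y => - f y) x.
Proof. exact: cvgN. Qed.

Lemma ctsM f g x : cts f x -> cts g x -> cts (fun y => f y * g y) x.
Proof. exact: cvgM. Qed.

Lemma ctsV f x : f x != 0 -> cts f x -> cts (fun y => (f y)^-1) x.
Proof. by move=> f0; exact: cvgV. Qed.

Lemma cts_sum (J : Type) (r : seq J) (P : pred J) (F : J -> T -> R) x :
  (forall j, P j -> cts (F j) x) ->
  cts (fun y => \sum_(j <- r | P j) F j y) x.
Proof.
move=> Fc; rewrite /cts; elim: r => [|j r IH].
  under eq_fun do rewrite big_nil.
  by rewrite big_nil; exact: cvg_cst.
under eq_fun do rewrite big_cons.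
rewrite big_cons; case: ifP => // Pj.
by apply: cvgD => //; exact: Fc.
Qed.

Lemma cts_prod (J : Type) (r : seq J) (P : pred J) (F : J -> T -> R) x :
  (forall j, P j -> cts (F j) x) ->
  cts (fun y => \prod_(j <- r | P j) F j y) x.
Proof.
move=> Fc; rewrite /cts; elim: r => [|j r IH].
  under eq_fun do rewrite big_nil.
  by rewrite big_nil; exact: cvg_cst.
under eq_fun do rewrite big_cons.
rewrite big_cons; case: ifP => // Pj.
by apply: cvgM => //; exact: Fc.
Qed.

Lemma cts_mx p q (F : T -> 'M[R]_(p, q)) x :
  (forall i j, cts (fun y => F y i j) x) -> F @ x --> F x.
Proof.
move=> Fc A [P nP PA].
apply: (@filterS _ _ _ [set y | forall i j, P i j (F y i j)]).
  by move=> y Py; apply: PA.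
apply: filter_forall => i; apply: filter_forall => j.
exact: Fc.
Qed.

Lemma cts_det p (F : T -> 'M[R]_p) x :
  (forall i j, cts (fun y => F y i j) x) -> cts (fun y => \det (F y)) x.
Proof.
move=> Fc; apply: cts_sum => s _; apply: ctsM; first exact: cts_cst.
by apply: cts_prod => i _; exact: Fc.
Qed.

Lemma cts_mulmx p q r (F : T -> 'M[R]_(p, q)) (H : T -> 'M[R]_(q, r)) x :
  (forall i j, cts (fun y => F y i j) x) ->
  (forall i j, cts (fun y => H y i j) x) ->
  forall i j, cts (fun y => (F y *m H y) i j) x.
Proof.
move=> Fc Hc i j.
rewrite (_ : (fun y => _) = fun y => \sum_k F y i k * H y k j).
  by apply: cts_sum => k _; apply: ctsM.
by apply/funext => y; rewrite mxE.
Qed.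

End ContinuousAlgebra.

Section IdentityComponent.
Variables (R : realType) (m : nat).
Local Notation M := (m + 1 + 1)%N.
Local Notation I := (I_m1 R m).
Local Notation lor := (bil I).
Local Notation sref := (refl I).
Implicit Types (X p g : 'M[R]_M) (c d u v : 'cV[R]_M).

Lemma bil_col3 (b b' : 'cV[R]_m) e f e' f' :
  lor (col3 b e f) (col3 b' e' f') = dot b^T b' + e * e' - f * f'.
Proof.
rewrite /bil -mulmxA mul_mx3_col3 !mx3E /col3 !tr_col_mx !mul_row_col.
by rewrite !tr_scalar_mx -!scalar_mxM dotE -!raddfD /= mxE eqxx mulr1n; ring.
Qed.

Lemma O_bil X u v : O_m1 R m X -> lor (X *m u) (X *m v) = lor u v.
Proof. by move=> /O_trmx; exact: bil_isom. Qed.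

Lemma O_refl c : lor c c != 0 -> O_m1 R m (sref c).
Proof. by move=> c0; apply: refl_isom_tr; rewrite ?tr_I ?mul_II. Qed.

Lemma SOe_O X : SOe R m X -> O_m1 R m X.
Proof. exact: connected_component_sub. Qed.

Lemma SOe_1 : SOe R m 1%:M.
Proof. by apply: connected_component_refl; exact: O_1. Qed.

(** Left translation by [X] carries a connected set joining 1 to [p] to one
joining [X] to [X p]. *)
Lemma SOe_mul X p : SOe R m X -> SOe R m p -> SOe R m (X *m p).
Proof.
move=> SX Sp; apply: (connected_component_trans SX).
have OX := SOe_O SX.
exists ((fun p => X *m p) @` SOe R m); last by exists p.
split.
- by exists 1%:M; rewrite ?mulmx1 //; exact: SOe_1.
- by move=> _ [q Sq <-]; apply: O_mul => //; exact: SOe_O.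
- apply: connected_continuous_connected; first exact: component_connected.
  apply: continuous_subspaceT => q; apply: cts_mx; apply: cts_mulmx => i j.
    exact: cts_cst.
  exact: coord_continuous.
Qed.

(** Up to the sign of [d], which does not affect the reflection, the segment
from [c] to [d] stays in the cone of spacelike vectors. *)
Lemma SOe_refl_refl c d : 0 < lor c c -> 0 < lor d d ->
  SOe R m (sref c *m sref d).
Proof.
move=> c0 d0; wlog cd : d d0 / 0 <= lor c d.
  move=> H; have [/H|cd] := leP 0 (lor c d); first exact.
  rewrite -(reflN (tr_I R m) d); apply: H.
    by rewrite bilNl bilNr ?tr_I // opprK.
  by rewrite bilNr ?tr_I // oppr_ge0 ltW.
pose path t : 'cV[R]_M := (1 - t) *: c + t *: d.
have path_gt0 t : `[0, 1]%classic t -> 0 < lor (path t) (path t).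
  rewrite /= in_itv /= => /andP[t0 t1].
  rewrite /path !(bilDl, bilDr, bilZl, bilZr) ?tr_I // (bilC _ d c) ?tr_I //.
  have [->|tn1] := eqVneq t 1.
    by rewrite subrr !mul0r !mulr0 !addr0 !add0r !mul1r.
  have : 0 < (1 - t) * ((1 - t) * lor c c).
    by rewrite !mulr_gt0 // subr_gt0 lt_neqAle tn1.
  have : 0 <= t * (t * lor d d) by rewrite !mulr_ge0 // ltW.
  have : 0 <= (1 - t) * (t * lor c d) by rewrite !mulr_ge0 // subr_ge0.
  lra.
exists ((fun t => sref c *m sref (path t)) @` `[0, 1]%classic); last first.
  exists 1; first by rewrite /= in_itv /= lexx ler01.
  by rewrite /path subrr scale0r scale1r add0r.
split.
- exists 0; first by rewrite /= in_itv /= lexx ler01.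
  by rewrite /path subr0 scale0r scale1r addr0 reflK // gt_eqF.
- move=> _ [t tI <-]; apply: O_mul; apply: O_refl; first by rewrite gt_eqF.
  by rewrite gt_eqF // path_gt0.
- apply: connected_continuous_connected; first exact: segment_connected.
  apply: continuous_in_subspaceT => t; rewrite inE => tI.
  have pc i j : cts (fun t => path t i j) t.
    rewrite (_ : (fun t => _) = fun t => (1 - t) * c i j + t * d i j).
      apply: ctsD; apply: ctsM; try exact: cts_cst; last exact: cvg_id.
      by apply: ctsD; [exact: cts_cst|apply: ctsN; exact: cvg_id].
    by apply/funext => x; rewrite !mxE.
  have ptc i j : cts (fun t => (path t)^T i j) t.
    by under eq_fun do rewrite mxE; exact: pc.
  apply: cts_mx; apply: cts_mulmx => i j; first exact: cts_cst.
  rewrite /refl.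
  rewrite (_ : (fun t => _) = fun t => (1%:M : 'M[R]_M) i j +
    - (2 * (lor (path t) (path t))^-1 * (path t *m (path t)^T *m I) i j)).
    apply: ctsD; first exact: cts_cst.
    apply: ctsN; apply: ctsM.
      apply: ctsM; first exact: cts_cst.
      apply: ctsV; first by rewrite gt_eqF // path_gt0.
      apply: cts_mulmx => // k l; apply: cts_mulmx => // k' l'; exact: cts_cst.
    apply: cts_mulmx => k l; last exact: cts_cst.
    exact: cts_mulmx.
  by apply/funext => x; rewrite !mxE.
Qed.

End IdentityComponent.

(** * The identity component of the Lorentz group *)

Section IdentityComponent2.
Variables (R : realType) (m : nat).
Local Notation M := (m + 1 + 1)%N.
Local Notation I := (I_m1 R m).
Local Notation lor := (bil I).
Local Notation sref := (refl I).
Implicit Types (X p g : 'M[R]_M) (c d u v : 'cV[R]_M).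

Definition e_time : 'cV[R]_M := col3 0 0 1.

(** The last diagonal entry of [X].  Writing it as a pairing with the time axis
makes it accessible to invariance arguments. *)
Definition timec X : R := - lor e_time (X *m e_time).

Lemma lor_et b e f : lor e_time (col3 b e f) = - f.
Proof. by rewrite /e_time bil_col3 trmx0 !mx3E. Qed.

Lemma O_time_col X : O_m1 R m X -> exists b e,
  X *m e_time = col3 b e (timec X) /\ dot b^T b + e ^+ 2 - timec X ^+ 2 = -1.
Proof.
move=> OX; have [b [e [f Xe]]] := col3P (X *m e_time).
have fE : timec X = f by rewrite /timec Xe lor_et opprK.
exists b, e; rewrite fE; split=> //.
by have := O_bil e_time e_time OX; rewrite lor_et Xe bil_col3 !expr2.
Qed.

Lemma dot_trmx_ge0 n (b : 'cV[R]_n) : 0 <= dot b^T b.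
Proof. by have := dotxx_ge0 b^T; rewrite trmxK. Qed.

Lemma dot_trmx_eq0 n (b : 'cV[R]_n) : (dot b^T b == 0) = (b == 0).
Proof. by have := dotxx_eq0 b^T; rewrite trmxK trmx_eq0. Qed.

(** An isometry preserves the future exactly when it sends the time axis to a
vector pairing negatively with the future isotropic vector [v0]. *)
Lemma timec_gt0 X : O_m1 R m X -> (0 < timec X) = (lor (X *m e_time) (v0 R m) < 0).
Proof.
move=> /O_time_col[b [e [-> h]]].
have := dot_trmx_ge0 b; rewrite bil_col3 dot0r !mulr1 add0r => bb.
have lt : (timec X - e) * (timec X + e) >= 1 by move: h; rewrite !expr2; lra.
apply/idP/idP => ht; rewrite ltNge; apply/negP => hh; nra.
Qed.

Lemma timec_sqr_ge1 X : O_m1 R m X -> 1 <= timec X ^+ 2.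
Proof.
move=> /O_time_col[b [e [_]]].
have := dot_trmx_ge0 b; have := sqr_ge0 e; lra.
Qed.

(** A continuous function without zeros on the isometry group keeps its sign on
a connected part. *)
Lemma SOe_sub_interval (f : 'M[R]_M -> R) X : SOe R m X ->
  (forall p, cts f p) -> (forall p, O_m1 R m p -> f p != 0) ->
  0 < f 1%:M -> 0 < f X.
Proof.
move=> SX fc f0 f1.
have iI : is_interval (f @` SOe R m).
  apply/connected_intervalP/connected_continuous_connected.
    exact: component_connected.
  by apply: continuous_subspaceT => p; exact: fc.
rewrite ltNge; apply/negP => fX.
have [] : (f @` SOe R m) 0.
  apply: (iI (f X) (f 1%:M)); [by exists X|by exists 1%:M => //; exact: SOe_1|].
  by rewrite fX ltW.
by move=> p /SOe_O Op fp; have := f0 _ Op; rewrite fp eqxx.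
Qed.

Lemma SOe_det X : SOe R m X -> \det X = 1.
Proof.
move=> SX; have [//|dX] := O_det (SOe_O SX).
suff : 0 < \det X by rewrite dX oppr_gt0 ltr10.
apply: SOe_sub_interval => //; last by rewrite det1.
  by move=> p; apply: cts_det => i j; exact: coord_continuous.
by move=> p /O_det[] ->; rewrite ?oppr_eq0 oner_eq0.
Qed.

Lemma SOe_timec X : SOe R m X -> 0 < timec X.
Proof.
move=> SX; apply: SOe_sub_interval => //.
- move=> p; apply: ctsN; apply: cts_mulmx => i j; first exact: cts_cst.
  by apply: cts_mulmx => k l; [exact: coord_continuous|exact: cts_cst].
- move=> p /timec_sqr_ge1; apply: contraTneq => ->.
  by rewrite expr0n /= ler10.
- by rewrite /timec mul1mx lor_et opprK.
Qed.

Lemma eq1_cols X : (forall i, X *m delta_mx i 0 = delta_mx i 0 :> 'cV_M) -> X = 1%:M.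
Proof.
move=> Xe; apply/trmx_inj/row_matrixP => i; rewrite -!tr_col; congr trmx.
by rewrite !colE Xe mul1mx.
Qed.

(** [g] is, up to elements of the identity component, the identity or a
spacelike reflection. *)
Let near1 g := (\det g = 1 -> SOe R m g) /\
  (\det g = -1 -> forall c, 0 < lor c c -> SOe R m (sref c *m g)).

(** Multiplication by a reflection exchanges the two cases, and products of two
reflections are absorbed by the identity component. *)
Lemma near1_refl g d : 0 < lor d d -> near1 (sref d *m g) -> near1 g.
Proof.
move=> d0 [H1 H2]; have dn : lor d d != 0 by rewrite gt_eqF.
have gE : g = sref d *m (sref d *m g) by rewrite mulmxA reflK // mul1mx.
move: H1 H2; rewrite det_mulmx det_refl // => H1 H2; split=> dg.
  by rewrite gE; apply: H2 => //; rewrite dg mulr1.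
move=> c c0; rewrite gE mulmxA; apply: SOe_mul.
  exact: SOe_refl_refl.
by apply: H1; rewrite dg mulrNN mulr1.
Qed.


Lemma lor_gt0 u : lor e_time u = 0 -> u != 0 -> 0 < lor u u.
Proof.
have [b [e [f ->]]] := col3P u; rewrite lor_et => /eqP; rewrite oppr_eq0 => /eqP ->.
rewrite bil_col3 mulr0 subr0 => nz.
have bb := dot_trmx_ge0 b; rewrite lt0r addr_ge0 -?expr2 ?sqr_ge0 // andbT.
apply: contraNneq nz => /eqP; rewrite paddr_eq0 ?sqr_ge0 // sqrf_eq0 dot_trmx_eq0.
by move=> /andP[/eqP-> /eqP->]; rewrite /col3 !raddf0 !col_mx0.
Qed.

(** Once the time axis is fixed, a displaced basis vector differs from its image
by a spacelike vector orthogonal to all basis vectors already fixed; the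
reflection along it puts one more basis vector in place. *)
Lemma near1_fix k g : O_m1 R m g -> g *m e_time = e_time ->
  (#|[pred i : 'I_M | g *m (delta_mx i 0%R : 'cV_M) != delta_mx i 0%R]| < k)%N -> near1 g.
Proof.
elim: k g => // k IH g Og ge gk.
have [i gi|gfix] := pickP (fun i : 'I_M => g *m (delta_mx i 0 : 'cV_M) != delta_mx i 0); last first.
  have -> : g = 1%:M by apply: eq1_cols => i; apply/eqP/negbFE/gfix.
  split=> [_|]; first exact: SOe_1.
  by rewrite det1 => /eqP; rewrite -subr_eq0 opprK => /eqP; lra.
set e : 'cV[R]_M := delta_mx i 0; set d := g *m e - e.
have det0 : lor e_time d = 0.
  by rewrite /d bilDr ?tr_I // bilNr ?tr_I // -{1}ge O_bil // subrr.
have d0 : 0 < lor d d by apply: lor_gt0; rewrite // subr_eq0.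
apply: (near1_refl d0); apply: IH.
- by apply: O_mul => //; apply: O_refl; rewrite gt_eqF.
- by rewrite -mulmxA ge refl_fix // bilC ?tr_I.
rewrite -ltnS; apply: leq_trans gk; rewrite ltnS; apply: proper_card.
apply/fintype.properP; split; last first.
  exists i; rewrite inE ?gi // negbK -mulmxA refl_swap ?O_bil ?tr_I //.
  by rewrite gt_eqF.
apply/fintype.subsetP => j; rewrite !inE; apply: contraNneq => gj.
by rewrite -mulmxA gj refl_fix // /d bilDl bilNl -{1}gj O_bil // subrr.
Qed.

(** The difference of two distinct future unit vectors is spacelike, so that one
reflection brings the time axis back. *)
Lemma near1_timec g : O_m1 R m g -> 0 < timec g -> near1 g.
Proof.
move=> Og tg.
have [ge|gne] := eqVneq (g *m e_time) e_time; first exact: near1_fix Og ge (ltnSn _).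
set d := g *m e_time - e_time.
have dd : lor d d = 2 * timec g - 2.
  rewrite /d !(bilDl, bilDr, bilNl, bilNr) ?tr_I // O_bil // /timec.
  by rewrite (bilC _ (g *m e_time)) ?tr_I // lor_et; ring.
have d0 : 0 < lor d d.
  have [b [e [ge h]]] := O_time_col Og.
  have bb := dot_trmx_ge0 b; have ee := sqr_ge0 e.
  rewrite dd; suff : timec g > 1 by lra.
  rewrite lt_neqAle; apply/andP; split; last first.
    by rewrite leNgt; apply/negP => h1; move: h; rewrite !expr2 in ee *; nra.
  apply: contraNneq gne => t1; rewrite ge -t1.
  have /eqP : dot b^T b + e ^+ 2 = 0 by move: h; rewrite -t1; lra.
  rewrite paddr_eq0 // dot_trmx_eq0 sqrf_eq0 => /andP[/eqP-> /eqP->].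
  exact: eqxx.
apply: (near1_refl d0).
have Og' : O_m1 R m (sref d *m g).
  by apply: O_mul => //; apply: O_refl; rewrite gt_eqF.
apply: (near1_fix Og' _ (ltnSn _)).
rewrite -mulmxA refl_swap ?O_bil ?tr_I //.
by rewrite gt_eqF.
Qed.

Lemma SOeP g : SOe R m g <-> [/\ O_m1 R m g, \det g = 1 & 0 < timec g].
Proof.
split=> [Sg|[Og dg tg]].
  by split; [exact: SOe_O|exact: SOe_det|exact: SOe_timec].
by have [+ _] := near1_timec Og tg; apply.
Qed.

Lemma MAN_SOe p : MAN R m p -> SOe R m p.
Proof.
move=> /MANP[Op dp [x x0 px]]; apply/SOeP; split => //.
rewrite timec_gt0 // -(pmulr_rlt0 _ x0) -bilZr ?tr_I // -px O_bil // lor_et.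
by rewrite oppr_lt0 ltr01.
Qed.

End IdentityComponent2.

(** * Coadjoint orbits in terms of matrices *)

Section Duals.
Variables (R : realType) (m : nat).
Local Notation M := (m + 1 + 1)%N.
Local Notation v0 := (v0 R m).
Implicit Types (X p g : 'M[R]_M).

Lemma iotaE X (u : subvs_of (g_ R m)) : iota_ X u = 2^-1 * \tr (X *m vsval u).
Proof.
rewrite linfunE // => x v w; rewrite [vsval _]linearP /= mulmxDr -scalemxAr mxtraceD mxtraceZ.
by rewrite mulrDr mulrCA.
Qed.

Lemma restrE (xi : dual (g_ R m)) (u : subvs_of (p_ R m)) :
  restr xi u = xi (vsproj (g_ R m) (vsval u)).
Proof. by rewrite linfunE // => x v w; rewrite !linearP. Qed.

Lemma coadE (V : {vspace 'M[R]_M}) g (xi : dual V) u :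
  coad g xi u = xi (vsproj V (invmx g *m vsval u *m g)).
Proof.
rewrite linfunE // => x v w.
by rewrite [vsval _]linearP /= mulmxDr mulmxDl -scalemxAr -scalemxAl !linearP.
Qed.

Lemma prE X (u : subvs_of (p_ R m)) : pr X u = 2^-1 * \tr (X *m vsval u).
Proof.
by rewrite restrE iotaE vsprojK //; apply: p_sub_g; exact: subvsP.
Qed.

Lemma invmx_mul n (A B : 'M[R]_n) : A \in unitmx -> B \in unitmx ->
  invmx (A *m B) = invmx B *m invmx A.
Proof.
move=> Au Bu; have ABu : A *m B \in unitmx by rewrite unitmx_mul Au.
by rewrite -[RHS](mulKmx ABu) -mulmxA (mulKVmx Bu) (mulmxV Au) mulmx1.
Qed.

Lemma coad_mul (V : {vspace 'M[R]_M}) g p (xi : dual V) :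
  g \in unitmx -> p \in unitmx ->
  (forall X, X \in V -> invmx g *m X *m g \in V) ->
  coad (g *m p) xi = coad g (coad p xi).
Proof.
move=> gu pu gV; apply/lfunP => u; rewrite !coadE vsprojK ?gV ?subvsP //.
by rewrite invmx_mul // !mulmxA.
Qed.

Lemma coad1 (V : {vspace 'M[R]_M}) (xi : dual V) : coad 1%:M xi = xi.
Proof. by apply/lfunP => u; rewrite coadE invmx1 mul1mx mulmx1 vsvalK. Qed.

Lemma conj_trace X u g : g \in unitmx ->
  \tr (X *m (invmx g *m u *m g)) = \tr (g *m X *m invmx g *m u) :> R.
Proof. by move=> gu; rewrite !mulmxA mxtrace_mulC !mulmxA. Qed.

Lemma g_conjV g X : O_m1 R m g -> X \in g_ R m -> invmx g *m X *m g \in g_ R m.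
Proof.
by move=> Og Xg; have := g_conj (O_invmx Og) Xg; rewrite invmxK.
Qed.

Lemma p_conjV p X : MAN R m p -> X \in p_ R m -> invmx p *m X *m p \in p_ R m.
Proof.
move=> /MAN_inv/MANP[Op _ [x x0 px]] Xp.
by have := p_conj Op (lt0r_neq0 x0) px Xp; rewrite invmxK.
Qed.

Lemma coad_iota g X : O_m1 R m g -> coad g (iota_ X) = iota_ (g *m X *m invmx g).
Proof.
move=> Og; apply/lfunP => u; rewrite coadE !iotaE vsprojK; last first.
  by apply: g_conjV => //; exact: subvsP.
by rewrite conj_trace // O_unit.
Qed.

Lemma coad_pr p X : MAN R m p -> coad p (pr X) = pr (p *m X *m invmx p).
Proof.
move=> Mp; apply/lfunP => u; rewrite coadE !prE vsprojK; last first.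
  by apply: p_conjV => //; exact: subvsP.
by rewrite conj_trace // O_unit //; exact: MAN_O.
Qed.

Lemma mxtrace_mx3 A b c d e f (g : 'rV[R]_m) h k : \tr (@mx3 R m A b c d e f g h k) = \tr A + e + k.
Proof. by rewrite /Defs.mx3 !mxtrace_block !mxtrace_scalar. Qed.

Lemma mk_g_p_trace A b c e A' e' alpha :
  \tr (mk_g A b c e *m @mk_p R m A' e' alpha) =
  \tr (A *m A') + 2 * dot alpha (b + c) + 2 * (e * e').
Proof.
have tr_dot (v : 'cV[R]_m) : \tr (v *m alpha) = dot alpha v.
  by rewrite mxtrace_mulC dotE mxtrace_scalar.
rewrite mul_mx3 mxtrace_mx3 !mxtraceD !tr_dot dotNl dotNr !dotC dotDr.
ring.
Qed.

Lemma X_mk_g alpha : X_ alpha = mk_g (0 : 'M[R]_m) (- alpha^T) alpha^T 0.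
Proof. by rewrite /mk_g linearN /= !trmxK opprK. Qed.

(** The radical [n_] is the orthogonal of [p_] in [g_]: pairing [X' - X] with a
suitable element of [p_] built from its own blocks gives a sum of squares, which
kills all blocks but those of an element of [n_]. *)
Lemma pr_eq X X' : X \in g_ R m -> X' \in g_ R m -> pr X = pr X' ->
  exists alpha, X' = X + X_ alpha.
Proof.
move=> Xg Xg' e.
have /gP3[A [b [c [x [As DE]]]]] : X' - X \in g_ R m by rewrite memvB.
pose v := mk_p A^T x (b + c)^T.
have vp : v \in p_ R m.
  by apply/pP; exists A^T, x, (b + c)^T; split=> //; rewrite trmxK As opprK.
have : \tr ((X' - X) *m v) = 0.
  move/lfunP/(_ (vsproj _ v)): e; rewrite !prE vsprojK // => e.
  have n2 : (2^-1 : R) != 0 by rewrite invr_eq0 pnatr_eq0.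
  by rewrite mulmxBl linearB /= (mulfI n2 e) subrr.
rewrite DE mk_g_p_trace.
have := mxtrace_sqr_ge0 A; have := dot_trmx_ge0 (b + c); have := sqr_ge0 x.
rewrite -expr2 => h1 h2 h3 h.
have A0 : A = 0 by apply: mxtrace_sqr_eq0; lra.
have /eqP : dot (b + c)^T (b + c) = 0 by lra.
rewrite dot_trmx_eq0 => /eqP bc.
have /eqP : x ^+ 2 = 0 by lra.
rewrite sqrf_eq0 => /eqP x0.
exists c^T; rewrite -[X'](subrK X) addrC DE X_mk_g A0 x0; congr (_ + mk_g _ _ _ _).
  by apply/eqP; rewrite trmxK -addr_eq0 bc.
by rewrite trmxK.
Qed.

Lemma pr_addX X alpha : X \in g_ R m -> pr (X + X_ alpha) = pr X.
Proof.
move=> Xg; apply/lfunP => u; rewrite !prE mulmxDl linearD /=.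
have /pP[A [e [al [As ->]]]] := subvsP u.
rewrite [\tr (X_ alpha *m _)](_ : _ = 0) ?addr0 //.
by rewrite X_mk_g mk_g_p_trace addNr dot0r mul0mx mxtrace0 mul0r !mulr0 !addr0.
Qed.

End Duals.

(** * Normal form of real skew-symmetric matrices *)

Section CharPoly.
Variable R : realType.

Lemma horner_char_poly n (A : 'M[R]_n) x : (char_poly A).[x] = \det (x%:M - A).
Proof.
rewrite /char_poly -horner_evalE -det_map_mx; congr determinant.
by apply/matrixP => i j; rewrite !mxE /= /horner_eval hornerD hornerN hornerC hornerMn hornerX.
Qed.

Lemma char_poly_isom n (P A : 'M[R]_n) : P^T *m P = 1%:M ->
  char_poly (P^T *m A *m P) = char_poly A.
Proof.
move=> PP; apply: poly_eq_on_neg => x _; rewrite !horner_char_poly.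
have -> : x%:M - P^T *m A *m P = P^T *m (x%:M - A) *m P.
  by rewrite mulmxBr mulmxBl mul_mx_scalar -scalemxAl PP scalemx1.
have := congr1 determinant PP; rewrite !det_mulmx det1 mulrAC => ->.
by rewrite mul1r.
Qed.

End CharPoly.

Section Orthogonal.
Variables (R : realType) (N : nat).
Implicit Types (u v c : 'cV[R]_N).
Local Notation dt := (bil (1%:M : 'M[R]_N)).

Lemma bil1E u v : dt u v = dot u^T v.
Proof. by rewrite /bil mulmx1. Qed.

(** Equal lengths suffice to move [a] to [b] by an orthogonal involution that
fixes all vectors pairing equally with [a] and [b]. *)
Lemma householder (a b : 'cV[R]_N) : dt a a = dt b b -> exists s : 'M[R]_N,
  [/\ s^T *m s = 1%:M, s *m s = 1%:M, s *m a = b &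
      forall c, dt a c = dt b c -> s *m c = c].
Proof.
move=> ab; have [<-|nab] := eqVneq a b.
  by exists 1%:M; rewrite trmx1 !mul1mx; split=> // c _; rewrite mul1mx.
have d0 : dt (a - b) (a - b) != 0.
  by rewrite bil1E dot_trmx_eq0 subr_eq0.
exists (refl 1%:M (a - b)); split.
- by have := @refl_isom R N 1%:M (trmx1 _ _) _ d0; rewrite mulmx1.
- exact: reflK.
- by apply: refl_swap => //; exact: trmx1.
- by move=> c ac; rewrite refl_fix // bilDl bilNl ac subrr.
Qed.

(** A first reflection moves [e0] to [u]; a second one, fixing [e0], moves [e1]
to the preimage of [v]. *)
Lemma orthogonal_pair (e0 e1 u v : 'cV[R]_N) :
  dt e0 e0 = dt u u -> dt e1 e1 = dt v v -> dt e0 e1 = dt u v -> dt u v = 0 ->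
  exists P : 'M[R]_N, [/\ P^T *m P = 1%:M, P *m e0 = u & P *m e1 = v].
Proof.
move=> eu ev euv uv.
have [s [sO ss se _]] := householder eu.
have sb a b : dt (s *m a) (s *m b) = dt a b by apply: bil_isom; rewrite mulmx1.
have su : s *m u = e0 by rewrite -se mulmxA ss mul1mx.
have /householder[s' [s'O s's' s'e s'f]] : dt e1 e1 = dt (s *m v) (s *m v).
  by rewrite sb.
exists (s *m s'); split.
- by rewrite trmx_mul -mulmxA (mulmxA s^T) sO mul1mx.
- rewrite -mulmxA s'f // -su sb (bilC _ v) ?trmx1 // uv -uv -euv su.
  by rewrite bilC ?trmx1.
- by rewrite -mulmxA s'e mulmxA ss mul1mx.
Qed.

End Orthogonal.

Section SkewNormalForm.
Variable R : realType.

Lemma dot_mulmx N (A : 'M[R]_N) d b : dot d (A *m b) = dot (d *m A) b.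
Proof. by rewrite /dot mulmxA. Qed.

Lemma dot_skew N (Y : 'M[R]_N) (u : 'rV[R]_N) : Y^T = - Y ->
  dot (u *m Y) u^T = 0.
Proof.
move=> Ys; have : dot (u *m Y) u^T = - dot (u *m Y) u^T.
  by rewrite -[LHS]dotC trmxK trmx_mul Ys mulNmx dotNr /dot mulmxA.
lra.
Qed.

(** If [u] is an eigenvector of [Y^T Y] for [x ^ 2], then [Y] rotates the plane of
[u] and [u Y / x] by a right angle and scales it by [x]. *)
Lemma skew_eigenplane N (Y : 'M[R]_N) (x : R) : Y^T = - Y -> 0 < x ->
  root (char_poly (Y^T *m Y)) (x ^+ 2) ->
  exists u v : 'rV[R]_N, [/\ dot u u^T = 1, dot v v^T = 1, dot u v^T = 0,
    u *m Y = x *: v & v *m Y = - (x *: u)].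
Proof.
move=> Ys x0; rewrite -eigenvalue_root_char => /eigenvalueP[w we w0].
have n0 : 0 < dot w w^T by rewrite lt0r dotxx_eq0 w0 dotxx_ge0.
have xn : x != 0 by rewrite gt_eqF.
pose u := (Num.sqrt (dot w w^T))^-1 *: w.
have uu : dot u u^T = 1.
  rewrite /u [(_ *: w)^T]linearZ /= dotZl dotZr mulrA -invfM -expr2 sqr_sqrtr ?ltW //.
  by rewrite mulVf // gt_eqF.
have ue : u *m Y *m Y = - (x ^+ 2 *: u).
  have -> : u *m Y *m Y = - (u *m (Y^T *m Y)) by rewrite Ys mulNmx mulmxN opprK mulmxA.
  by rewrite /u -scalemxAl we scalerA mulrC -scalerA.
pose v := x^-1 *: (u *m Y).
have vY : v *m Y = - (x *: u).
  by rewrite -scalemxAl ue scalerN scalerA expr2 mulKf.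
have uY : u *m Y = x *: v by rewrite scalerA divff ?scale1r.
exists u, v; split => //; last first.
  by rewrite -dotC trmxK /v dotZl dot_skew ?mulr0.
have -> : dot v v^T = x^-1 * dot v (u *m Y)^T by rewrite -dotZr -[_ *: _]linearZ.
rewrite trmx_mul Ys mulNmx dotNr dot_mulmx vY dotNl dotZl uu opprK mulr1.
by rewrite mulVf.
Qed.

(** An orthogonal basis starting with an eigenplane splits [Y] into blocks; the
characteristic polynomial of the complementary block is the remaining factor. *)
Lemma skew_normal_form n (x : nat -> R) (Y : 'M[R]_(n.*2.+1)) : Y^T = - Y ->
  (forall i, (1 <= i <= n)%N -> 0 < x i) ->
  char_poly (Y^T *m Y) = 'X * \prod_(1 <= i < n.+1) ('X - (x i ^+ 2)%:P) ^+ 2 ->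
  exists k : 'M[R]_(n.*2.+1), k *m k^T = 1%:M /\ k *m Y *m k^T = skew_diag _ n x.
Proof.
elim: n x Y => [|n IH] x Y Ys x0 chY.
  exists 1%:M; rewrite trmx1 !mul1mx mulmx1; split=> //.
  apply/matrixP => i j; rewrite skew_diagE // ltn0 /= !ord1.
  by have /matrixP/(_ 0 0) := Ys; rewrite !mxE; lra.
have x1 : 0 < x 1%N by apply: x0.
have rx : root (char_poly (Y^T *m Y)) (x 1%N ^+ 2).
  rewrite chY rootM big_nat_recl // rootM expr2 rootM root_XsubC eqxx.
  by rewrite /= orbT.
have [u [v [uu vv uv uY vY]]] := skew_eigenplane Ys x1 rx.
pose N' := n.*2.+1.
change 'M[R]_(2 + N') in Y.
pose e (i : 'I_2) : 'cV[R]_(2 + N') := delta_mx (lshift N' i) 0.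
have dte i j : bil 1%:M (e i) (e j) = (i == j)%:R.
  rewrite bil1E /dot /e trmx_delta mul_delta_mx_cond mulmxnE mxE.
  by rewrite (inj_eq (@lshift_inj _ _)) !eqxx; case: (i == j).
have [P [PP Pe0 Pe1]] : exists P : 'M[R]_(2 + N'),
    [/\ P^T *m P = 1%:M, P *m e 0 = u^T & P *m e 1 = v^T].
  by apply: orthogonal_pair; rewrite ?dte ?bil1E ?trmxK ?uu ?vv ?uv.
have PPt : P *m P^T = 1%:M by apply: mulmx1C.
have Pu : P^T *m u^T = e 0 by rewrite -Pe0 mulmxA PP mul1mx.
have Pv : P^T *m v^T = e 1 by rewrite -Pe1 mulmxA PP mul1mx.
have [W WE] : exists W, W = P^T *m Y *m P by exists (P^T *m Y *m P).
have Ws : W^T = - W.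
  by rewrite WE !trmx_mul trmxK Ys mulNmx mulmxN mulmxA.
have Yt (w : 'rV_(2 + N')) : Y *m w^T = - (w *m Y)^T.
  by rewrite trmx_mul Ys mulNmx opprK.
have We0 : W *m e 0 = - (x 1%N *: e 1).
  by rewrite WE -!mulmxA Pe0 Yt uY mulmxN trmxZ -scalemxAr Pv.
have We1 : W *m e 1 = x 1%N *: e 0.
  rewrite WE -!mulmxA Pe1 Yt vY trmxN opprK trmxZ.
  by rewrite -scalemxAr Pu.
have WW : W^T *m W = P^T *m (Y^T *m Y) *m P.
  rewrite WE !trmx_mul trmxK !mulmxA.
  by rewrite -(mulmxA _ P P^T) PPt mulmx1.
have chW : char_poly (W^T *m W) = char_poly (Y^T *m Y).
  by rewrite WW char_poly_isom.
pose c : nat -> R := fun=> x 1%N.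
pose Y' := drsubmx W.
have S_E (i j : 'I_2) : skew_diag 2 1 c i j =
    if j == 0 then - (x 1%N * (i == 1)%:R) else x 1%N * (i == 0)%:R.
  rewrite skew_diagE // /c -!(inj_eq val_inj) /= val_mate.
  by case: i => [[|[|i]] p] //; case: j => [[|[|j]] q] //=;
    rewrite ?(expr0, expr1, mul1r, mulN1r, mulr1, mulr0, oppr0).
have WB : W = block_mx (skew_diag 2 1 c) 0 0 Y'.
  have W0 i : W i (lshift N' 0) = - (x 1%N * (i == lshift N' 1)%:R).
    by have /colP/(_ i) := We0; rewrite /e -colE !mxE eqxx andbT.
  have W1 i : W i (lshift N' 1) = x 1%N * (i == lshift N' 0)%:R.
    by have /colP/(_ i) := We1; rewrite /e -colE !mxE eqxx andbT.
  have Wl i (j : 'I_2) : W i (lshift N' j) =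
      if j == 0 then - (x 1%N * (i == lshift N' 1)%:R)
      else x 1%N * (i == lshift N' 0)%:R.
    case: eqVneq => [->|]; first exact: W0.
    by case: j => [[|[|]]] // p _; rewrite -W1; congr (W _ (lshift _ _)); apply: val_inj.
  have Wt i j : W i j = - W j i.
    by have /matrixP/(_ j i) := Ws; rewrite !mxE.
  rewrite -[LHS]submxK; congr block_mx.
  - apply/matrixP => i j; by rewrite S_E !mxE Wl !(inj_eq (@lshift_inj _ _)).
  - apply/matrixP => i j; rewrite !mxE Wt Wl; case: ifP => _.
    by rewrite eq_rlshift mulr0 !oppr0.
    by rewrite eq_rlshift mulr0 oppr0.
  - apply/matrixP => i j; rewrite !mxE Wl; case: ifP => _.
    by rewrite eq_rlshift mulr0 !oppr0.
    by rewrite eq_rlshift mulr0.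
have Y's : Y'^T = - Y'.
  apply/matrixP => i j; have /matrixP/(_ (rshift 2 i) (rshift 2 j)) := Ws.
  by rewrite !mxE.
have ch' : char_poly (Y'^T *m Y') =
    'X * \prod_(1 <= i < n.+1) ('X - (x i.+1 ^+ 2)%:P) ^+ 2.
  have S2 : (skew_diag 2 1 c)^T *m skew_diag 2 1 c = (x 1%N ^+ 2)%:M :> 'M[R]_2.
    apply/matrixP => i j; rewrite mxE !big_ord_recl big_ord0 ![_^T _ _]mxE !S_E [RHS]mxE.
    by case: i => [[|[|i]] p] //; case: j => [[|[|j]] q] //=; ring.
  have : char_poly (W^T *m W) = ('X - (x 1%N ^+ 2)%:P) ^+ 2 * char_poly (Y'^T *m Y').
    rewrite WB tr_block_mx mulmx_block !trmx0 !(mulmx0, mul0mx, addr0, add0r) S2.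
    rewrite /char_poly char_block_diag_mx det_ublock; congr (_ * _).
    rewrite /char_poly_mx map_scalar_mx -raddfB det_scalar //.
  rewrite chW chY big_nat_recl // mulrCA => /(mulfI _) <- //.
  by rewrite expf_neq0 // polyXsubC_eq0.
have x_tail_gt0 i : (1 <= i <= n)%N -> 0 < x i.+1 by move=> /andP[_ lin]; apply: x0.
have [k' [kk kY]] := IH (fun i => x i.+1) Y' Y's x_tail_gt0 ch'.
change (exists k : 'M[R]_(2 + N'), k *m k^T = 1%:M /\
  k *m Y *m k^T = skew_diag (2 + N') n.+1 x).
exists (block_mx 1%:M 0 0 k' *m P^T); split.
  rewrite trmx_mul trmxK mulmxA -(mulmxA _ P^T) PP mulmx1 tr_block_mx mulmx_block.
  by rewrite !trmx0 trmx1 !(mulmx0, mul0mx, addr0, add0r, mul1mx) kk -scalar_mx_block.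
have -> : block_mx 1%:M 0 0 k' *m P^T *m Y *m (block_mx 1%:M 0 0 k' *m P^T)^T
   = block_mx 1%:M 0 0 k' *m W *m (block_mx 1%:M 0 0 k')^T.
  by rewrite trmx_mul trmxK WE !mulmxA.
rewrite WB tr_block_mx !mulmx_block !trmx0 trmx1.
rewrite !(mulmx0, mul0mx, addr0, add0r, mul1mx, mulmx1) kY.
apply/matrixP => i j.
case: (split_ordP i) => i' ->; case: (split_ordP j) => j' ->.
- rewrite block_mxEul !skew_diagE // -!(inj_eq val_inj) /= !val_mate /=.
  by case: i' => [[|[|]]] //; case: j' => [[|[|]]].
- rewrite block_mxEur skew_diagE // [LHS]mxE -!(inj_eq val_inj) /= !val_mate /=.
  by case: i' => [[|[|]]].
- rewrite block_mxEdl skew_diagE // [LHS]mxE -!(inj_eq val_inj) /= !val_mate /=.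
  rewrite ifN //; apply/negP => /andP[_ /eqP]; rewrite negbK add0n.
  have := ltn_ord j'; have := odd_double_half i'.
  by case: ifP => oi; [|case: ifP => _]; lia.
- rewrite block_mxEdr !skew_diagE // -!(inj_eq val_inj) /= !val_mate /=.
  rewrite !add0n !negbK ltnS; congr (if _ && _ then _ else _).
  have -> : ((2 + i').+1 < 2 + N')%N = (i'.+1 < N')%N by [].
  have := odd_double_half i'.
  case: ifP => oi; [|case: ifP => _]; move=> h; apply/eqP/eqP; lia.
Qed.

End SkewNormalForm.

(** * The resolvent at the isotropic vector *)

Section Key.
Variables (R : realType) (m : nat).
Local Notation M := (m + 1 + 1)%N.
Local Notation I := (I_m1 R m).
Local Notation mx3 := (@mx3 R m).
Local Notation lor := (bil I).
Local Notation v0 := (v0 R m).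
Implicit Types (Y : 'M[R]_m) (alpha beta : 'rV[R]_m) (X g : 'M[R]_M).

Lemma det_border n (c : 'cV[R]_n) (r : 'rV[R]_n) (k : R) :
  \det (block_mx 1%:M c r k%:M) = k - dot r c.
Proof.
have -> : block_mx 1%:M c r k%:M =
    block_mx 1%:M 0 r 1%:M *m block_mx 1%:M c 0 (k - dot r c)%:M.
  rewrite mulmx_block !(mulmx1, mul1mx, mulmx0, mul0mx, addr0, add0r).
  by rewrite dotE -raddfD /= addrC subrK.
by rewrite det_mulmx det_lblock det_ublock !det1 det_scalar1 !mul1r.
Qed.

Lemma X_Yb0_add Y beta alpha : X_Yb0 Y beta + X_ alpha =
  mx3 Y (beta - alpha)^T (beta + alpha)^T (alpha - beta) 0 0 (beta + alpha) 0 0.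
Proof.
rewrite /X_Yb0 X_E add_mx3 !addr0 [(beta - _)^T]linearB [(beta + _)^T]linearD /=.
by congr (mx3 _ _ _ _ _ _ _ _ _); rewrite addrC.
Qed.

Lemma X_Yb0_in_g Y beta : Y^T = - Y -> X_Yb0 Y beta \in g_ R m.
Proof.
move=> Ys; apply/gP3; exists Y, beta^T, beta^T, 0; split=> //.
by rewrite /mk_g trmxK.
Qed.

(** Cramer's rule for the coordinate of [y = (x - X)^-1 v0] along the isotropic
line opposite to [v0]: replacing that column of [x - X] by [v0] leaves a
determinant in which [alpha] no longer occurs. *)
Lemma resolvent_v0 Y beta alpha x y : Y *m beta^T = 0 -> x != 0 ->
  (x%:M - (X_Yb0 Y beta + X_ alpha)) *m y = v0 ->
  - (x * lor v0 y * \det (x%:M - (X_Yb0 Y beta + X_ alpha))) =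
  4 * dot beta beta^T * \det (x%:M - Y).
Proof.
move=> Yb x0; have [b [e [f ->]]] := col3P y.
rewrite {}X_Yb0_add.
set bm := beta - alpha; set bp := beta + alpha; set ap := alpha - beta.
set X := mx3 _ _ _ _ _ _ _ _ _ => Hy.
have Hdet : \det (x%:M - X) * (f - e) = \det (x%:M - Y) * (4 / x * dot beta beta^T).
  have detE : \det (mx3 1%:M 0 b 0 1 e 0 1 f) = f - e.
    by rewrite /Defs.mx3 -scalar_mx_block det_border /dot mul_row_col
      mul0mx add0r mul1mx mxE eqxx mulr1n.
  (* Subtracting the last row from the row above it leaves only beta there. *)
  have detL : \det (mx3 1%:M 0 0 0 1 (-1) 0 0 1) = 1.
    by rewrite /Defs.mx3 raddf0 row_mx0 -scalar_mx_block det_ublock det1 det_scalar1 mulr1.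
  have prodE : mx3 1%:M 0 0 0 1 (-1) 0 0 1 *m ((x%:M - X) *m mx3 1%:M 0 b 0 1 e 0 1 f)
      = mx3 (x%:M - Y) (- (2 *: beta^T)) 0 (2 *: beta) 0 0 (- bp) x 1.
    move: Hy; rewrite /X mx3_scalar opp_mx3 add_mx3 mul_mx3_col3 => /col3_inj[h1 h2 h3].
    rewrite mul_mx3 h1 h2 h3 mul_mx3 !mx3E.
    congr (mx3 _ _ _ _ _ _ _ _ _); try by ring.
      by apply/matrixP => i j; rewrite /bm /bp !mxE; ring.
    by apply/matrixP => i j; rewrite /ap /bp !mxE; ring.
  rewrite -[LHS]mul1r -{1}detL -detE -[X in _ * X]det_mulmx -det_mulmx prodE.
  have colE : block_mx (x%:M - Y) (- (2 *: beta^T)) (2 *: beta) 0%:M *m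
      block_mx 1%:M ((2 / x) *: beta^T) 0 1%:M =
      block_mx (x%:M - Y) 0 (2 *: beta) (4 / x * dot beta beta^T)%:M.
    rewrite mulmx_block !(mulmx1, mulmx0, addr0) mulmxBl -!scalemxAr -scalemxAl.
    rewrite Yb scaler0 subr0 mul_scalar_mx dotE scale_scalar_mx.
    rewrite scalerA divfK // addrN raddf0 addr0 scale_scalar_mx.
    by congr (block_mx _ _ _ _%:M); field.
  have := congr1 determinant colE.
  rewrite [LHS]det_mulmx det_ublock det_lblock !det1 !mulr1 det_scalar1 => <-.
  by rewrite /Defs.mx3 [col_mx _ _](_ : _ = 0) ?det_lblock ?det_scalar1 ?mulr1 // raddf0 col_mx0.
have -> : lor v0 (col3 b e f) = e - f by rewrite bil_col3 trmx0 !mx3E.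
transitivity (x * (\det (x%:M - X) * (f - e))); first by ring.
by rewrite Hdet; field.
Qed.

End Key.

(** * The torus element *)

Lemma big_half (T : Type) (idx : T) (op : Monoid.law idx) (n : nat) (F : nat -> T) :
  \big[op/idx]_(0 <= j < n.*2) F j =
  \big[op/idx]_(0 <= i < n) op (F i.*2) (F i.*2.+1).
Proof.
elim: n => [|n IH]; first by rewrite !big_geq.
by rewrite doubleS !big_nat_recr //= IH Monoid.mulmA.
Qed.

Section Torus.
Variables (R : realType) (m n : nat) (a : nat -> R).
Hypothesis hm : (m + 1 = n.*2)%N.
Local Notation M := (m + 1 + 1)%N.
Local Notation I := (I_m1 R m).

Definition torus_blk : 'M[R]_(m + 1) := skew_diag (m + 1) n a.
Definition torus_mx : 'M[R]_M := skew_diag (m + 1 + 1) n a.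
Local Notation t0 := torus_blk.
Local Notation t := torus_mx.

(** The diagonal entries of [- t0 ^ 2]. *)
Definition dsq (j : nat) : R := a j./2.+1 ^+ 2.

Lemma half_lt (j : 'I_(m + 1)) : (j./2 < n)%N.
Proof. by have := ltn_ord j; have := odd_double_half j; lia. Qed.

Lemma even_m1 : ~~ odd (m + 1). Proof. by rewrite hm odd_double. Qed.

Lemma torus_blkE i j : t0 i j = if j == mate i then (-1) ^+ odd i * a i./2.+1 else 0.
Proof. by rewrite skew_diagE ?hm // half_lt. Qed.

Lemma torus_mx_block : t = block_mx t0 0 0 0.
Proof.
have le1 : (n.*2 <= m + 1)%N by rewrite hm.
have le2 : (n.*2 <= m + 1 + 1)%N by rewrite hm addn1.
apply/matrixP => i j; rewrite skew_diagE //.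
case: (split_ordP i) => i' ->; case: (split_ordP j) => j' ->.
- rewrite block_mxEul torus_blkE -!(inj_eq val_inj) /= half_lt !val_mate /=.
  congr (if _ == _ then _ else _).
  have := ltn_ord i'; have := odd_double_half i'.
  case: (odd i') => //=; case: ifP => h1; case: ifP => h2 //=; lia.
- rewrite block_mxEur [RHS]mxE -!(inj_eq val_inj) /= !val_mate /= ifN //.
  apply/negP => /andP[_ /eqP]; have := ltn_ord i'; have := odd_double_half i'.
  case: (odd i') => //=; [|case: ifP => h1]; lia.
- rewrite block_mxEdl [RHS]mxE ifN //= negb_and -leqNgt.
  by apply/orP; left; have := odd_double_half (m + 1 + i'); lia.
- rewrite block_mxEdr [RHS]mxE ifN //= negb_and -leqNgt.
  by apply/orP; left; have := odd_double_half (m + 1 + i'); lia.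
Qed.

Lemma tr_torus_blk : t0^T = - t0.
Proof.
apply/matrixP => i j; rewrite [LHS]mxE [RHS]mxE !torus_blkE.
rewrite -(inj_eq (can_inj (@mateK _)) j) mateK eq_sym.
case: eqVneq => [<-|]; last by rewrite oppr0.
by rewrite half_mate odd_mate ?even_m1 //; case: (odd j) => /=; ring.
Qed.

Lemma tr_torus_mx : t^T = - t.
Proof. by rewrite torus_mx_block tr_block_mx tr_torus_blk !trmx0 opp_block_mx !oppr0. Qed.

Lemma I_block : I = block_mx 1%:M 0 0 (-1)%:M.
Proof. by rewrite /I_m1 /Defs.mx3 raddf0 col_mx0 row_mx0 -scalar_mx_block. Qed.

Lemma mul_I_torus : I *m t = t.
Proof.
by rewrite I_block torus_mx_block mulmx_block !(mulmx0, mul0mx, addr0, mul1mx).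
Qed.

Lemma mul_torus_I : t *m I = t.
Proof.
by rewrite I_block torus_mx_block mulmx_block !(mulmx0, mul0mx, addr0, mulmx1).
Qed.

Lemma torus_in_g : t \in g_ R m.
Proof. by apply/gP; rewrite mul_torus_I tr_torus_mx mulmxN mul_I_torus subrr. Qed.

Lemma torus_blk_sqr : t0 *m t0 = diag_mx (\row_j - dsq j).
Proof.
apply/matrixP => i j; rewrite mxE (bigD1 (mate i)) //= big1 ?addr0; last first.
  by move=> k /negbTE ki; rewrite torus_blkE ki mul0r.
rewrite !torus_blkE eqxx mateK !mxE eq_sym; case: eqVneq => [->|] ; last by rewrite mulr0 mulr0n.
rewrite half_mate odd_mate ?even_m1 // mulr1n /dsq.
by case: (odd j) => /=; ring.
Qed.

Lemma torus_sub_tr x : (x%:M - t) *m (x%:M - t)^T =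
  block_mx (diag_mx (\row_j (x ^+ 2 + dsq j))) 0 0 (x ^+ 2)%:M.
Proof.
have -> : (x%:M - t)^T = x%:M + t by rewrite trmxD trmxN tr_scalar_mx tr_torus_mx opprK.
have -> : (x%:M - t) *m (x%:M + t) = (x ^+ 2)%:M - t *m t.
  rewrite mulmxDr !mulmxBl -scalar_mxM mul_mx_scalar mul_scalar_mx expr2.
  by rewrite addrA subrK.
rewrite torus_mx_block mulmx_block !(mulmx0, mul0mx, addr0) torus_blk_sqr [(x ^+ 2)%:M in LHS]scalar_mx_block.
rewrite opp_block_mx add_block_mx !oppr0 !addr0; congr (block_mx _ _ _ _).
apply/matrixP => i j; rewrite !mxE; case: (i == j); rewrite ?mulr1n ?mulr0n //.
  by rewrite opprK.
by rewrite subr0.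
Qed.

Lemma prod_dsq (F : R -> R) :
  \prod_(j < m + 1) F (dsq j) = \prod_(1 <= i < n.+1) F (a i ^+ 2) ^+ 2.
Proof.
rewrite -(big_mkord xpredT (fun j => F (dsq j))) hm big_half [RHS]big_add1 /=.
by apply: eq_bigr => i _; rewrite /dsq /= uphalf_double doubleK -expr2.
Qed.

(** The determinant of [(x - t) (x - t)^T], a diagonal matrix, is the square of
that of [x - t]; two monic polynomials with the same square are equal. *)
Lemma char_poly_torus : char_poly t = 'X * \prod_(1 <= i < n.+1) ('X^2 + (a i ^+ 2)%:P).
Proof.
set p := RHS.
have pm : p \is monic.
  rewrite monicMl ?monicX // monic_prod // => i _.
  by rewrite monicE lead_coefDl ?lead_coefXn // size_polyC size_polyXn; case: eqP.
have sq : char_poly t ^+ 2 = p ^+ 2.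
  apply: poly_eq_on_neg => x _; rewrite !horner_exp horner_char_poly.
  have e : (x%:M - t) *m (x%:M - t)^T =
      block_mx (diag_mx (\row_j (x ^+ 2 + dsq j))) 0 0 (x ^+ 2)%:M.
    exact: torus_sub_tr.
  have := congr1 determinant e; rewrite det_mulmx det_tr -expr2 => ->.
  rewrite det_ublock det_scalar1 det_diag.
  under eq_bigr do rewrite mxE.
  rewrite (prod_dsq (fun y => x ^+ 2 + y)) /p hornerM hornerX exprMn mulrC.
  rewrite horner_prod prodrXl; congr (_ * _ ^+ 2).
  by apply: eq_bigr => i _; rewrite !hornerE.
move/eqP: sq; rewrite eqf_sqr => /orP[/eqP//|/eqP pN].
have := char_poly_monic t; rewrite pN monicE lead_coefN (monicP pm).
by move=> /eqP h; exfalso; move: h; lra.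
Qed.

End Torus.

(** * The secular identity *)

Section Orbit.
Variables (R : realType) (m n : nat) (a : nat -> R).
Hypothesis hm : (m + 1 = n.*2)%N.
Local Notation M := (m + 1 + 1)%N.
Local Notation I := (I_m1 R m).
Local Notation lor := (bil I).
Local Notation v0 := (v0 R m).
Local Notation t := (torus_mx m n a).
Local Notation dsq := (dsq a).
Implicit Types (g : 'M[R]_M) (u v : 'cV[R]_(m + 1)).

Definition bsq (i : nat) : R := a i.+1 ^+ 2.

Definition weight u (i : nat) : R := \sum_(j < m + 1 | j./2 == i) u j 0 ^+ 2.

Lemma weight_ge0 u i : 0 <= weight u i.
Proof. by apply: sumr_ge0 => j _; exact: sqr_ge0. Qed.

Lemma sum_weight u (F : nat -> R) :
  \sum_(j < m + 1) u j 0 ^+ 2 * F j./2 = \sum_(i < n) weight u i * F i.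
Proof.
rewrite (partition_big (fun j : 'I_(m + 1) => Ordinal (half_lt hm j)) predT) //=.
apply: eq_bigr => i _; rewrite /weight mulr_suml.
apply: eq_big => [j|j /eqP <-] //.
Qed.

Lemma lor_col_mx u v (s x : R) :
  lor (col_mx u s%:M) (col_mx v x%:M) = dot u^T v - s * x.
Proof.
rewrite /bil I_block tr_col_mx mul_row_block !(mulmx0, addr0, add0r) mulmx1.
rewrite mul_row_col (mul_mx_scalar (-1)) scaleN1r tr_scalar_mx mulNmx -scalar_mxM.
by rewrite dotE -raddfB /= mxE eqxx mulr1n.
Qed.

Lemma lor_skew (y : 'cV[R]_M) : lor y (t *m y) = 0.
Proof.
have e : lor y (t *m y) = dot (y^T *m t) y^T^T.
  by rewrite trmxK /bil /dot -!mulmxA (mulmxA I) mul_I_torus // mulmxA.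
by rewrite e; apply: dot_skew; exact: tr_torus_mx.
Qed.

(** When [s i] is the weight of an isotropic vector in the [i]-th plane times
[bsq i], the roots of this polynomial turn out to be the squares of the singular
values. *)
Definition secular (s : nat -> R) : {poly R} :=
  \sum_(i < n) s i *: \prod_(k < n | k != i) ('X - (bsq k)%:P).

Lemma horner_secular s x : (secular s).[- x] =
  (-1) ^+ n.-1 * \sum_(i < n) s i * \prod_(k < n | k != i) (x + bsq k).
Proof.
rewrite /secular horner_sum mulr_sumr; apply: eq_bigr => i _.
rewrite hornerZ horner_prod mulrCA; congr (_ * _).
have -> : n.-1 = #|[pred k : 'I_n | k != i]|.
  by rewrite -[n in LHS]card_ord -(cardC1 i); apply: eq_card => k; rewrite !inE.
rewrite -prodrN; apply: eq_bigr => k _; rewrite !hornerE.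
by rewrite opprD.
Qed.

(** In the frame of the torus [(x - t)^-1 z] is explicit, because
[(x - t) (x - t)^T] is diagonal, and the skew part of [(x - t)^T] does not
contribute to the pairing with [z].  Isotropy of [z] eliminates its time
coordinate. *)
Lemma secular_identity g Y beta alpha u s x : O_m1 R m g ->
  Y *m beta^T = 0 -> g *m t *m invmx g = X_Yb0 Y beta + X_ alpha ->
  invmx g *m v0 = col_mx u s%:M -> x != 0 ->
  4 * dot beta beta^T * \det (x%:M - Y) =
  x * \sum_(i < n) weight u i * bsq i * \prod_(k < n | k != i) (x ^+ 2 + bsq k).
Proof.
move=> Og Yb gE zE x0; have gu := O_unit Og.
set z := col_mx u s%:M in zE.
have x2 : 0 < x ^+ 2 by rewrite exprn_even_gt0.
have xd j : x ^+ 2 + dsq j != 0 by rewrite gt_eqF // ltr_wpDr // sqr_ge0.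
have xb i : x ^+ 2 + bsq i != 0 by rewrite gt_eqF // ltr_wpDr // sqr_ge0.
pose w' : 'cV[R]_(m + 1) := \col_j (u j 0 / (x ^+ 2 + dsq j)).
pose w : 'cV[R]_M := col_mx w' (s / x ^+ 2)%:M.
have zw : z = (x%:M - t) *m ((x%:M - t)^T *m w).
  rewrite mulmxA torus_sub_tr // /w mul_block_col !mul0mx addr0 add0r -scalar_mxM.
  rewrite /z; congr (col_mx _ _%:M); last by rewrite mulrC divfK ?gt_eqF.
  by apply/colP => j; rewrite mul_diag_mx !mxE mulrC divfK.
pose y := g *m ((x%:M - t)^T *m w).
have xX : x%:M - (X_Yb0 Y beta + X_ alpha) = g *m (x%:M - t) *m invmx g.
  by rewrite -gE mulmxBr mulmxBl mul_mx_scalar -scalemxAl mulmxV // scalemx1.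
have yE : (x%:M - (X_Yb0 Y beta + X_ alpha)) *m y = v0.
  by rewrite xX /y -!mulmxA mulKmx // -zw -zE mulKVmx.
rewrite -(resolvent_v0 Yb x0 yE).
have detE : \det (x%:M - (X_Yb0 Y beta + X_ alpha)) = x * \prod_(i < n) (x ^+ 2 + bsq i).
  rewrite xX !det_mulmx det_inv mulrAC divff ?mul1r; last by rewrite -unitfE -unitmxE.
  rewrite -horner_char_poly char_poly_torus // hornerM hornerX; congr (_ * _).
  by rewrite horner_prod big_add1 big_mkord; apply: eq_bigr => i _; rewrite !hornerE.
have lorE : lor v0 y = x * lor z w.
  have {1}-> : v0 = g *m z by rewrite -zE mulKVmx.
  rewrite /y O_bil //.
  have -> : (x%:M - t)^T *m w = x *: w + t *m w.
    by rewrite trmxD trmxN tr_torus_mx // opprK tr_scalar_mx mulmxDl mul_scalar_mx.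
  rewrite bilDr ?tr_I // bilZr ?tr_I //.
  suff -> : lor z (t *m w) = 0 by rewrite addr0.
  have -> : z = x ^+ 2 *: w - t *m (t *m w).
    rewrite {1}zw trmxD trmxN tr_torus_mx // opprK tr_scalar_mx.
    rewrite [(_ + t) *m w]mulmxDl mulmxDr !mulmxBl !mul_scalar_mx -!scalemxAr.
    by rewrite scalerA -expr2 addrA subrK.
  rewrite bilDl bilZl bilNl lor_skew (bilC _ (t *m _)) ?tr_I // lor_skew.
  by rewrite mulr0 subr0.
have s2 : s ^+ 2 = \sum_(j < m + 1) u j 0 ^+ 2.
  have : lor z z = 0.
    rewrite -zE (O_bil _ _ (O_invmx Og)).
    transitivity (lor (col3 0 1 1) (col3 0 1 1)); first by [].
    by rewrite bil_col3 trmx0 !mx3E subrr.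
  have h : lor z z = dot u^T u - s * s by exact: lor_col_mx.
  rewrite h => /eqP; rewrite subr_eq0 -expr2 => /eqP <-.
  by have := dotxx u^T; rewrite trmxK => ->; apply: eq_bigr => j _; rewrite mxE.
have zwE : - (x ^+ 2 * lor z w) = \sum_(i < n) weight u i * (bsq i / (x ^+ 2 + bsq i)).
  rewrite -(sum_weight u (fun i => bsq i / (x ^+ 2 + bsq i))) /z /w lor_col_mx.
  rewrite mulrA -expr2 mulrBr mulrCA divff ?mulr1 ?gt_eqF // s2 opprB.
  rewrite /dot mxE mulr_sumr -sumrB; apply: eq_bigr => j _; rewrite !mxE.
  rewrite -/(bsq _) -[dsq j]/(bsq j./2); field.
  exact: xb.
rewrite detE lorE.
transitivity (- (x ^+ 2 * lor z w) * (x * \prod_(i < n) (x ^+ 2 + bsq i))).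
  by ring.
rewrite zwE mulrCA mulr_suml; congr (_ * _); apply: eq_bigr => i _.
by rewrite [in LHS](bigD1 i) //=; field; exact: xb.
Qed.

End Orbit.

(** * The sign of the Pfaffian, and normal forms modulo n *)

Section Sign.
Variables (R : realType) (m n : nat) (a : nat -> R).
Hypothesis hm : (m + 1 = n.*2)%N.
Local Notation M := (m + 1 + 1)%N.
Local Notation I := (I_m1 R m).
Local Notation lor := (bil I).
Local Notation v0 := (v0 R m).
Local Notation t := (torus_mx m n a).
Local Notation t0 := (torus_blk m n a).
Implicit Types (Y : 'M[R]_m) (alpha beta : 'rV[R]_m) (X g : 'M[R]_M).

Lemma Pf_skew_diag_eq N (c : nat -> R) : (N = n.*2)%N ->
  exists2 k, 0 < k & Pf (skew_diag N n c) = (\prod_(1 <= i < n.+1) c i) * k.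
Proof.
move=> ->; exists (Pf (skew_diag n.*2 n (fun=> 1 : R))).
  exact: Pf_skew_diag1_gt0.
exact: Pf_skew_diag.
Qed.

(** A basis of the orthogonal of [v0]: the first [m] basis vectors and [v0]. *)
Definition v0_perp : 'M[R]_(M, m + 1) := col_mx 1%:M (row_mx 0 1%:M).

Lemma v0_perp_form Y beta alpha :
  v0_perp^T *m I *m (X_Yb0 Y beta + X_ alpha) *m v0_perp =
  block_mx Y (2 *: beta^T) (- (2 *: beta)) 0.
Proof.
have compress (P : 'M[R]_(m + 1)) c r (rho : 'rV[R]_(m + 1)) :
    (col_mx 1%:M rho)^T *m I *m block_mx P c r 0%:M *m col_mx 1%:M rho =
    P + c *m rho - rho^T *m r.
  rewrite I_block tr_col_mx trmx1 mul_row_block !(mulmx1, mulmx0, addr0, add0r).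
  rewrite (mul_mx_scalar (-1)) scaleN1r mul_row_block !mul1mx raddf0 mulmx0 addr0.
  by rewrite mul_row_col mulmx1 mulNmx addrAC.
rewrite X_Yb0_add /v0_perp [Defs.mx3 _ _ _ _ _ _ _ _ _]/Defs.mx3 compress.
rewrite tr_row_mx trmx0 trmx1 !mul_col_row !raddf0.
rewrite !(mulmx0, mulmx1, mul0mx, mul1mx) opp_block_mx !add_block_mx !oppr0 !addr0.
congr (block_mx _ _ _ _); apply/matrixP => i j; rewrite !mxE; ring.
Qed.

(** Only the spacelike coordinates of the transported basis enter, because [t]
kills the time axis. *)
Lemma v0_perp_conj g Y beta alpha : O_m1 R m g ->
  g *m t *m invmx g = X_Yb0 Y beta + X_ alpha ->
  block_mx Y (2 *: beta^T) (- (2 *: beta)) 0 =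
  (usubmx (invmx g *m v0_perp))^T *m t0 *m usubmx (invmx g *m v0_perp).
Proof.
move=> Og gE; rewrite -(v0_perp_form Y beta alpha) -gE.
have -> : v0_perp^T *m I *m (g *m t *m invmx g) *m v0_perp =
    (invmx g *m v0_perp)^T *m (I *m t) *m (invmx g *m v0_perp).
  have := O_invI (O_invmx Og); rewrite invmxK => e.
  by rewrite trmx_mul !mulmxA -(mulmxA _ I g) e !mulmxA.
rewrite mul_I_torus // torus_mx_block // -[invmx g *m v0_perp in LHS]vsubmxK tr_col_mx.
by rewrite mul_row_block mul_row_col !(mulmx0, mul0mx, addr0).
Qed.

(** Completing the basis of the orthogonal of [v0] by the image of the time axis
reduces the determinant to the pairing of that image with [v0], whose sign is
given by the time direction. *)
Lemma det_v0_perp g : O_m1 R m g -> 0 < timec g ->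
  0 < \det g * \det (usubmx (invmx g *m v0_perp)).
Proof.
move=> Og tg; have gu := O_unit Og.
set h := invmx g *m v0_perp.
have [b [e [ge _]]] := O_time_col Og.
have : lor (g *m e_time R m) v0 < 0 by rewrite -timec_gt0.
rewrite ge bil_col3 dot0r add0r !mulr1 subr_lt0 => et.
have e1 : block_mx (usubmx h) 0 (dsubmx h) 1%:M = invmx g *m row_mx v0_perp (g *m e_time R m).
  rewrite mul_mx_row mulKmx // -/h -[h in RHS]vsubmxK /e_time /col3 raddf0 col_mx0.
  by rewrite block_mxEh.
have e2 : \det (row_mx v0_perp (g *m e_time R m)) = timec g - e.
  rewrite ge /v0_perp /col3 -block_mxEh det_border /dot mul_row_col mul0mx add0r.
  by rewrite mul1mx mxE eqxx mulr1n.
have := congr1 determinant e1; rewrite det_lblock det1 mulr1 det_mulmx det_inv e2 => ->.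
by rewrite mulrA divff ?mul1r ?subr_gt0 // -unitfE -unitmxE.
Qed.

Lemma norm2_gt0 beta : beta != 0 -> 0 < norm2 beta.
Proof. by move=> b0; rewrite sqrtr_gt0 lt0r -/(dot beta beta^T) dotxx_eq0 b0 dotxx_ge0. Qed.

Lemma norm2_sqr beta : norm2 beta ^+ 2 = dot beta beta^T.
Proof. by rewrite sqr_sqrtr // -/(dot beta beta^T) dotxx_ge0. Qed.

Lemma Pf_Z Y beta : beta != 0 ->
  Pf (block_mx Y (2 *: beta^T) (- (2 *: beta)) 0) = 2 * norm2 beta * Pf (Z_Yb Y beta).
Proof.
move=> /norm2_gt0 b0; have bn : norm2 beta != 0 by rewrite gt_eqF.
pose D : 'M[R]_(m + 1) := block_mx 1%:M 0 0 (2 * norm2 beta)%:M.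
have -> : block_mx Y (2 *: beta^T) (- (2 *: beta)) 0 = D *m Z_Yb Y beta *m D^T.
  rewrite /D /Z_Yb tr_block_mx !mulmx_block !trmx0 trmx1 tr_scalar_mx.
  rewrite !(mulmx0, mul0mx, addr0, add0r, mulmx1, mul1mx) mul_mx_scalar mul_scalar_mx.
  by rewrite scalerN !scalerA mulfK.
rewrite Pf_congr ?even_m1 //; last exact: (even_m1 hm).
by rewrite /D det_lblock det1 det_scalar1 mul1r.
Qed.

(** Both sides are signs of the Pfaffian of the same skew form on the orthogonal
of [v0]. *)
Lemma sg_Pf_Z g Y beta alpha : O_m1 R m g -> 0 < timec g -> beta != 0 ->
  g *m t *m invmx g = X_Yb0 Y beta + X_ alpha ->
  Num.sg (Pf (Z_Yb Y beta)) = \det g * Num.sg (\prod_(1 <= i < n.+1) a i).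
Proof.
move=> Og tg b0 gE.
have := v0_perp_conj Og gE; set B := usubmx _ => BE.
have dB : 0 < \det g * \det B by exact: det_v0_perp.
have [k k0 PfE] := Pf_skew_diag_eq a hm.
have PfB : Pf (B^T *m t0 *m B) = \det B * Pf t0.
  by rewrite -{2}[B]trmxK Pf_congr ?det_tr //; exact: (even_m1 hm).
have := congr1 (@Pf R _) BE; rewrite Pf_Z // PfB PfE => e.
have : Num.sg (2 * norm2 beta * Pf (Z_Yb Y beta)) = Num.sg (Pf (Z_Yb Y beta)).
  by rewrite sgrM gtr0_sg ?mul1r // mulr_gt0 // norm2_gt0.
rewrite e => <-; rewrite !sgrM (gtr0_sg k0) mulr1; congr (_ * _).
by have [dg|dg] := O_det Og; move: dB; rewrite dg ?mul1r ?mulN1r ?oppr_gt0 => h;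
  rewrite ?(gtr0_sg h) ?(ltr0_sg h).
Qed.

(** The unipotent part of the parabolic subgroup brings any element that does
not stabilize the line of [v0] to the normal form, modulo n. *)
Lemma normal_form X : X \in g_ R m -> (forall e, X *m v0 <> e *: v0) ->
  exists alpha Y beta gamma, [/\ Y^T = - Y, beta != 0, Y *m beta^T = 0 &
    expN alpha *m X *m invmx (expN alpha) = X_Yb0 Y beta + X_ gamma].
Proof.
move=> /gP3[A [b [c [e [As ->]]]]]; rewrite mk_g_v0 => nv.
have [w wE] : exists w, w = b + c by exists (b + c).
rewrite -wE in nv.
have w0 : w != 0 by apply/eqP => w0; apply: (nv e); rewrite scale_v0 w0.
have q0 : dot w^T w != 0 by rewrite dot_trmx_eq0.
pose alpha : 'rV[R]_m := - ((dot w^T w)^-1 *: (A *m w + e *: w))^T.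
have Aw : dot w^T (A *m w) = 0.
  rewrite dot_mulmx; have := @dot_skew R m A w^T As; rewrite trmxK //.
have aw : dot alpha w = - e.
  rewrite /alpha dotNl trmxZ dotZl trmxD dotDl trmxZ dotZl.
  have -> : dot (A *m w)^T w = 0 by rewrite -dotC trmxK.
  by rewrite add0r mulrCA mulVf // mulr1.
have Oa := O_expN alpha; have au := O_unit Oa.
have /(g_conj Oa) : mk_g A b c e \in g_ R m by apply/gP3; exists A, b, c, e.
set X' := _ *m _ *m _ => /gP3[A' [b' [c' [e' [A's X'E]]]]].
have X'v : X' *m v0 = expN alpha *m (mk_g A b c e *m v0).
  by rewrite /X' -!mulmxA -[X in invmx _ *m X](expN_v0 alpha) mulKmx.
have X'p : X' *m expN alpha = expN alpha *m mk_g A b c e.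
  by rewrite /X' -!mulmxA mulVmx // mulmx1.
move: X'v; rewrite X'E !mk_g_v0 expNE /= mul_mx3_col3 => /col3_inj[bc ee _].
move: X'p; rewrite X'E expNE /= !mul_mx3 => /mx3_inj[[AA _ _] _ _].
have {}bc : b' + c' = w.
  by rewrite bc -wE mul1mx scalerN addrNK.
have e'0 : e' = 0 by rewrite ee -wE aw; ring.
have {}AA : A' = A + alpha^T *m w^T - w *m alpha.
  move: AA; rewrite mulmx1 mul1mx -addrA -mulmxDl bc => /(canRL (addrK _)) ->.
  by rewrite mulNmx mulmxN opprK wE trmxD [alpha^T *m (_ + _)]mulmxDr !addrA.
have Aw0 : A' *m w = 0.
  rewrite AA mulmxBl mulmxDl -!mulmxA !dotE aw !mul_mx_scalar scaleNr opprK.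
  rewrite /alpha trmxN trmxK scalerN scalerA divff // scale1r.
  by rewrite opprD addrA addrN sub0r addNr.
exists alpha, A', (2^-1 *: w^T), (2^-1 *: (c' - b')^T); split => //.
- by rewrite scaler_eq0 invr_eq0 pnatr_eq0 trmx_eq0.
- by rewrite trmxZ trmxK -scalemxAr Aw0 scaler0.
rewrite -/X' X'E e'0 X_Yb0_add /mk_g -bc.
by congr (mx3 _ _ _ _ _ _ _ _ _); apply/matrixP => i j; rewrite !mxE; field.
Qed.

End Sign.

(** * Conjugacy of pairs (Y, beta) under SO(m) *)

Section Frame.
Variables (R : realType) (m n : nat) (x : nat -> R).
Hypothesis hm : (m = n.*2.+1)%N.
Hypothesis x_gt0 : forall i, (1 <= i <= n)%N -> 0 < x i.
Implicit Types (Y k : 'M[R]_m) (beta : 'rV[R]_m).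

Definition e_last : 'cV[R]_m := \col_j (nat_of_ord j == n.*2)%:R.

Let S : 'M[R]_m := skew_diag m n x.

Let leN : (n.*2 <= m)%N. Proof. by rewrite hm. Qed.

Lemma mul_skew_diag (w : 'cV[R]_m) (i : 'I_m) : (i./2 < n)%N ->
  (S *m w) i 0 = (-1) ^+ odd i * x i./2.+1 * w (mate i) 0.
Proof.
move=> lti; rewrite mxE (bigD1 (mate i)) //= big1 ?addr0.
  by rewrite /S skew_diagE // lti eqxx.
by move=> j /negbTE ji; rewrite /S skew_diagE // ji andbF mul0r.
Qed.

Lemma skew_diag_e_last : S *m e_last = 0.
Proof.
apply/colP => i; rewrite mxE [RHS]mxE big1 // => j _.
rewrite /S skew_diagE //; case: ifP; last by rewrite mul0r.
move=> /andP[lti /eqP->]; rewrite mxE; case: eqP => [e|]; last by rewrite mulr0.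
by have := half_mate i; have := odd_double_half (mate i); lia.
Qed.

(** The planes of [skew_diag] carry nonzero scalars, so the kernel is the
remaining coordinate line. *)
Lemma skew_diag_ker (w : 'cV[R]_m) : S *m w = 0 -> exists y, w = y *: e_last.
Proof.
move=> Sw; have lt : (n.*2 < m)%N by rewrite hm.
exists (w (Ordinal lt) 0); apply/colP => j; rewrite !mxE.
have [jn|jn] := eqVneq (nat_of_ord j) n.*2.
  by rewrite mulr1; congr (w _ _); apply: val_inj.
rewrite mulr0; have ltj : (j./2 < n)%N.
  by have := ltn_ord j; have := odd_double_half j; move/eqP: jn; lia.
have := mul_skew_diag w (i := mate j); rewrite half_mate ltj Sw mxE mateK => /(_ isT).
move/esym/eqP; rewrite !mulf_eq0 signr_eq0 /= gt_eqF /=; first by move/eqP.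
by apply: x_gt0; rewrite ltj.
Qed.

Lemma bordered_skew_diag : block_mx S e_last (- e_last^T) 0 =
  skew_diag (m + 1) n.+1 (fun i => if i == n.+1 then 1 else x i).
Proof.
have le1 : (n.+1.*2 <= m + 1)%N by rewrite hm doubleS addn1.
apply/matrixP => i j; rewrite [RHS]skew_diagE //.
case: (split_ordP i) => i' ->; case: (split_ordP j) => j' ->.
- rewrite block_mxEul /S skew_diagE // -!(inj_eq val_inj) /= !val_mate /=.
  have lti := ltn_ord i'; have ltj := ltn_ord j'; have hi := odd_double_half i'.
  have [h|h] := ltnP i'./2 n.
    rewrite ltnS (ltnW h) eqSS (ltn_eqF h) /=; congr (if _ == _ then _ else _).
    move: hi; case: (odd i') => //= hi.
    by case: ifP => h3; case: ifP => h4; lia.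
  rewrite [RHS]ifN //; apply/negP => /andP[_ /eqP].
  move: hi; case: (odd i') => /= hi; first lia.
  by case: ifP => h3; lia.
- rewrite block_mxEur mxE -!(inj_eq val_inj) /= !val_mate /=.
  have lti := ltn_ord i'; have hi := odd_double_half i'.
  have [iE|iE] := eqVneq (nat_of_ord i') n.*2.
    have oi : odd i' = false by rewrite iE odd_double.
    have h2 : i'./2 = n by rewrite iE doubleK.
    rewrite h2 ltnSn oi eqxx ifT; last first.
      by rewrite andTb; have := ltn_ord j'; case: ifP => h3 h4; apply/eqP; lia.
    by rewrite expr0 mulr1.
  rewrite ifN //; apply/negP => /andP[_ /eqP].
  by move: hi; case: (odd i') => /= hi; [|case: ifP => _]; move/eqP: iE; lia.
- rewrite block_mxEdl !mxE -!(inj_eq val_inj) /= !val_mate /= ord1 /= addn0.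
  have om : odd m by rewrite hm /= odd_double.
  have h2 : m./2 = n by rewrite hm /= uphalf_double.
  have m1 : m.-1 = n.*2 by rewrite hm.
  rewrite om h2 ltnSn eqxx m1 /= mulr1 expr1.
  by case: eqP => _; rewrite ?mulr0n ?oppr0.
- rewrite block_mxEdr [LHS]mxE -!(inj_eq val_inj) /= !val_mate /= !ord1 /= addn0.
  have om : odd m by rewrite hm /= odd_double.
  by rewrite ifN // om; apply/negP => /andP[_ /eqP]; lia.
Qed.

(** The normal form of [Y] sends [beta] to the kernel line, and a reflection
corrects the direction.  Bordering by [beta] then turns the normal form into a
[skew_diag] with positive entries, whose Pfaffian is positive; so the determinant
of the frame is the sign of the Pfaffian. *)
Lemma skew_frame Y beta : Y^T = - Y -> Y *m beta^T = 0 -> beta != 0 ->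
  char_poly (Y^T *m Y) = 'X * \prod_(1 <= i < n.+1) ('X - (x i ^+ 2)%:P) ^+ 2 ->
  exists k, [/\ k *m k^T = 1%:M, k *m Y *m k^T = S,
    k *m beta^T = norm2 beta *: e_last & \det k = Num.sg (Pf (Z_Yb Y beta))].
Proof.
move=> Ys Yb b0 chY; have nb := norm2_gt0 b0.
have [k0 [kk0 kY0]] : exists k, k *m k^T = 1%:M /\ k *m Y *m k^T = S.
  rewrite /S; move: Y Ys chY {Yb}; rewrite hm => Y Ys chY.
  exact: skew_normal_form.
have eO : bil 1%:M e_last e_last = 1.
  have lt : (n.*2 < m)%N by rewrite hm.
  rewrite bil1E /dot mxE (bigD1 (Ordinal lt)) //= big1 => [|j].
    by rewrite !mxE eqxx mulr1 addr0.
  by rewrite -(inj_eq val_inj) /= !mxE => /negbTE ->; rewrite mul0r.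
have ttr (k : 'M[R]_m) : k *m k^T = 1%:M -> k^T *m k = 1%:M by exact: mulmx1C.
have [k [kk kY kb]] : exists k, [/\ k *m k^T = 1%:M, k *m Y *m k^T = S &
    k *m beta^T = norm2 beta *: e_last].
  have [y ye] : exists y, k0 *m beta^T = y *: e_last.
    apply: skew_diag_ker; rewrite -kY0 -!mulmxA (mulmxA k0^T) ttr // mul1mx.
    by rewrite Yb mulmx0.
  have y2 : y ^+ 2 = norm2 beta ^+ 2.
    have <- : bil 1%:M beta^T beta^T = norm2 beta ^+ 2.
      by rewrite norm2_sqr bil1E trmxK.
    rewrite -(@bil_isom _ _ _ k0) ?mulmx1 ?ttr // ye bilZl bilZr ?trmx1 // eO; ring.
  move/eqP: y2; rewrite eqf_sqr => /orP[]/eqP yE; first by exists k0; rewrite -yE.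
  have dn : bil 1%:M e_last e_last != 0 by rewrite eO oner_eq0.
  have fS : refl 1%:M e_last *m S *m (refl 1%:M e_last)^T = S.
    have tS : S^T = - S by rewrite -kY0 !trmx_mul trmxK Ys mulNmx mulmxN mulmxA.
    have fS : refl 1%:M e_last *m S = S.
      rewrite mulmxBl mul1mx mulmx1 -scalemxAl -mulmxA.
      have -> : e_last^T *m S = 0.
        by rewrite -[S]trmxK -trmx_mul tS mulNmx skew_diag_e_last oppr0 trmx0.
      by rewrite mulmx0 scaler0 subr0.
    by rewrite fS -[S]trmxK -trmx_mul tS mulmxN fS.
  exists (refl 1%:M e_last *m k0); split.
  - rewrite trmx_mul mulmxA -(mulmxA _ k0) kk0 mulmx1.
    by have := refl_isom_tr (trmx1 _ _) (mulmx1 _) dn; rewrite mulmx1.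
  - rewrite trmx_mul -[RHS]fS -kY0 !mulmxA //.
  - rewrite -mulmxA ye -scalemxAr refl_apply eO yE divr1 mulr1.
    by rewrite -[X in X - _]scale1r -scalerBl scalerA; congr (_ *: _); ring.
exists k; split=> //.
pose D : 'M[R]_(m + 1) := block_mx k 0 0 1%:M.
have DZ : D *m Z_Yb Y beta *m D^T = block_mx S e_last (- e_last^T) 0.
  rewrite /D /Z_Yb tr_block_mx !mulmx_block !trmx0 trmx1.
  rewrite !(mulmx0, mul0mx, addr0, add0r, mulmx1, mul1mx) kY -scalemxAr kb.
  rewrite scalerA mulVf ?gt_eqF // scale1r; congr (block_mx _ _ _ _).
  rewrite mulNmx -scalemxAl -[beta *m _]trmxK trmx_mul trmxK kb trmxZ scalerA.
  by rewrite mulVf ?gt_eqF // scale1r.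
have ev : ~~ odd (m + 1) by rewrite hm addn1 /= negbK odd_double.
have hm1 : (m + 1 = n.+1.*2)%N by rewrite hm addn1 doubleS.
have [c c0 PfE] := Pf_skew_diag_eq (fun i => if i == n.+1 then 1 else x i) hm1.
have : 0 < \det k * Pf (Z_Yb Y beta).
  have -> : \det k = \det D by rewrite /D det_lblock det1 mulr1.
  rewrite -Pf_congr // DZ bordered_skew_diag PfE pmulr_lgt0 //.
  rewrite big_nat; apply: prodr_gt0 => i /andP[i1 lin].
  by case: eqP => // /eqP ne; apply: x_gt0; rewrite i1 -ltnS ltn_neqAle ne.
have : \det k ^+ 2 = 1 by rewrite expr2 -{2}det_tr -det_mulmx kk det1.
move=> /eqP; rewrite sqrf_eq1 => /orP[]/eqP ->; rewrite ?mul1r ?mulN1r ?oppr_gt0 => h.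
  by rewrite gtr0_sg.
by rewrite ltr0_sg.
Qed.

(** Both pairs have the same normal form, in frames with the same determinant. *)
Lemma skew_conj Y beta Y1 beta1 : Y^T = - Y -> Y *m beta^T = 0 -> beta != 0 ->
  Y1^T = - Y1 -> Y1 *m beta1^T = 0 -> beta1 != 0 ->
  char_poly (Y^T *m Y) = 'X * \prod_(1 <= i < n.+1) ('X - (x i ^+ 2)%:P) ^+ 2 ->
  char_poly (Y1^T *m Y1) = 'X * \prod_(1 <= i < n.+1) ('X - (x i ^+ 2)%:P) ^+ 2 ->
  dot beta beta^T = dot beta1 beta1^T ->
  Num.sg (Pf (Z_Yb Y beta)) = Num.sg (Pf (Z_Yb Y1 beta1)) ->
  exists k, [/\ SO R m k, k *m Y1 *m k^T = Y & k *m beta1^T = beta^T].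
Proof.
move=> Ys Yb b0 Ys1 Yb1 b10 chY chY1 bb sgE.
have [k [kk kY kb dk]] := skew_frame Ys Yb b0 chY.
have [k1 [kk1 kY1 kb1 dk1]] := skew_frame Ys1 Yb1 b10 chY1.
have kt := mulmx1C kk.
have nE : norm2 beta = norm2 beta1 by rewrite /norm2 -!/(dot _ _) bb.
exists (k^T *m k1); split.
- split.
    by rewrite trmx_mul trmxK mulmxA -(mulmxA _ k1) kk1 mulmx1.
  rewrite det_mulmx det_tr dk1 -sgE -dk -expr2 expr2 -{2}det_tr -det_mulmx kk.
  by rewrite det1.
- rewrite trmx_mul trmxK.
  have -> : k^T *m k1 *m Y1 *m (k1^T *m k) = k^T *m (k1 *m Y1 *m k1^T) *m k.
    by rewrite !mulmxA.
  by rewrite kY1 -kY !mulmxA kt mul1mx -mulmxA kt mulmx1.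
- by rewrite -mulmxA kb1 -nE -kb mulmxA kt mul1mx.
Qed.

End Frame.

(** * Transitivity of the torus on vectors of given weights *)

Section PairMatrices.
Variables (R : realType) (N : nat).
Hypothesis evenN : ~~ odd N.
Implicit Types (c s : 'I_N -> R) (i j : 'I_N).

(** The matrices preserving each of the planes spanned by two mated basis
vectors. *)
Definition pair_mx c s : 'M[R]_N :=
  \matrix_(i, j) (if j == i then c i else if j == mate i then s i else 0).

Lemma mate_neq_even i : mate i != i.
Proof.
apply: mate_neq; have := ltn_ord i; have := odd_double_half N.
by rewrite (negbTE evenN) add0n => ->.
Qed.

Lemma pair_mulmx c s p (A : 'M[R]_(N, p)) i (j : 'I_p) :
  (pair_mx c s *m A) i j = c i * A i j + s i * A (mate i) j.
Proof.
rewrite mxE (bigD1 i) //= (bigD1 (mate i)) ?mate_neq_even //= big1 ?addr0.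
  by rewrite !mxE !eqxx (negbTE (mate_neq_even i)).
by move=> k /andP[/negbTE ki /negbTE kmi]; rewrite mxE ki kmi mul0r.
Qed.

Lemma tr_pair_mx c s : (pair_mx c s)^T = pair_mx c (fun i => s (mate i)).
Proof.
apply/matrixP => i j; rewrite !mxE eq_sym; case: eqVneq => [->//|_].
by rewrite -(inj_eq (can_inj (@mateK N)) i) mateK eq_sym; case: eqP => // <-.
Qed.

Lemma mul_pair_mx c s c' s' : pair_mx c s *m pair_mx c' s' =
  pair_mx (fun i => c i * c' i + s i * s' (mate i))
          (fun i => c i * s' i + s i * c' (mate i)).
Proof.
apply/matrixP => i j; rewrite pair_mulmx !mxE mateK.
have [->|_] := eqVneq j i; last by case: eqP => _; ring.
by rewrite eq_sym (negbTE (mate_neq_even i)).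
Qed.

Lemma pair_mx_eq c s c' s' : c =1 c' -> s =1 s' -> pair_mx c s = pair_mx c' s'.
Proof. by move=> cc ss; apply/matrixP => i j; rewrite !mxE cc ss. Qed.

Lemma pair_mx1 : pair_mx (fun=> 1) (fun=> 0) = 1%:M.
Proof.
by apply/matrixP => i j; rewrite !mxE eq_sym; case: eqP => // _; case: eqP.
Qed.

End PairMatrices.

Section TorusTransitivity.
Variables (R : realType) (m n : nat) (a : nat -> R).
Hypothesis hm : (m + 1 = n.*2)%N.
Hypothesis a_neq0 : \prod_(1 <= i < n.+1) a i != 0.
Local Notation t0 := (torus_blk m n a).
Implicit Types (u v : 'cV[R]_(m + 1)).

Lemma weightE u (i : 'I_(m + 1)) :
  weight u i./2 = u i 0 ^+ 2 + u (mate i) 0 ^+ 2.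
Proof.
rewrite /weight (bigD1 i) //= (bigD1 (mate i)) /=; last first.
  by rewrite half_mate eqxx mate_neq_even // (even_m1 hm).
rewrite big1 ?addr0 // => j /andP[/andP[]]; rewrite half_eq_mate.
by move=> /orP[]/eqP ->; rewrite eqxx.
Qed.

(** Two vectors with the same weight in each plane differ by plane rotations;
these centralize the torus element, whose Pfaffian then forces their
determinant to be 1. *)
Lemma torus_transitive u v : (forall i, (i < n)%N -> weight u i = weight v i) ->
  exists k : 'M[R]_(m + 1), [/\ k *m k^T = 1%:M, \det k = 1,
    k *m t0 *m k^T = t0 & k *m u = v].
Proof.
move=> uv; have ev := even_m1 hm.
pose e (i : 'I_(m + 1)) : R := (-1) ^+ odd i.
have em i : e (mate i) = - e i.
  by rewrite /e odd_mate //; case: (odd i) => /=; ring.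
pose r (i : 'I_(m + 1)) := u i 0 ^+ 2 + u (mate i) 0 ^+ 2.
have rv i : r i = v i 0 ^+ 2 + v (mate i) 0 ^+ 2.
  by rewrite /r -!weightE uv // (half_lt hm).
have rm i : r (mate i) = r i by rewrite /r mateK addrC.
pose c i := if r i == 0 then 1 else (u i 0 * v i 0 + u (mate i) 0 * v (mate i) 0) / r i.
pose s i := if r i == 0 then 0 else (u (mate i) 0 * v i 0 - u i 0 * v (mate i) 0) / r i.
have cm i : c (mate i) = c i by rewrite /c rm mateK addrC.
have sm i : s (mate i) = - s i.
  by rewrite /s rm mateK; case: ifP => _; rewrite ?oppr0 //; ring.
have cs i : c i * c i + s i * s i = 1.
  rewrite /c /s; case: ifPn => [_|r0]; first by ring.
  have := rv i; rewrite /r in r0 * => rvi.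
  have -> : forall p q w : R, p / w * (p / w) + q / w * (q / w) = (p ^+ 2 + q ^+ 2) / (w * w).
    by move=> p q w; rewrite invfM; ring.
  rewrite [X in X / _](_ : _ = (u i 0 ^+ 2 + u (mate i) 0 ^+ 2) * (v i 0 ^+ 2 + v (mate i) 0 ^+ 2)); last by ring.
  by rewrite -rvi divff // mulf_neq0.
pose k := pair_mx c s.
have kk : k *m k^T = 1%:M.
  rewrite /k tr_pair_mx // mul_pair_mx // -pair_mx1; apply: pair_mx_eq => i.
    by rewrite mateK cs.
  by rewrite sm cm; ring.
have torus_blk_pair : t0 = pair_mx (fun=> 0) (fun i => e i * a i./2.+1).
  apply/matrixP => i j; rewrite torus_blkE // mxE.
  have [->|_] := eqVneq j i; last by case: eqP.
  by rewrite eq_sym (negbTE (mate_neq_even ev i)).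
have kt : k *m t0 = t0 *m k.
  rewrite torus_blk_pair !mul_pair_mx //; apply: pair_mx_eq => i.
    by rewrite em sm half_mate; ring.
  by rewrite cm; ring.
have kt0 : k *m t0 *m k^T = t0 by rewrite kt -mulmxA kk mulmx1.
exists k; split=> //.
  have := Pf_congr ev t0 k; rewrite kt0.
  have [p p0 ->] := Pf_skew_diag_eq a hm.
  rewrite -[LHS]mul1r => /(mulIf _) -> //.
  by rewrite mulf_neq0 // gt_eqF.
apply/colP => i; rewrite pair_mulmx // /c /s; case: ifPn => [|r0].
  have := rv i => rvi; rewrite /r in rvi *.
  rewrite paddr_eq0 ?sqr_ge0 // !sqrf_eq0 => /andP[/eqP ui /eqP umi].
  move/esym/eqP: rvi; rewrite ui umi expr0n addr0 paddr_eq0 ?sqr_ge0 // sqrf_eq0.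
  by move=> /andP[/eqP -> _]; ring.
by rewrite /r in r0 *; field.
Qed.

End TorusTransitivity.

(** * Interlacing and the secular polynomial *)

Section Interlacing.
Variables (R : realType) (n : nat) (a : nat -> R).
Hypothesis ha : forall i, (1 <= i)%N -> (i.+1 < n)%N -> a i.+1 < a i.
Hypothesis ha_n : `|a n| < a n.-1.
Hypothesis ha_0 : 0 < `|a n|.
Hypothesis hn : (2 <= n)%N.
Local Notation bsq := (bsq a).
Local Notation secp := (secular n a).

Lemma a_decr i j : (1 <= i < j)%N -> (j < n)%N -> a j < a i.
Proof.
move=> /andP[i1]; elim: j => // j IH; rewrite ltnS leq_eqVlt => /orP[/eqP<-|ij] jn.
  exact: ha.
apply: lt_trans (IH ij (ltnW jn)); apply: ha => //.
exact: leq_trans i1 (ltnW ij).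
Qed.

Lemma a_gt_abs i : (1 <= i < n)%N -> `|a n| < a i.
Proof.
move=> /andP[i1 lin].
have [->//|ne] := eqVneq i n.-1.
by apply: (lt_trans ha_n); apply: a_decr; lia.
Qed.

Lemma a_gt0 i : (1 <= i < n)%N -> 0 < a i.
Proof. by move=> /a_gt_abs; apply: le_lt_trans. Qed.

Lemma a_neq0 i : (1 <= i <= n)%N -> a i != 0.
Proof.
move=> /andP[i1]; rewrite leq_eqVlt => /orP[/eqP->|lin].
  by rewrite -normr_gt0.
by rewrite gt_eqF // a_gt0 // i1.
Qed.

Lemma bsq_gt0 i : (i < n)%N -> 0 < bsq i.
Proof. by move=> lin; rewrite exprn_even_gt0 //= a_neq0. Qed.

Lemma bsq_decr i j : (i < j < n)%N -> bsq j < bsq i.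
Proof.
move=> /andP[ij jn]; have ai : 0 < a i.+1 by apply: a_gt0; lia.
rewrite /bsq -[ltLHS]real_normK ?num_real // ltr_pXn2r ?nnegrE //.
  have [e|ne] := eqVneq j.+1 n; first by rewrite e a_gt_abs //; lia.
  by rewrite gtr0_norm ?a_decr ?a_gt0 //; lia.
exact: ltW.
Qed.

Lemma horner_secular_bsq s i : (i < n)%N ->
  (secp s).[bsq i] = s i * \prod_(k < n | k != i :> nat) (bsq i - bsq k).
Proof.
move=> lin; rewrite /secular horner_sum (bigD1 (Ordinal lin)) //= [X in _ + X]big1.
  rewrite addr0 hornerZ horner_prod; congr (_ * _).
  by apply: eq_bigr => k _; rewrite hornerXsubC.
move=> j ji; rewrite hornerZ horner_prod (bigD1 (Ordinal lin)) /=; last by rewrite eq_sym.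
by rewrite hornerXsubC subrr mul0r mulr0.
Qed.

Lemma alternating_gap i : (i < n)%N ->
  0 < (-1) ^+ i * \prod_(k < n | k != i :> nat) (bsq i - bsq k).
Proof.
move=> lin; rewrite lt0r mulf_neq0 ?signr_eq0 //=; last first.
  apply/prodf_neq0 => k ki; rewrite subr_eq0.
  have [h|h|/eqP] := ltngtP k i; last by rewrite (negbTE ki).
    by rewrite lt_eqF // bsq_decr // h.
  by rewrite gt_eqF // bsq_decr // h ltn_ord.
have -> : \prod_(k < n | k != i :> nat) (bsq i - bsq k) =
    \prod_(0 <= k < n) (if k == i then 1 else bsq i - bsq k).
  rewrite big_mkord [in RHS](bigID (fun k : 'I_n => k != i :> nat)) /=.
  rewrite [X in _ * X]big1 ?mulr1; last by move=> k /negPn ->.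
  by apply: eq_bigr => k /negbTE ->.
apply: alternating_prod; first exact: ltnW.
  by move=> k ki; rewrite ltn_eqF // subr_le0 ltW // bsq_decr // ki.
move=> k /andP[ik kn]; case: eqVneq => // ne.
by rewrite subr_ge0 ltW // bsq_decr // kn ltn_neqAle eq_sym ne ik.
Qed.

Lemma size_secular s : (size (secp s) <= n)%N.
Proof.
apply: (leq_trans (size_sum _ _ _)); apply/bigmax_leqP => i _.
apply: (leq_trans (size_scale_leq _ _)).
have -> : \prod_(k < n | k != i) ('X - (bsq k)%:P) =
    \prod_(k <- enum (predC1 i)) ('X - (bsq k)%:P) by rewrite big_enum.
rewrite size_prod_XsubC -cardE cardC1 card_ord.
by have := ltn_ord i; lia.
Qed.

(** The values at the points [bsq i] alternate in sign. *)
Lemma secular_roots s : (forall i, (i < n)%N -> 0 <= s i) ->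
  exists c (y : nat -> R),
    (forall j, (j < n.-1)%N -> bsq j.+1 <= y j <= bsq j) /\
    secp s = c *: \prod_(0 <= j < n.-1) ('X - (y j)%:P).
Proof.
move=> s0; have nE : n = n.-1.+1 by lia.
apply: interlacing_roots.
- by move=> i j ij; apply: bsq_decr; lia.
- by rewrite -nE size_secular.
- move=> i lin; have {}lin : (i < n)%N by lia.
  by rewrite horner_secular_bsq // mulrCA mulr_ge0 ?s0 // ltW // alternating_gap.
Qed.

(** Lagrange interpolation at the points [bsq i]; the interlacing makes the
signs of the values alternate like those of the denominators. *)
Lemma secular_of_roots c (y : nat -> R) : 0 <= c ->
  (forall j, (j < n.-1)%N -> bsq j.+1 <= y j <= bsq j) ->
  exists2 s : nat -> R, forall i, (i < n)%N -> 0 <= s i &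
    secp s = c *: \prod_(0 <= j < n.-1) ('X - (y j)%:P).
Proof.
move=> c0 yI; set Q := c *: _.
pose gap i := \prod_(k < n | k != i :> nat) (bsq i - bsq k).
have gap0 i : (i < n)%N -> gap i != 0.
  by move=> /alternating_gap; rewrite -/(gap i); apply: contraTneq => ->; rewrite mulr0 ltxx.
have bmono i j : (i <= j < n)%N -> bsq j <= bsq i.
  move=> /andP[]; rewrite leq_eqVlt => /orP[/eqP->//|ij jn].
  by rewrite ltW // bsq_decr // ij.
exists (fun i => Q.[bsq i] / gap i).
  move=> i lin; have h : 0 <= (-1) ^+ i * Q.[bsq i].
    rewrite hornerZ horner_prod mulrCA mulr_ge0 //.
    apply: alternating_prod; first by lia.
      move=> j ji; rewrite hornerXsubC subr_le0.
      have jn1 : (j < n.-1)%N by lia.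
      have /andP[h _] := yI j jn1.
      by apply: le_trans h; apply: bmono; lia.
    move=> j /andP[ij jn]; rewrite hornerXsubC subr_ge0.
    have /andP[_ h] := yI j jn.
    by apply: (le_trans h); apply: bmono; lia.
  have -> : Q.[bsq i] / gap i = ((-1) ^+ i * Q.[bsq i]) / ((-1) ^+ i * gap i).
    by rewrite -mulf_div divff ?mul1r // signr_eq0.
  by rewrite divr_ge0 // ltW // alternating_gap.
apply: (poly_eq_on_pts (n := n) (b := bsq)).
- exact: bsq_decr.
- exact: size_secular.
- apply: (leq_trans (size_scale_leq _ _)).
  by rewrite size_prod_XsubC size_iota subn0; lia.
- by move=> i lin; rewrite horner_secular_bsq // divfK // gap0.
Qed.

End Interlacing.

(** * The type of a point of the image *)

Section SingularValues.
Variables (R : realType) (m : nat).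

Lemma prod_sing (n : nat) (x : nat -> R) :
  \prod_(z <- flatten [seq [:: x i; x i] | i <- iota 1 n] ++ [:: 0]) ('X - (z ^+ 2)%:P)
  = 'X * \prod_(1 <= i < n.+1) ('X - (x i ^+ 2)%:P) ^+ 2.
Proof.
rewrite big_cat big_seq1 expr0n /= subr0 mulrC; congr (_ * _).
rewrite big_flatten big_map /index_iota subSS subn0; apply: eq_bigr => i _.
by rewrite big_cons big_seq1 expr2.
Qed.

(** At [z = - x ^ 2] the matrix [z - Y^T Y] is [- (x - Y) (x - Y)^T], and the
size is odd. *)
Lemma char_poly_gram (k : nat) (Y : 'M[R]_m) (y : nat -> R) : odd m -> Y^T = - Y ->
  char_poly Y = 'X * \prod_(0 <= j < k) ('X^2 + (y j)%:P) ->
  char_poly (Y^T *m Y) = 'X * \prod_(0 <= j < k) ('X - (y j)%:P) ^+ 2.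
Proof.
move=> om Ys chY; apply: poly_eq_on_neg => z z0; rewrite horner_char_poly.
have [x zE] : exists x, z = - x ^+ 2.
  by exists (Num.sqrt (- z)); rewrite sqr_sqrtr ?opprK // oppr_ge0 ltW.
have -> : z%:M - Y^T *m Y = - ((x%:M - Y) *m (x%:M - Y)^T).
  rewrite trmxD trmxN tr_scalar_mx Ys opprK mulmxDr !mulmxBl mulNmx opprK.
  rewrite -scalar_mxM mul_mx_scalar mul_scalar_mx addrA subrK zE expr2.
  by rewrite opprB raddfN addrC.
rewrite -scaleN1r detZ det_mulmx det_tr -horner_char_poly chY -signr_odd om.
rewrite !hornerM !hornerX !horner_prod expr1 zE mulN1r mulrACA mulNr -expr2.
congr (- (_ * _)); rewrite -big_split /=; apply: eq_bigr => j _.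
by rewrite horner_exp !hornerE; ring.
Qed.

End SingularValues.

Section Main.
Variables (R : realType) (m n : nat) (a : nat -> R).
Hypothesis hm : (m + 1 = n.*2)%N.
Hypothesis hn : (2 <= n)%N.
Hypothesis ha : forall i, (1 <= i)%N -> (i.+1 < n)%N -> a i.+1 < a i.
Hypothesis ha_n : `|a n| < a n.-1.
Hypothesis ha_0 : 0 < `|a n|.
Local Notation M := (m + 1 + 1)%N.
Local Notation I := (I_m1 R m).
Local Notation lor := (bil I).
Local Notation v0 := (v0 R m).
Local Notation t := (torus_mx m n a).
Local Notation bsqa := (bsq a).
Implicit Types (Y : 'M[R]_m) (alpha beta gamma : 'rV[R]_m) (X g p : 'M[R]_M).

Let odd_m : odd m. Proof. lia. Qed.
Let nE : n = n.-1.+1. Proof. lia. Qed.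

Definition conj_torus g : 'M[R]_M := g *m t *m invmx g.

Lemma conj_torus_mul p g : p \in unitmx -> g \in unitmx ->
  conj_torus (p *m g) = p *m conj_torus g *m invmx p.
Proof. by move=> pu gu; rewrite /conj_torus invmx_mul // !mulmxA. Qed.

Lemma conj_torus_in_g g : O_m1 R m g -> conj_torus g \in g_ R m.
Proof. by move=> Og; apply: g_conj => //; exact: torus_in_g. Qed.

(** The isotropic vector [v0] in the frame of the torus: its timelike coordinate
is positive. *)
Lemma null_coords g : SOe R m g -> exists u s,
  [/\ invmx g *m v0 = col_mx u s%:M, 0 < s & s ^+ 2 = \sum_j u j 0 ^+ 2].
Proof.
move=> /SOeP[Og _ tg]; have [b [e [f zE]]] := col3P (invmx g *m v0).
have etE : e_time R m = col_mx 0 1%:M.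
  by rewrite /e_time /col3 raddf0 col_mx0.
exists (col_mx b e%:M), f; split=> //.
  move: tg; rewrite timec_gt0 // -(O_bil _ _ (O_invmx Og)) mulKmx ?O_unit //.
  by rewrite zE etE lor_col_mx trmx0 dot0l mul1r sub0r oppr_lt0.
have vv : lor v0 v0 = 0.
  transitivity (lor (col3 0 1 1) (col3 0 1 1)); first by [].
  by rewrite bil_col3 trmx0 !mx3E subrr.
have := O_bil v0 v0 (O_invmx Og); rewrite vv zE lor_col_mx => /eqP.
rewrite subr_eq0 -expr2 => /eqP <-.
have := dotxx (col_mx b e%:M)^T; rewrite trmxK => ->.
by apply: eq_bigr => j _; rewrite [_^T _ _]mxE.
Qed.

(** Stabilizing the line of [v0] would make the isotropic vector [z] an
eigenvector of [t]; but [t] is injective on the spacelike coordinates and kills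
the time axis, which is not isotropic. *)
Lemma orbit_normal_form g : SOe R m g -> exists alpha Y beta gamma,
  [/\ Y^T = - Y, beta != 0, Y *m beta^T = 0 &
    conj_torus (expN alpha *m g) = X_Yb0 Y beta + X_ gamma].
Proof.
move=> Sg; have Og := SOe_O Sg; have gu := O_unit Og.
have [u [s [zE s0 s2]]] := null_coords Sg.
have [e Xe|alpha [Y [beta [gamma [Ys b0 Yb E]]]]] := @normal_form R m (conj_torus g) (conj_torus_in_g Og).
  have {Xe} : t *m col_mx u s%:M = e *: col_mx u s%:M.
    rewrite -zE -[LHS](mulKmx gu) (mulmxA g) (mulmxA (g *m t)) -/(conj_torus g) Xe.
    by rewrite scalemxAr.
  rewrite torus_mx_block // mul_block_col !mul0mx !addr0 scale_col_mx => /eq_col_mx[tu /esym].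
  rewrite scale_scalar_mx => es.
  have e0 : e = 0.
    have := congr1 (fun A : 'M[R]_1 => A 0 0) es; rewrite !mxE eqxx mulr1n => /eqP.
    by rewrite mulf_eq0 (gt_eqF s0) orbF => /eqP.
  have ttu : diag_mx (\row_j - dsq a j) *m u = 0.
    by rewrite -(torus_blk_sqr a hm) -mulmxA tu e0 scale0r mulmx0.
  suff u0 : u = 0.
    by move: s2; rewrite u0 big1 => [/eqP|j _]; rewrite ?mxE ?expr0n // sqrf_eq0 gt_eqF.
  apply/colP => j; have /colP/(_ j) := ttu; rewrite mul_diag_mx !mxE => /eqP.
  rewrite mulf_eq0 oppr_eq0 gt_eqF /= => [/eqP //|].
  by apply: (bsq_gt0 ha ha_n ha_0 hn); exact: (half_lt hm).
exists alpha, Y, beta, gamma; split => //.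
by rewrite conj_torus_mul // O_unit //; exact: O_expN.
Qed.

(** The leading coefficients in the secular identity give the length of [beta]. *)
Lemma secular_char_poly g Y beta gamma u s c (y : nat -> R) : O_m1 R m g ->
  Y *m beta^T = 0 -> conj_torus g = X_Yb0 Y beta + X_ gamma ->
  invmx g *m v0 = col_mx u s%:M ->
  secular n a (fun i => weight u i * bsqa i) =
    c *: \prod_(0 <= j < n.-1) ('X - (y j)%:P) ->
  c = 4 * dot beta beta^T /\
  (beta != 0 -> char_poly Y = 'X * \prod_(0 <= j < n.-1) ('X^2 + (y j)%:P)).
Proof.
move=> Og Yb gE zE QE; set q := 4 * _.
set p := 'X * _.
have pm : p \is monic.
  rewrite monicMl ?monicX // monic_prod // => i _.
  by rewrite monicE lead_coefDl ?lead_coefXn // size_polyC size_polyXn; case: eqP.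
have pE : q *: char_poly Y = c *: p.
  apply: poly_eq_on_neg => x x0; rewrite !hornerZ horner_char_poly.
  rewrite (secular_identity hm Og Yb gE zE) ?lt_eqF //.
  have := horner_secular n a (fun i => weight u i * bsqa i) (x ^+ 2).
  rewrite QE hornerZ horner_prod => /(congr1 ( *%R ((-1) ^+ n.-1))).
  rewrite [RHS]mulrA -expr2 sqrr_sign mul1r => <-.
  rewrite /p hornerM hornerX horner_prod [RHS]mulrCA; congr (_ * _).
  rewrite mulrCA; congr (_ * _).
  under eq_bigr do rewrite hornerXsubC -opprD.
  rewrite big_mkord prodrN card_ord mulrA -expr2 sqrr_sign mul1r big_mkord.
  by apply: eq_bigr => j _; rewrite !hornerE.
have qc : c = q.
  have := congr1 lead_coef pE; rewrite !lead_coefZ (monicP pm).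
  by rewrite (monicP (char_poly_monic Y)) !mulr1.
split=> // b0; apply: (@scalerI _ _ q) => //; last by rewrite pE qc.
by rewrite mulf_neq0 ?dotxx_eq0 // pnatr_eq0.
Qed.

Lemma prod_a_sg : Num.sg (\prod_(1 <= i < n.+1) a i) = Num.sg (a n).
Proof.
rewrite nE big_nat_recr //= sgrM gtr0_sg ?mul1r -?nE //.
rewrite big_nat; apply: prodr_gt0 => i /andP[i1 lin].
by apply: (a_gt0 ha ha_n ha_0 hn); lia.
Qed.

Lemma expN_SOe alpha : SOe R m (expN alpha).
Proof.
apply: MAN_SOe; apply/MANP; split; [exact: O_expN|exact: det_expN|].
by exists 1; rewrite // expN_v0 scale1r.
Qed.

Lemma expN_MAN alpha : MAN R m (expN alpha).
Proof.
apply/MANP; split; [exact: O_expN|exact: det_expN|].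
by exists 1; rewrite // expN_v0 scale1r.
Qed.

Lemma expN_coords alpha g : g \in unitmx ->
  invmx (expN alpha *m g) *m v0 = invmx g *m v0.
Proof.
move=> gu; have au := O_unit (O_expN alpha).
by rewrite invmx_mul // -mulmxA -[X in invmx (expN _) *m X](expN_v0 alpha) mulKmx.
Qed.

(** The singular values are read off from the roots of the secular polynomial,
and the sign from [sg_Pf_Z]. *)
Lemma image_type g : SOe R m g -> exists alpha Y beta gamma (x : nat -> R),
  [/\ [/\ Y^T = - Y, beta != 0 & Y *m beta^T = 0],
      conj_torus (expN alpha *m g) = X_Yb0 Y beta + X_ gamma,
      (forall i, (1 <= i)%N -> (i.+1 < n)%N -> x i.+1 <= x i) /\
      singular_values Y (flatten [seq [:: x i; x i] | i <- iota 1 n.-1] ++ [:: 0]),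
      Num.sg (Pf (Z_Yb Y beta)) = Num.sg (a n) &
      [/\ forall i, (1 <= i)%N -> (i < n)%N -> x i <= a i,
          forall i, (1 <= i)%N -> (i.+1 < n)%N -> a i.+1 <= x i &
          `|a n| <= x n.-1]].
Proof.
move=> Sg; have [alpha [Y [beta [gamma [Ys b0 Yb E]]]]] := orbit_normal_form Sg.
have gu := O_unit (SOe_O Sg).
have Sg' := SOe_mul (expN_SOe alpha) Sg; have /SOeP[Og' dg' tg'] := Sg'.
have [u [s [zE _ _]]] := null_coords Sg'.
have w0 i : (i < n)%N -> 0 <= weight u i * bsqa i.
  by move=> lin; rewrite mulr_ge0 ?weight_ge0 // sqr_ge0.
have [c [y [yI QE]]] := secular_roots ha ha_n ha_0 hn w0.
have [_ /(_ b0) chY] := secular_char_poly Og' Yb E zE QE.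
have bge0 j : 0 <= bsqa j by rewrite sqr_ge0.
have y0 j : (j < n.-1)%N -> 0 <= y j by move=> /yI/andP[h _]; apply: le_trans h.
pose x i := Num.sqrt (y i.-1).
have sb j : (j < n.-1)%N -> Num.sqrt (bsqa j) = a j.+1.
  by move=> jn; rewrite /bsq sqrtr_sqr gtr0_norm // (a_gt0 ha ha_n ha_0 hn); lia.
exists alpha, Y, beta, gamma, x; split=> //.
- split=> [i i1 lin|].
    apply: ler_wsqrtr; have /andP[_ h1] := yI i.+1.-1 ltac:(lia).
    have /andP[h2 _] := yI i.-1 ltac:(lia).
    by apply: (le_trans h1); rewrite prednK in h2.
  split.
    apply/allP => z; rewrite mem_cat => /orP[|]; last by rewrite inE => /eqP ->.
    move=> /flattenP[l /mapP[i _ ->]]; rewrite !inE orbb => /eqP ->.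
    exact: sqrtr_ge0.
  rewrite prod_sing (char_poly_gram odd_m Ys chY) [in RHS]big_add1 /=.
  congr (_ * _); rewrite !big_mkord; apply: eq_bigr => i _.
  by rewrite /x /= sqr_sqrtr // y0.
- by rewrite (sg_Pf_Z hm Og' tg' b0 E) dg' mul1r prod_a_sg.
- split.
  + move=> i i1 lin; have jn : (i.-1 < n.-1)%N by lia.
    have := sb _ jn; rewrite prednK // => <-; apply: ler_wsqrtr.
    by case/andP: (yI _ jn).
  + move=> i i1 lin; have jn : (i < n.-1)%N by lia.
    rewrite -(sb _ jn); apply: ler_wsqrtr.
    have /andP[h _] := yI i.-1 ltac:(lia); by rewrite prednK in h.
  + have /andP[h _] := yI n.-2 ltac:(lia).
    rewrite -[leLHS]sqrtr_sqr.
    apply: ler_wsqrtr; apply: le_trans h; rewrite /bsq.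
    by have -> : n.-2.+2 = n by lia.
Qed.

End Main.

(** * Realization and separation of orbits *)
Section Main2.
Variables (R : realType) (m n : nat) (a : nat -> R).
Hypothesis hm : (m + 1 = n.*2)%N.
Hypothesis hn : (2 <= n)%N.
Hypothesis ha : forall i, (1 <= i)%N -> (i.+1 < n)%N -> a i.+1 < a i.
Hypothesis ha_n : `|a n| < a n.-1.
Hypothesis ha_0 : 0 < `|a n|.
Local Notation M := (m + 1 + 1)%N.
Local Notation I := (I_m1 R m).
Local Notation lor := (bil I).
Local Notation v0 := (v0 R m).
Local Notation t := (torus_mx m n a).
Local Notation bsqa := (bsq a).
Implicit Types (Y : 'M[R]_m) (beta : 'rV[R]_m) (g p : 'M[R]_M).

Let odd_m : odd m. Proof. lia. Qed.
Let nE : n = n.-1.+1. Proof. lia. Qed.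
Let mE : (m = n.-1.*2.+1)%N. Proof. lia. Qed.

Local Notation conj_torus := (@conj_torus R m n a).

(** Conversely, Lagrange interpolation gives the weights of an isotropic vector
in the frame of the torus; moving it to [v0] produces a point of the orbit whose
image has the prescribed invariants, hence is conjugate to the given one. *)
Lemma realize Y beta (x : nat -> R) : Y^T = - Y -> beta != 0 -> Y *m beta^T = 0 ->
  singular_values Y (flatten [seq [:: x i; x i] | i <- iota 1 n.-1] ++ [:: 0]) ->
  Num.sg (Pf (Z_Yb Y beta)) = Num.sg (a n) ->
  (forall i, (1 <= i)%N -> (i < n)%N -> x i <= a i) ->
  (forall i, (1 <= i)%N -> (i.+1 < n)%N -> a i.+1 <= x i) ->
  `|a n| <= x n.-1 ->
  exists g gamma, SOe R m g /\ conj_torus g = X_Yb0 Y beta + X_ gamma.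
Proof.
move=> Ys b0 Yb [_ chY] sgY xa ax anx.
rewrite prod_sing -nE in chY.
have x0 i : (1 <= i <= n.-1)%N -> 0 < x i.
  move=> /andP[i1 lin]; have [->|ne] := eqVneq i n.-1; first exact: lt_le_trans anx.
  apply: lt_le_trans (ax i i1 _); last by lia.
  by apply: (a_gt0 ha ha_n ha_0 hn); lia.
pose y j := x j.+1 ^+ 2.
have yI j : (j < n.-1)%N -> bsqa j.+1 <= y j <= bsqa j.
  move=> jn; have xj : 0 <= x j.+1 by apply: ltW; apply: x0; lia.
  rewrite /bsq /y; apply/andP; split; last first.
    rewrite ler_pXn2r ?nnegrE ?xa //; try lia.
    by apply: ltW; apply: (a_gt0 ha ha_n ha_0 hn); lia.
  have [e|ne] := eqVneq j.+2 n.
    rewrite e -[leLHS]real_normK ?num_real // ler_pXn2r ?nnegrE //.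
    by have -> : j.+1 = n.-1 by lia.
  have aj : 0 <= a j.+2 by apply: ltW; apply: (a_gt0 ha ha_n ha_0 hn); lia.
  by rewrite ler_pXn2r ?nnegrE // ax //; lia.
pose q := dot beta beta^T.
have q0 : 0 < q by rewrite lt0r dotxx_eq0 b0 dotxx_ge0.
have c0 : 0 <= 4 * q by rewrite mulr_ge0 // ltW.
have [s s0 sE] := secular_of_roots ha ha_n ha_0 hn c0 yI.
have b_gt0 i : (i < n)%N -> 0 < bsqa i by exact: (bsq_gt0 ha ha_n ha_0 hn).
pose r i := s i / bsqa i.
have r0 i : (i < n)%N -> 0 <= r i by move=> lin; rewrite divr_ge0 ?s0 // ltW // b_gt0.
(* With vanishing odd coordinates the pairing with v0 only sees the time
   coordinate; in particular z is not parallel to v0. *)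
pose u : 'cV[R]_(m + 1) := \col_j (if odd j then 0 else Num.sqrt (r j./2)).
have wE i : (i < n)%N -> weight u i = r i.
  move=> lin; have lt : (i.*2 < m + 1)%N by lia.
  have -> : i = (Ordinal lt : 'I_(m + 1))./2 by rewrite /= doubleK.
  rewrite (weightE hm) !mxE odd_mate ?(even_m1 hm) //= odd_double /= doubleK.
  by rewrite expr0n addr0 sqr_sqrtr // r0.
have QE : secular n a (fun i => weight u i * bsqa i) =
    (4 * q) *: \prod_(0 <= j < n.-1) ('X - (y j)%:P).
  rewrite -sE; apply: eq_bigr => i _; congr (_ *: _).
  by rewrite wE // /r divfK // gt_eqF // b_gt0.
pose uu := dot u^T u.
have uu0 : 0 < uu.
  rewrite lt0r dot_trmx_eq0 dot_trmx_ge0 andbT; apply/eqP => u0.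
  have : secular n a (fun i => weight u i * bsqa i) = 0.
    apply: big1 => i _; rewrite /weight big1 ?mul0r ?scale0r // => j _.
    by rewrite u0 mxE expr0n.
  have := monic_neq0 (monic_prod_XsubC (index_iota 0 n.-1) xpredT y).
  move=> /negbTE pn; rewrite QE => /eqP; rewrite scaler_eq0 pn orbF.
  by rewrite mulf_eq0 pnatr_eq0 (gt_eqF q0).
pose sg := Num.sqrt uu.
have sg0 : 0 < sg by rewrite sqrtr_gt0.
pose z : 'cV[R]_M := col_mx u sg%:M.
have dotu : dot u^T (col_mx 0 1%:M) = 0.
  rewrite -[u]vsubmxK tr_col_mx /dot mul_row_col mulmx0 add0r mulmx1 [LHS]mxE.
  by rewrite !mxE /= addn0 odd_m.
have zz : lor z z = 0.
  have -> : lor z z = uu - sg * sg by exact: lor_col_mx.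
  by rewrite -expr2 sqr_sqrtr ?subrr // ltW.
have vv : lor v0 v0 = 0.
  transitivity (lor (col3 0 1 1) (col3 0 1 1)); first by [].
  by rewrite bil_col3 trmx0 !mx3E subrr.
have zv : lor z v0 = - sg.
  have -> : lor z v0 = dot u^T (col_mx 0 1%:M) - sg * 1 by exact: lor_col_mx.
  by rewrite dotu mulr1 sub0r.
have d1 : 0 < lor (z - v0) (z - v0).
  rewrite !(bilDl, bilDr, bilNl, bilNr) ?tr_I // zz vv (bilC _ v0) ?tr_I // zv.
  by move: sg0; lra.
(* A second reflection, fixing v0, restores the determinant. *)
pose d : 'cV[R]_M := col3 beta^T 0 0.
have d2 : 0 < lor d d by rewrite bil_col3 trmxK !mulr0 addr0 subr0.
have dv : lor d v0 = 0.
  transitivity (lor d (col3 0 1 1)); first by [].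
  by rewrite bil_col3 dot0r !mul0r addr0 subr0.
pose g := refl I d *m refl I (z - v0).
have Sg : SOe R m g by exact: SOe_refl_refl.
have gz : g *m z = v0.
  by rewrite -mulmxA refl_swap ?tr_I // ?zz ?vv // ?gt_eqF // refl_fix.
have zE : invmx g *m v0 = z by rewrite -gz mulKmx // O_unit //; exact: SOe_O.
have [alpha [Y1 [beta1 [gamma [Ys1 b10 Yb1 E]]]]] := orbit_normal_form hm hn ha ha_n ha_0 Sg.
have Sg' := SOe_mul (expN_SOe alpha) Sg; have /SOeP[Og' dg' tg'] := Sg'.
have zE' : invmx (expN alpha *m g) *m v0 = z.
  by rewrite expN_coords // O_unit //; exact: SOe_O.
have [qq /(_ b10) chY1] := secular_char_poly hm Og' Yb1 E zE' QE.
have {}qq : dot beta beta^T = dot beta1 beta1^T.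
  by apply: (mulfI _ qq); rewrite pnatr_eq0.
have chY1' : char_poly (Y1^T *m Y1) =
    'X * \prod_(1 <= i < n.-1.+1) ('X - (x i ^+ 2)%:P) ^+ 2.
  by rewrite (char_poly_gram odd_m Ys1 chY1) big_add1.
have sgE : Num.sg (Pf (Z_Yb Y beta)) = Num.sg (Pf (Z_Yb Y1 beta1)).
  by rewrite sgY (sg_Pf_Z hm Og' tg' b10 E) dg' mul1r (prod_a_sg hm hn ha ha_n ha_0).
rewrite nE in chY.
have [k [[kk dk] kY kb]] := skew_conj mE x0 Ys Yb b0 Ys1 Yb1 b10 chY chY1' qq sgE.
have Mk : MAN R m (mk_k k).
  apply/MANP; split; [exact: O_mk_k|by rewrite det_mk_k|].
  by exists 1; rewrite // mk_k_v0 scale1r.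
exists (mk_k k *m (expN alpha *m g)), (gamma *m k^T); split.
  by apply: SOe_mul => //; exact: MAN_SOe.
have Ok := MAN_O Mk.
rewrite conj_torus_mul ?O_unit // E O_inv // /I_m1 /mk_k tr_mx3 X_Yb0_add.
rewrite !mul_mx3 X_Yb0_add !trmx0 !mx3E.
have kbt : beta1 *m k^T = beta by apply: trmx_inj; rewrite trmx_mul trmxK.
have kt (w : 'rV[R]_m) : k *m w^T = (w *m k^T)^T by rewrite trmx_mul trmxK.
by rewrite mulN1r opprK scale1r kY !kt !mulmxBl !mulmxDl kbt.
Qed.

(** The polynomial identity recovers the weights of the isotropic vector from
the image, and elements with equal weights differ by an element of the torus. *)
Lemma separate g1 g2 : SOe R m g1 -> SOe R m g2 -> pr (conj_torus g1) = pr (conj_torus g2) ->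
  exists2 p, MAN R m p & conj_torus g2 = p *m conj_torus g1 *m invmx p.
Proof.
move=> S1 S2 prE12.
have [alpha [Y [beta [gamma [Ys b0 Yb E1]]]]] := orbit_normal_form hm hn ha ha_n ha_0 S1.
have Ma := expN_MAN alpha; have Sa := expN_SOe alpha.
have u1 := O_unit (SOe_O S1); have u2 := O_unit (SOe_O S2).
have ua := O_unit (MAN_O Ma).
have T1 := SOe_mul Sa S1; have T2 := SOe_mul Sa S2.
set h1 := expN alpha *m g1 in E1 T1; set h2 := expN alpha *m g2 in T2.
have Xg := X_Yb0_in_g beta Ys.
have [delta E2] : exists delta, conj_torus h2 = X_Yb0 Y beta + X_ delta.
  apply: pr_eq => //; first by apply: conj_torus_in_g => //; exact: SOe_O.
  rewrite -(pr_addX gamma Xg) -E1 /h1 /h2 !conj_torus_mul //.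
  by rewrite -(coad_pr (conj_torus g1) Ma) -(coad_pr (conj_torus g2) Ma) prE12.
have [w1 [s1 [z1 s10 n1]]] := null_coords T1.
have [w2 [s2 [z2 s20 n2]]] := null_coords T2.
have O1 := SOe_O T1; have O2 := SOe_O T2.
have wE i : (i < n)%N -> weight w1 i = weight w2 i.
  move=> lin.
  have sE : secular n a (fun i => weight w1 i * bsqa i) =
            secular n a (fun i => weight w2 i * bsqa i).
    apply: poly_eq_on_neg => y y0.
    have [x xE xn] : exists2 x, y = - x ^+ 2 & x != 0.
      exists (Num.sqrt (- y)); last by rewrite gt_eqF // sqrtr_gt0 oppr_gt0.
      by rewrite sqr_sqrtr ?opprK // oppr_ge0 ltW.
    rewrite xE !horner_secular; congr (_ * _); apply: (mulfI xn).
    by rewrite -(secular_identity hm O1 Yb E1 z1) // -(secular_identity hm O2 Yb E2 z2).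
  have := congr1 (fun p : {poly R} => p.[bsqa i]) sE.
  rewrite !(horner_secular_bsq a _ lin) => /(mulIf _) h.
  have bn : bsqa i != 0 by rewrite gt_eqF // (bsq_gt0 ha ha_n ha_0 hn).
  apply: (mulIf bn); apply: h.
  have := alternating_gap ha ha_n ha_0 hn lin.
  by apply: contraTneq => ->; rewrite mulr0 ltxx.
have sE : s1 = s2.
  have ss : s1 ^+ 2 = s2 ^+ 2.
    rewrite n1 n2; have e (w : 'cV[R]_(m + 1)) : \sum_j w j 0 ^+ 2 = \sum_(i < n) weight w i.
      have := sum_weight hm w (fun=> 1); under eq_bigr do rewrite mulr1.
      by move=> ->; under eq_bigr do rewrite mulr1.
    by rewrite !e; apply: eq_bigr => i _; exact: wE.
  by move/eqP: ss; rewrite eqrXn2 // ?ltW // => /eqP.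
have an0 : \prod_(1 <= i < n.+1) a i != 0.
  by rewrite -sgr_eq0 (prod_a_sg hm hn ha ha_n ha_0) sgr_eq0 -normr_gt0.
have [k [kk dk kt ku]] := torus_transitive hm an0 wE.
pose K : 'M[R]_M := block_mx k 0 0 1%:M.
have KO : O_m1 R m K.
  rewrite /O_m1 /= /K I_block tr_block_mx !mulmx_block !trmx0 trmx1.
  by rewrite !(mulmx0, mul0mx, addr0, add0r, mulmx1, mul1mx) kk.
have dK : \det K = 1 by rewrite det_lblock dk det1 mulr1.
have Kt : conj_torus K = t.
  rewrite /conj_torus O_inv // /K tr_block_mx trmx0 trmx1 I_block torus_mx_block //.
  rewrite !mulmx_block !(mulmx0, mul0mx, addr0, add0r, mulmx1, mul1mx).
  by rewrite kt.
have Kz : K *m col_mx w1 s1%:M = col_mx w2 s2%:M.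
  by rewrite /K mul_block_col !mul0mx addr0 add0r mul1mx ku sE.
have uK := O_unit KO; have v1 := O_unit O1; have v2 := O_unit O2.
pose p := h2 *m K *m invmx h1.
have Mp : MAN R m p.
  apply/MANP; split.
  - by do 2?apply: O_mul => //; exact: O_invmx.
  - by rewrite det_mulmx det_mulmx det_inv dK (SOe_det T1) (SOe_det T2) invr1 !mulr1.
  - by exists 1; rewrite // scale1r /p -mulmxA z1 -mulmxA Kz -z2 mulKVmx.
have pE : conj_torus h2 = p *m conj_torus h1 *m invmx p.
  rewrite -(conj_torus_mul n a (O_unit (MAN_O Mp)) v1).
  by rewrite /p mulmxKV // (conj_torus_mul n a v2 uK) Kt.
exists (invmx (expN alpha) *m p *m expN alpha).
  by do 2?apply: MAN_mul => //; exact: MAN_inv.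
have up := O_unit (MAN_O Mp); have uia : invmx (expN alpha) \in unitmx by rewrite unitmx_inv.
have g2E : g2 = invmx (expN alpha) *m h2 by rewrite mulKmx.
have ip : invmx (invmx (expN alpha) *m p *m expN alpha) =
    invmx (expN alpha) *m invmx p *m expN alpha.
  have uap : invmx (expN alpha) *m p \in unitmx by rewrite unitmx_mul uia.
  by rewrite (invmx_mul uap ua) (invmx_mul uia up) invmxK !mulmxA.
rewrite ip {1}g2E (conj_torus_mul n a uia v2) pE /h1 (conj_torus_mul n a ua u1) invmxK.
by rewrite !mulmxA.
Qed.

End Main2.

(** * The moment map on P-orbits *)

Section ParabolicOrbits.
Variables (R : realType) (m : nat) (G : topologicalGroupType).
Variable pi : G -> 'M[R]_(m + 1 + 1).
Hypothesis hpi : two_fold_covering pi (SOe R m).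
Local Notation M := (m + 1 + 1)%N.
Implicit Types (X p : 'M[R]_M) (V : {vspace 'M[R]_M}).

Lemma covering_surj X : SOe R m X -> exists g, pi g = X.
Proof.
move=> SX; have [U [s [[_ UX] _ _ piK _]]] := cover_even hpi SX.
by exists (s true X); apply: piK.
Qed.

Lemma P_orbitE V (xi eta : dual V) :
  orbit_of pi (P_ pi) xi eta <-> exists2 p, MAN R m p & coad p xi = eta.
Proof.
split=> [[g Pg <-] | [p Mp <-]]; first by exists (pi g).
have [g gE] := covering_surj (MAN_SOe Mp).
by exists g; rewrite ?gE //= /P_ /= gE.
Qed.

Lemma coad_MAN_mul V p p' (xi : dual V) : MAN R m p -> MAN R m p' ->
  (forall r X, MAN R m r -> X \in V -> invmx r *m X *m r \in V) ->
  coad (p *m p') xi = coad p (coad p' xi).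
Proof.
move=> Mp Mp' VM; apply: coad_mul => [||X XV]; last exact: VM.
- by apply: O_unit; exact: MAN_O.
- by apply: O_unit; exact: MAN_O.
Qed.

Lemma coadK V p (xi : dual V) : MAN R m p ->
  (forall r X, MAN R m r -> X \in V -> invmx r *m X *m r \in V) ->
  coad (invmx p) (coad p xi) = xi.
Proof.
move=> Mp VM; rewrite -coad_MAN_mul //; last exact: MAN_inv.
by rewrite mulVmx ?coad1 // O_unit //; exact: MAN_O.
Qed.

Lemma P_orbit_refl V (xi : dual V) : orbit_of pi (P_ pi) xi xi.
Proof. by apply/P_orbitE; exists 1%:M; rewrite ?coad1 //; exact: MAN_1. Qed.

Lemma P_orbit_sub V (xi eta : dual V) :
  (forall r X, MAN R m r -> X \in V -> invmx r *m X *m r \in V) ->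
  orbit_of pi (P_ pi) xi eta -> orbit_of pi (P_ pi) eta `<=` orbit_of pi (P_ pi) xi.
Proof.
move=> VM /P_orbitE[p Mp <-] zeta /P_orbitE[r Mr <-]; apply/P_orbitE.
by exists (r *m p); [exact: MAN_mul|rewrite coad_MAN_mul].
Qed.

Lemma P_orbit_sym V (xi eta : dual V) :
  (forall r X, MAN R m r -> X \in V -> invmx r *m X *m r \in V) ->
  orbit_of pi (P_ pi) xi eta -> orbit_of pi (P_ pi) eta xi.
Proof.
move=> VM /P_orbitE[p Mp <-]; apply/P_orbitE.
by exists (invmx p); [exact: MAN_inv|rewrite coadK].
Qed.

Lemma P_orbit_eq V (xi eta : dual V) :
  (forall r X, MAN R m r -> X \in V -> invmx r *m X *m r \in V) ->
  orbit_of pi (P_ pi) xi eta -> orbit_of pi (P_ pi) eta = orbit_of pi (P_ pi) xi.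
Proof.
move=> VM xe; apply/seteqP; split; first exact: P_orbit_sub.
by apply: P_orbit_sub => //; exact: P_orbit_sym.
Qed.

Lemma MAN_g r X : MAN R m r -> X \in g_ R m -> invmx r *m X *m r \in g_ R m.
Proof. by move=> /MAN_O; exact: g_conjV. Qed.

Lemma MAN_p r X : MAN R m r -> X \in p_ R m -> invmx r *m X *m r \in p_ R m.
Proof. exact: p_conjV. Qed.

(** Pairing with [X_ beta], an element of n, gives a multiple of the squared
length of [beta]. *)
Lemma pr_depth_one Y beta : beta != 0 -> ~ l_dual R m (pr (X_Yb0 Y beta)).
Proof.
move=> b0 /(_ (vsproj _ (X_ beta))).
have Xp : X_ beta \in p_ R m.
  apply/pP; exists 0, 0, beta; rewrite trmx0 oppr0; split=> //.
rewrite prE vsprojK // => /(_ _) h.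
have {h} : 2^-1 * \tr (X_Yb0 Y beta *m X_ beta) = 0.
  by apply: h; apply/nP; exists beta.
have -> : X_Yb0 Y beta = mk_g Y beta^T beta^T 0 by rewrite /mk_g trmxK.
rewrite (_ : X_ beta = mk_p 0 0 beta) // mk_g_p_trace mulmx0 mxtrace0 dotDr.
have : 0 < dot beta beta^T by rewrite lt0r dotxx_eq0 b0 dotxx_ge0.
lra.
Qed.

End ParabolicOrbits.

Theorem proposition4p9 (R : realType) (n : nat) (hn : (2 <= n)%N)
    (G : topologicalGroupType) (pi : G -> 'M[R]_(n.*2.-1 + 1 + 1))
    (hpi : two_fold_covering pi (SOe R n.*2.-1))
    (a : nat -> R)
    (ha : forall i, (1 <= i)%N -> (i.+1 < n)%N -> a i.+1 < a i)
    (ha_n : `|a n| < a n.-1) (ha_0 : 0 < `|a n|) :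
  let f : dual (g_ R n.*2.-1) := iota_ (skew_diag (n.*2.-1 + 1 + 1) n a) in
  let O_f : set (dual (g_ R n.*2.-1)) := orbit_of pi [set: G] f in
  let q : dual (g_ R n.*2.-1) -> dual (p_ R n.*2.-1) :=
    @restr R n.*2.-1 in
  q @` O_f =
    \bigcup_(O in [set O : set (dual (p_ R n.*2.-1)) |
       [/\ is_P_orbit pi O, depth_one O &
           exists x : nat -> R,
             orbit_type n O x (Num.sg (a n)) /\
             [/\ forall i, (1 <= i)%N -> (i < n)%N -> x i <= a i,
                 forall i, (1 <= i)%N -> (i.+1 < n)%N -> a i.+1 <= x i &
                 `|a n| <= x n.-1]]]) O
  /\
  (forall O1 O2 : set (dual (g_ R n.*2.-1)),
     is_P_orbit pi O1 -> is_P_orbit pi O2 ->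
     O1 `<=` O_f -> O2 `<=` O_f -> O1 <> O2 ->
     [/\ is_P_orbit pi (q @` O1), is_P_orbit pi (q @` O2) &
         q @` O1 <> q @` O2]).
Proof.
have hm : (n.*2.-1 + 1 = n.*2)%N by lia.
move: (n.*2.-1) hm pi hpi => m hm pi hpi f O_f q.
have O_fE xi : O_f xi <-> exists2 g, SOe R m g & xi = iota_ (conj_torus n a g).
  split=> [[g _ <-] | [g Sg ->]].
    have Sg := cover_range hpi g; exists (pi g) => //.
    by rewrite coad_iota //; exact: SOe_O.
  have [h hE] := covering_surj hpi Sg; exists h => //.
  by rewrite hE coad_iota //; exact: SOe_O.
have gMAN := @MAN_g R m; have pMAN := @MAN_p R m.
split.
  apply/seteqP; split=> [_ [_ /O_fE[g Sg ->] <-] | eta [ Orb [[xi OE] _ [x [tx [xa ax anx]]]] Oeta]].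
    have [alpha [Y [beta [gamma [x [[Ys b0 Yb] E [xd sv] sgE xI]]]]]] :=
      image_type hm hn ha ha_n ha_0 Sg.
    have Ma := expN_MAN alpha; have gu := O_unit (SOe_O Sg).
    have ua := O_unit (MAN_O Ma).
    exists (orbit_of pi (P_ pi) (pr (X_Yb0 Y beta))); last first.
      apply: (P_orbit_sym hpi pMAN); apply/(P_orbitE hpi).
      exists (expN alpha) => //.
      by rewrite -/(pr _) coad_pr // -conj_torus_mul // E pr_addX // X_Yb0_in_g.
    split.
    - by exists (pr (X_Yb0 Y beta)).
    - by move=> /(_ _ (P_orbit_refl hpi _)); exact: pr_depth_one.
    - exists x; split=> //; exists Y, beta; split=> //.
        by split=> //; exact/soP.
      exact: P_orbit_refl.
  have [Y [beta [[/soP Ys b0 Yb] OX xd sv sgE]]] := tx.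
  have [g [gamma [Sg gE]]] := realize hm hn ha ha_n ha_0 Ys b0 Yb sv sgE xa ax anx.
  have prgE : pr (conj_torus n a g) = pr (X_Yb0 Y beta).
    by rewrite gE pr_addX // X_Yb0_in_g.
  have /(P_orbitE hpi) [p Mp <-] : orbit_of pi (P_ pi) (pr (X_Yb0 Y beta)) eta.
    by rewrite OE in OX Oeta; rewrite (P_orbit_eq hpi pMAN OX).
  rewrite -prgE coad_pr // -conj_torus_mul; last first.
  - exact: O_unit (SOe_O Sg).
  - exact: O_unit (MAN_O Mp).
  exists (iota_ (conj_torus n a (p *m g))) => //; apply/O_fE.
  by exists (p *m g) => //; apply: SOe_mul => //; exact: MAN_SOe.
have q_orbit g : SOe R m g ->
    q @` orbit_of pi (P_ pi) (iota_ (conj_torus n a g)) =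
    orbit_of pi (P_ pi) (pr (conj_torus n a g)).
  move=> Sg; apply/seteqP; split=> [_ [_ /(P_orbitE hpi) [p Mp <-] <-] | _ /(P_orbitE hpi) [p Mp <-]].
    apply/(P_orbitE hpi); exists p => //.
    by rewrite coad_iota ?coad_pr //; exact: MAN_O.
  exists (coad p (iota_ (conj_torus n a g))); first by apply/(P_orbitE hpi); exists p.
  by rewrite coad_iota ?coad_pr //; exact: MAN_O.
move=> O1 O2 [xi1 E1] [xi2 E2] sub1 sub2 ne.
have /sub1/O_fE[g1 S1 xi1E] : O1 xi1 by rewrite E1; exact: P_orbit_refl.
have /sub2/O_fE[g2 S2 xi2E] : O2 xi2 by rewrite E2; exact: P_orbit_refl.
rewrite E1 E2 xi1E xi2E !q_orbit //; split.
- by exists (pr (conj_torus n a g1)).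
- by exists (pr (conj_torus n a g2)).
move=> eqO; apply: ne; rewrite E1 E2 xi1E xi2E.
have : orbit_of pi (P_ pi) (pr (conj_torus n a g2)) (pr (conj_torus n a g1)).
  by rewrite -eqO; exact: P_orbit_refl.
move=> /(P_orbitE hpi) [p Mp]; rewrite coad_pr //.
have Op := MAN_O Mp; have Sp := MAN_SOe Mp.
rewrite -conj_torus_mul; last first.
- exact: O_unit (SOe_O S2).
- exact: O_unit.
move=> prE; have [r Mr] := separate hm hn ha ha_n ha_0 S1 (SOe_mul Sp S2) (esym prE).
rewrite conj_torus_mul; last first.
- exact: O_unit (SOe_O S2).
- exact: O_unit.
move=> /(congr1 (@iota_ R m)).
rewrite -(coad_iota (conj_torus n a g2) Op) -(coad_iota (conj_torus n a g1) (MAN_O Mr)).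
move=> cE; transitivity (orbit_of pi (P_ pi) (coad p (iota_ (conj_torus n a g2)))).
  rewrite cE; apply/esym/(P_orbit_eq hpi gMAN); apply/(P_orbitE hpi).
  by exists r.
by apply: (P_orbit_eq hpi gMAN); apply/(P_orbitE hpi); exists p.
Qed.
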